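(* Let $G=(V,E)$ be a connected unimodular transitive graph with maximum degree at most $M$ satisfying $(\mathrm{HK}_{\gamma,c})$ for some $c>0$ and $\gamma>1/2$. Then for every $0\le\beta<(2\gamma-1)/\gamma$ there exists a constant $C(\beta)=C(\beta,\gamma,M,c)<\infty$ such that \[\mathbf E_p\exp\left[\log^\beta|K_v|\right]\le C(\beta)\] for every $v\in V$ and every $p\le p_c(G)$.
   Context: Bernoulli bond percolation with parameter $p$: each edge retained independently with probability $p$; the resulting subgraph is $\omega_p$, with law $\mathbf P_p$ and expectation $\mathbf E_p$. $K_v$ is the cluster (connected component) of $v$ in $\omega_p$, $|K_v|$ its number of vertices (with $\exp[\log^\beta\infty]=\infty$). $p_c(G)=\inf\{p:\omega_p\text{ has an infinite cluster a.s.}\}$. Transitive: $\mathrm{Aut}(G)$ acts on $V$ with a single orbit. Unimodular: $|\mathrm{Stab}_u v|=|\mathrm{Stab}_v u|$ for all $u,v$ in the same orbit, where $\mathrm{Stab}_u v$ is the orbit of $v$ under the stabilizer of $u$ in $\mathrm{Aut}(G)$. $(\mathrm{HK}_{\gamma,c})$: $p_n(v,v)\le\exp[-cn^\gamma]$ for all $v\in V$, $n\ge 1$, where $p_n(v,v)$ is the $n$-step return probability of simple random walk. *)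

(* Defs.v *)
(* Stdlib reals, classical logic.
   Bernoulli bond percolation on a locally finite graph is encoded through its
   finite-dimensional (cylinder) marginals: every event used below depends on
   finitely many edges, and its P_p-probability is computed exactly as the
   product-measure sum over the states of those edges. *)
From Stdlib Require Import Reals List Classical ClassicalDescription Relations.
Import ListNotations.
Open Scope R_scope.

Section Percolation.
Context {V : Type} (nb : V -> list V).

Definition adj (x y : V) : Prop := In y (nb x).
Definition deg (v : V) : nat := length (nb v).

Definition connected_graph : Prop := forall u v, clos_refl_trans V adj u v.

Definition is_aut (f : V -> V) : Prop :=
  (exists g : V -> V, (forall x, g (f x) = x) /\ (forall y, f (g y) = y)) /\
  (forall x y, adj x y <-> adj (f x) (f y)).

Definition transitive_graph : Prop :=
  forall u v, exists f, is_aut f /\ f u = v.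

Definition stab_orbit (u v : V) : V -> Prop :=
  fun w => exists f, is_aut f /\ f u = u /\ f v = w.

Definition has_card (A : V -> Prop) (n : nat) : Prop :=
  exists L : list V, NoDup L /\ length L = n /\ (forall x, In x L <-> A x).

(* |Stab_u v| = |Stab_v u| (as cardinalities; all vertices lie in one orbit) *)
Definition unimodular : Prop :=
  forall u v n, has_card (stab_orbit u v) n <-> has_card (stab_orbit v u) n.

Definition ind (P : Prop) : R := if excluded_middle_informative P then 1 else 0.

Fixpoint walk_prob (n : nat) (x y : V) : R :=
  match n with
  | O => ind (x = y)
  | S k => fold_right Rplus 0
             (map (fun z => / INR (deg x) * walk_prob k z y) (nb x))
  end.

Definition HK (gamma c : R) : Prop :=
  forall v (n : nat), (1 <= n)%nat ->
    walk_prob n v v <= exp (- c * Rpower (INR n) gamma).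

(* a configuration: w x y = true iff the edge {x,y} is open *)
Definition config := V -> V -> bool.

Definition same_edge (x y a b : V) : Prop := (a = x /\ b = y) \/ (a = y /\ b = x).

Definition upd (w : config) (x y : V) (bv : bool) : config :=
  fun a b => if excluded_middle_informative (same_edge x y a b) then bv else w a b.

Definition edge_eqb (e f : V * V) : bool :=
  if excluded_middle_informative (same_edge (fst e) (snd e) (fst f) (snd f))
  then true else false.

Fixpoint dedup_edges (l : list (V * V)) : list (V * V) :=
  match l with
  | [] => []
  | e :: l' => if existsb (edge_eqb e) l' then dedup_edges l' else e :: dedup_edges l'
  end.

Definition inb (S : list V) (y : V) : bool :=
  if excluded_middle_informative (In y S) then true else false.

Definition edges_in (S : list V) : list (V * V) :=
  dedup_edges (flat_map (fun x => map (fun y => (x, y)) (filter (inb S) (nb x))) S).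

(* product-measure probability of the event Q, where each edge of Es is
   open with probability p independently (all other edges closed in w;
   Q will only depend on the edges of Es) *)
Fixpoint cyl_prob (p : R) (Es : list (V * V)) (Q : config -> Prop) (w : config) : R :=
  match Es with
  | [] => ind (Q w)
  | e :: Es' => p * cyl_prob p Es' Q (upd w (fst e) (snd e) true)
              + (1 - p) * cyl_prob p Es' Q (upd w (fst e) (snd e) false)
  end.

Definition Pcyl (p : R) (S : list V) (Q : config -> Prop) : R :=
  cyl_prob p (edges_in S) Q (fun _ _ => false).

Fixpoint ball (v : V) (n : nat) : list V :=
  match n with
  | O => [v]
  | S k => ball v k ++ flat_map nb (ball v k)
  end.

Definition open_conn (w : config) : V -> V -> Prop :=
  clos_refl_trans V (fun a b => w a b = true).

Definition cluster_ge (w : config) (v : V) (n : nat) : Prop :=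
  exists L : list V, NoDup L /\ length L = n /\ (forall x, In x L -> open_conn w v x).

(* P_p(|K_v| >= n): this event is determined by the edges inside ball v n *)
Definition P_cluster_ge (p : R) (v : V) (n : nat) : R :=
  Pcyl p (ball v n) (fun w => cluster_ge w v n).

Definition P_union_ge (p : R) (F : list V) (n : nat) : R :=
  Pcyl p (flat_map (fun u => ball u n) F)
       (fun w => exists u, In u F /\ cluster_ge w u n).

(* omega_p has an infinite cluster almost surely:
   P(exists u, |K_u| = oo) = sup_F lim_n P(exists u in F, |K_u| >= n) = 1 *)
Definition as_infinite_cluster (p : R) : Prop :=
  forall eps, 0 < eps -> exists F : list V, forall n, P_union_ge p F n >= 1 - eps.

(* p <= p_c(G) = inf {q : omega_q has an infinite cluster a.s.} *)
Definition le_pc (p : R) : Prop :=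
  forall q, 0 <= q <= 1 -> as_infinite_cluster q -> p <= q.

Definition rpow (x b : R) : R :=
  if Req_EM_T x 0 then (if Req_EM_T b 0 then 1 else 0) else Rpower x b.

Definition f_beta (beta : R) (n : nat) : R := exp (rpow (ln (INR n)) beta).

(* E_p exp[log^beta |K_v|] <= C, with exp[log^beta oo] = oo:
   P_p(|K_v| = oo) = lim_n P_p(|K_v| >= n) = 0, and
   sum_{n>=1} P_p(|K_v| = n) exp[log^beta n] <= C *)
Definition exp_moment_le (p : R) (v : V) (beta C : R) : Prop :=
  (forall eps, 0 < eps -> exists n : nat, P_cluster_ge p v n < eps) /\
  (forall N : nat,
     fold_right Rplus 0
       (map (fun n => (P_cluster_ge p v n - P_cluster_ge p v (S n)) * f_beta beta n)
            (seq 1 N)) <= C).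

End Percolation.

(* Main.v *)
(* Write [psi n = P_p(|K_v| >= n)]. All events are cylinder events, so expectations are finite sums:
   [ex p Es] composes the commuting operators averaging over the state of one edge.

   For [p < p_c] one has [psi n <= X / n]: by the argument of Duminil-Copin and Tassion, either some
   finite set [S] has [phi p S v < 1], which makes the susceptibility finite, or infinite clusters
   exist almost surely at every [q > p].

   Two-ghost inequality: let [g] be the cluster weight [min(s/n, 1)] cut to [0] above [N]. Writing
   [p(1-p) E(f(w_e) - f(w^e)) = E((p - w_e) f)] for [f] the total weight of the clusters touching
   an edge [e], mass transport bounds the probability that [e] separates two clusters with sizes in
   [n, N] by [E(|Z| / max(n, |K_v|))], with [Z] the sum of [p - w_e] over the edges touching [K_v].
   As [Z] is the final value of an exploration martingale, this is [O(n^(-1/2))].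

   Random walk: for a finite set [K], [j -> <P^(2j) 1_K, 1_K>] is log-convex, so the heat kernel
   bound gives [<P^(2k) 1_K, 1_K> <= |K| exp(-c' k log^(1 - 1/gamma) |K|)]. By mass transport this
   controls the probability that the walk at time [2k] lies in [K_v]. Two clusters of size at least
   [n] joined by a path of length [2k] are either equal, or opening the path edge by edge meets the
   event of the two-ghost inequality. With [k] a small multiple of [log n] and Harris' inequality,
     [psi(n)^2 <= E(exp(-c' k log^(1 - 1/gamma) |K_v|); |K_v| >= n) + C n^(-eps)].
   If [F = E exp(log^b |K_v|)] with [b < 2 - 1/gamma], the right-hand side is at most
   [C (F + 1) exp(-c'' log^b' n)] for some [b' > b]; summing yields [F <= C sqrt(F + 1)], a bound that
   is uniform in [p < p_c] and passes to [p_c] by continuity of cylinder probabilities. *)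
From Stdlib Require Import Reals List Lra Lia Arith Classical ClassicalEpsilon
  ClassicalDescription FunctionalExtensionality Relations Permutation ZArith.
Require Import Defs.
Import ListNotations.
Open Scope R_scope.

(** * Finite sums and indicators *)

(** The inequality [F <= C sqrt(F + 1)] says nothing about an infinite [F], and the bound behind it
    has error terms for clusters above the cutoff [N]; this is why the work is done strictly below
    [p_c]. There the tail [X / n] makes [F] finite, because [exp(log^b n)] grows slower than any
    power of [n] when [b < 1], and it sends the cutoff errors to [0]. The number [X] is not uniform
    in [p], but it does not enter the final constant. Opening a path of length [2k] costs [p^(-2k)],
    so [k] can only be a small multiple of [log n] and [p] must stay away from [0]; if [p] times the
    degree is at most [1/2], a one-point set has [phi <= 1/2] and gives a uniform tail. The range of
    [b] comes from minimising [k L^(-a) + L^b] over [L], with [a = 1/gamma - 1]: the minimum has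
    order [k^(b/(a+b))], and this exponent exceeds [b] exactly when [a + b < 1]. For [gamma > 1] the
    heat kernel bound contradicts a walk going back and forth along one edge, so the graph has no
    edge. Sizes are grouped by powers of [4] to make square roots powers of [2]. *)

Definition sum {A : Type} (l : list A) (f : A -> R) : R := fold_right Rplus 0 (map f l).

Lemma eqdec {A : Type} (x y : A) : {x = y} + {x <> y}.
Proof. apply excluded_middle_informative. Qed.

Lemma sum_cons {A} (x : A) l f : sum (x :: l) f = f x + sum l f.
Proof. reflexivity. Qed.

Lemma sum_app {A} (l l' : list A) f : sum (l ++ l') f = sum l f + sum l' f.
Proof.
  induction l as [|x l IH]; simpl.
  - unfold sum; simpl; lra.
  - rewrite !sum_cons, IH; lra.
Qed.

Lemma sum_le {A} (l : list A) f g :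
  (forall x, In x l -> f x <= g x) -> sum l f <= sum l g.
Proof.
  induction l as [|x l IH]; intros H.
  - unfold sum; simpl; lra.
  - rewrite !sum_cons. apply Rplus_le_compat.
    + apply H; left; reflexivity.
    + apply IH; intros y Hy; apply H; right; exact Hy.
Qed.

Lemma sum_ext {A} (l : list A) f g :
  (forall x, In x l -> f x = g x) -> sum l f = sum l g.
Proof.
  intros H; apply Rle_antisym; apply sum_le; intros x Hx; rewrite (H x Hx); lra.
Qed.

Lemma sum_plus {A} (l : list A) f g : sum l (fun x => f x + g x) = sum l f + sum l g.
Proof.
  induction l as [|x l IH]; [unfold sum; simpl; lra|]. rewrite !sum_cons, IH; lra.
Qed.

Lemma sum_scal {A} (l : list A) c f : sum l (fun x => c * f x) = c * sum l f.
Proof.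
  induction l as [|x l IH]; [unfold sum; simpl; lra|]. rewrite !sum_cons, IH; lra.
Qed.

Lemma sum_scal_r {A} (l : list A) c f : sum l (fun x => f x * c) = sum l f * c.
Proof.
  rewrite Rmult_comm, <- sum_scal. apply sum_ext; intros; lra.
Qed.

Lemma sum_const {A} (l : list A) c : sum l (fun _ => c) = INR (length l) * c.
Proof.
  induction l as [|x l IH]; [unfold sum; simpl; lra|].
  rewrite sum_cons, IH. simpl length. rewrite S_INR. lra.
Qed.

Lemma sum_0 {A} (l : list A) f : (forall x, In x l -> f x = 0) -> sum l f = 0.
Proof.
  intros H. rewrite (sum_ext l f (fun _ => 0) H), sum_const; lra.
Qed.

Lemma sum_nonneg {A} (l : list A) f : (forall x, In x l -> 0 <= f x) -> 0 <= sum l f.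
Proof.
  intros H. rewrite <- (sum_0 l (fun _ => 0)) by reflexivity. apply sum_le; exact H.
Qed.

Lemma sum_swap {A B} (l : list A) (l' : list B) f :
  sum l (fun x => sum l' (f x)) = sum l' (fun y => sum l (fun x => f x y)).
Proof.
  induction l as [|x l IH].
  - symmetry; apply sum_0; reflexivity.
  - rewrite sum_cons, IH, <- sum_plus. reflexivity.
Qed.

Lemma sum_perm {A} (l l' : list A) f : Permutation l l' -> sum l f = sum l' f.
Proof.
  induction 1; rewrite ?sum_cons; [reflexivity|lra|lra|lra].
Qed.

Lemma sum_map {A B} (h : A -> B) l f : sum (map h l) f = sum l (fun x => f (h x)).
Proof. unfold sum. rewrite map_map. reflexivity. Qed.

Lemma sum_flat_map {A B} (h : A -> list B) l f :
  sum (flat_map h l) f = sum l (fun x => sum (h x) f).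
Proof.
  induction l as [|x l IH]; [reflexivity|].
  simpl. rewrite sum_app, IH. reflexivity.
Qed.

Lemma sum_ge_term {A} (l : list A) f x :
  (forall y, In y l -> 0 <= f y) -> In x l -> f x <= sum l f.
Proof.
  intros H Hx. apply in_split in Hx. destruct Hx as [l1 [l2 ->]].
  rewrite sum_app, sum_cons.
  assert (0 <= sum l1 f) by (apply sum_nonneg; intros; apply H; apply in_or_app; auto).
  assert (0 <= sum l2 f) by (apply sum_nonneg; intros; apply H; apply in_or_app; simpl; auto).
  lra.
Qed.

Lemma ind_true (P : Prop) : P -> ind P = 1.
Proof. intros H; unfold ind; destruct (excluded_middle_informative P); [reflexivity|contradiction]. Qed.

Lemma ind_false (P : Prop) : ~ P -> ind P = 0.
Proof. intros H; unfold ind; destruct (excluded_middle_informative P); [contradiction|reflexivity]. Qed.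

Lemma ind_bound (P : Prop) : 0 <= ind P <= 1.
Proof. unfold ind; destruct (excluded_middle_informative P); lra. Qed.

Lemma ind_le (P Q : Prop) : (P -> Q) -> ind P <= ind Q.
Proof.
  intros H. destruct (classic P) as [HP|HP].
  - rewrite (ind_true P HP), (ind_true Q (H HP)); lra.
  - rewrite (ind_false P HP). apply ind_bound.
Qed.

Lemma ind_iff (P Q : Prop) : (P <-> Q) -> ind P = ind Q.
Proof. intros H; apply Rle_antisym; apply ind_le; tauto. Qed.

Lemma ind_and (P Q : Prop) : ind (P /\ Q) = ind P * ind Q.
Proof.
  unfold ind; repeat destruct excluded_middle_informative; try lra; tauto.
Qed.

Lemma ind_not (P : Prop) : ind (~ P) = 1 - ind P.
Proof.
  unfold ind; repeat destruct excluded_middle_informative; try lra; tauto.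
Qed.

Lemma ind_mul_le (P : Prop) c : 0 <= c -> ind P * c <= c.
Proof. intros H; pose proof (ind_bound P). nra. Qed.

Lemma sum_pick {A} (l : list A) x f :
  NoDup l -> In x l -> sum l (fun y => ind (x = y) * f y) = f x.
Proof.
  intros Hn Hx. apply in_split in Hx. destruct Hx as [l1 [l2 ->]].
  rewrite sum_app, sum_cons, ind_true by reflexivity.
  apply NoDup_remove_2 in Hn.
  rewrite (sum_0 l1), (sum_0 l2); [lra| |];
    intros y Hy; rewrite ind_false; try lra; intros <-; apply Hn, in_or_app; auto.
Qed.

Lemma sum_filter {A} (l : list A) (b : A -> bool) f :
  sum (filter b l) f = sum l (fun x => ind (b x = true) * f x).
Proof.
  induction l as [|x l IH]; [reflexivity|]. simpl filter. rewrite sum_cons.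
  destruct (b x) eqn:E.
  - rewrite sum_cons, IH, ind_true by reflexivity; lra.
  - rewrite IH, ind_false by congruence; lra.
Qed.

Lemma sum_incl {A} (l l' : list A) f :
  NoDup l -> incl l l' -> (forall x, In x l' -> 0 <= f x) -> sum l f <= sum l' f.
Proof.
  revert l'. induction l as [|x l IH]; intros l' Hn Hi Hf.
  - apply sum_nonneg; exact Hf.
  - assert (Hx : In x l') by (apply Hi; left; reflexivity).
    apply in_split in Hx. destruct Hx as [l1 [l2 ->]].
    rewrite sum_app, !sum_cons. inversion_clear Hn.
    assert (sum l f <= sum (l1 ++ l2) f).
    { apply IH; auto.
      - intros y Hy. assert (In y (l1 ++ x :: l2)) by (apply Hi; right; exact Hy).
        apply in_app_or in H1. apply in_or_app. destruct H1 as [?|[?|?]]; auto.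
        subst; contradiction.
      - intros y Hy; apply Hf. apply in_app_or in Hy. apply in_or_app. simpl; tauto. }
    rewrite sum_app in H1. lra.
Qed.

Lemma sum_support {A} (l l' : list A) f :
  NoDup l -> NoDup l' -> (forall x, f x <> 0 -> (In x l <-> In x l')) ->
  sum l f = sum l' f.
Proof.
  intros Hn Hn' Hf.
  assert (Hfil : forall k : list A, sum k f = sum (filter (fun x => if Req_EM_T (f x) 0 then false else true) k) f).
  { intros k. rewrite sum_filter. apply sum_ext. intros x _.
    destruct (Req_EM_T (f x) 0) as [E|E].
    - rewrite E; lra.
    - rewrite ind_true by reflexivity; lra. }
  rewrite (Hfil l), (Hfil l'). apply sum_perm, NoDup_Permutation; try (apply NoDup_filter; assumption).
  intros x. rewrite !filter_In. destruct (Req_EM_T (f x) 0) as [E|E].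
  - split; intros [_ ?]; discriminate.
  - pose proof (Hf x E); tauto.
Qed.

Lemma sum_ind_count {A} (l : list A) (P : A -> Prop) n :
  (exists L, NoDup L /\ length L = n /\ forall x, In x L -> In x l /\ P x) ->
  INR n <= sum l (fun x => ind (P x)).
Proof.
  intros [L [Hn [Hl HL]]].
  apply Rle_trans with (sum L (fun x => ind (P x))).
  - rewrite (sum_ext L _ (fun _ => 1)), sum_const, Hl; [lra|].
    intros x Hx. apply ind_true. apply HL, Hx.
  - apply sum_incl; auto; [intros x Hx; apply HL, Hx| intros; apply ind_bound].
Qed.

(** * Expectation over a finite set of edges *)

Section Expectation.
Context {V : Type}.

Definition avg (p : R) (e : V * V) (f : @config V -> R) (w : config) : R :=
  p * f (upd w (fst e) (snd e) true) + (1 - p) * f (upd w (fst e) (snd e) false).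

(** The result is again a function of the configuration: the conditional expectation of [f] given
    the states of the edges outside [Es]. Edges listed twice do no harm, by [avg_idem]. *)
Fixpoint ex (p : R) (Es : list (V * V)) (f : @config V -> R) : config -> R :=
  match Es with
  | [] => f
  | e :: Es' => avg p e (ex p Es' f)
  end.

Definition w0 : @config V := fun _ _ => false.

Lemma cyl_prob_ex p Es Q w : cyl_prob p Es Q w = ex p Es (fun w' => ind (Q w')) w.
Proof.
  revert w; induction Es as [|e Es IH]; intros w; [reflexivity|].
  simpl. rewrite !IH. reflexivity.
Qed.

Lemma same_edge_sym (x y a b : V) : same_edge x y a b -> same_edge a b x y.
Proof. unfold same_edge; intuition congruence. Qed.

Lemma same_edge_swap (x y a b : V) : same_edge x y a b -> same_edge x y b a.
Proof. unfold same_edge; intuition congruence. Qed.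

Lemma same_edge_trans (x y a b c d : V) :
  same_edge x y a b -> same_edge a b c d -> same_edge x y c d.
Proof. unfold same_edge; intuition congruence. Qed.

Lemma upd_same (w : config) (x y a b : V) v : same_edge x y a b -> upd w x y v a b = v.
Proof. intros H; unfold upd; destruct excluded_middle_informative; [reflexivity|contradiction]. Qed.

Lemma upd_diff (w : config) (x y a b : V) v : ~ same_edge x y a b -> upd w x y v a b = w a b.
Proof. intros H; unfold upd; destruct excluded_middle_informative; [contradiction|reflexivity]. Qed.

Lemma upd_comm (w : config) (x y a b : V) u v : ~ same_edge x y a b ->
  upd (upd w x y u) a b v = upd (upd w a b v) x y u.
Proof.
  intros H. do 2 (apply functional_extensionality; intro).
  unfold upd; repeat destruct excluded_middle_informative; try reflexivity.
  exfalso; apply H. eapply same_edge_trans; [eassumption|]. apply same_edge_sym; assumption.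
Qed.

Lemma upd_upd (w : config) (x y a b : V) u v : same_edge x y a b ->
  upd (upd w x y u) a b v = upd w x y v.
Proof.
  intros H. do 2 (apply functional_extensionality; intro).
  unfold upd; repeat destruct excluded_middle_informative; try reflexivity; exfalso.
  - apply n. eapply same_edge_trans; eassumption.
  - apply n. eapply same_edge_trans; [apply same_edge_sym|]; eassumption.
Qed.

Lemma upd_id (w : config) (x y : V) v : w x y = v -> w y x = v -> upd w x y v = w.
Proof.
  intros H H'. do 2 (apply functional_extensionality; intro).
  unfold upd; destruct excluded_middle_informative as [[[-> ->]|[-> ->]]|]; congruence.
Qed.

Lemma upd_edge (w : config) (x y a b : V) v : same_edge x y a b -> upd w a b v = upd w x y v.
Proof. unfold same_edge; intros [[-> ->]|[-> ->]]; [reflexivity|].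
  do 2 (apply functional_extensionality; intro).
  unfold upd; repeat destruct excluded_middle_informative; try reflexivity; exfalso;
  unfold same_edge in *; tauto.
Qed.

Lemma avg_comm p e e' f : avg p e (avg p e' f) = avg p e' (avg p e f).
Proof.
  apply functional_extensionality; intros w. unfold avg.
  destruct (classic (same_edge (fst e) (snd e) (fst e') (snd e'))) as [H|H].
  - pose proof (same_edge_sym _ _ _ _ H) as H'. rewrite !upd_upd by assumption.
    rewrite !(upd_edge w _ _ _ _ _ H). lra.
  - assert (H' : ~ same_edge (fst e') (snd e') (fst e) (snd e)) by (intro; apply H, same_edge_sym; assumption).
    rewrite !(upd_comm w (fst e) (snd e) (fst e') (snd e')) by assumption. lra.
Qed.

Lemma ex_avg p e Es f : avg p e (ex p Es f) = ex p Es (avg p e f).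
Proof.
  induction Es as [|e' Es IH]; [reflexivity|]. simpl. rewrite avg_comm, IH. reflexivity.
Qed.

Lemma ex_swap p Es Es' f : ex p Es (ex p Es' f) = ex p Es' (ex p Es f).
Proof.
  induction Es as [|e Es IH]; [reflexivity|]. simpl. rewrite IH, ex_avg. reflexivity.
Qed.

Lemma avg_idem p e e' f : same_edge (fst e) (snd e) (fst e') (snd e') ->
  avg p e (avg p e' f) = avg p e f.
Proof.
  intros H. apply functional_extensionality; intros w. unfold avg.
  rewrite !upd_upd by assumption. lra.
Qed.

Lemma ex_plus p Es f g w : ex p Es (fun w => f w + g w) w = ex p Es f w + ex p Es g w.
Proof.
  revert w; induction Es as [|e Es IH]; intros w; [reflexivity|]. simpl. unfold avg. rewrite !IH. lra.
Qed.

Lemma ex_scal p Es c f w : ex p Es (fun w => c * f w) w = c * ex p Es f w.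
Proof.
  revert w; induction Es as [|e Es IH]; intros w; [reflexivity|]. simpl. unfold avg. rewrite !IH. lra.
Qed.

Lemma ex_cst p Es c w : ex p Es (fun _ => c) w = c.
Proof.
  revert w; induction Es as [|e Es IH]; intros w; [reflexivity|]. simpl. unfold avg. rewrite !IH. lra.
Qed.

End Expectation.

(** * Valid configurations, dependence on sets of edges, independence *)

Section Graph.
Context {V : Type} (nb : V -> list V).
Context (nb_sym : forall v w, In w (nb v) -> In v (nb w)).

Notation adj := (adj nb).

Definition valid (w : config) : Prop :=
  (forall a b, w a b = w b a) /\ (forall a b, w a b = true -> adj a b).

Definition supp (S : list V) (w : config) : Prop :=
  forall a b, w a b = true -> In a S /\ In b S.

(** Tested on valid configurations only: in others the two orientations of an edge may disagree, and
    reading one of them is not reading the edge. *)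
Definition dep (A : V -> V -> Prop) (f : @config V -> R) : Prop :=
  forall w w', valid w -> valid w' ->
    (forall a b, adj a b -> A a b -> w a b = w' a b) -> f w = f w'.

Definition inside (S : list V) (a b : V) : Prop := In a S /\ In b S.

Definition covers (Es : list (V * V)) (A : V -> V -> Prop) : Prop :=
  forall a b, adj a b -> A a b -> exists e, In e Es /\ same_edge (fst e) (snd e) a b.

Definition all_adj (Es : list (V * V)) : Prop := forall e, In e Es -> adj (fst e) (snd e).

Lemma valid_w0 : valid w0.
Proof. split; [reflexivity|discriminate]. Qed.

Lemma supp_w0 S : supp S w0.
Proof. intros a b H; discriminate. Qed.

Lemma valid_upd w x y b : valid w -> adj x y -> valid (upd w x y b).
Proof.
  intros [H1 H2] Hxy. split.
  - intros a c. destruct (classic (same_edge x y a c)) as [H|H].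
    + rewrite !upd_same; auto using same_edge_swap.
    + rewrite !upd_diff; auto using same_edge_swap.
  - intros a c. unfold upd. destruct excluded_middle_informative as [[[-> ->]|[-> ->]]|]; intros H; auto.
    apply nb_sym; exact Hxy.
Qed.

Lemma supp_upd S w x y b : supp S w -> In x S -> In y S -> supp S (upd w x y b).
Proof.
  intros H Hx Hy a c. unfold upd.
  destruct excluded_middle_informative as [[[-> ->]|[-> ->]]|]; intros E; auto.
Qed.

Lemma dep_weaken (A B : V -> V -> Prop) f : (forall a b, adj a b -> A a b -> B a b \/ B b a) -> dep A f -> dep B f.
Proof.
  intros H Hf w w' Hw Hw' E. apply Hf; auto. intros a b Hab HA.
  destruct (H a b Hab HA) as [HB|HB]; [apply E; auto|].
  destruct Hw as [Hw _], Hw' as [Hw' _]. rewrite Hw, Hw'. apply E; auto. apply nb_sym; exact Hab.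
Qed.

Lemma dep_op2 A (op : R -> R -> R) f g : dep A f -> dep A g -> dep A (fun w => op (f w) (g w)).
Proof. intros Hf Hg w w' H1 H2 E. rewrite (Hf w w'), (Hg w w'); auto. Qed.

Lemma dep_cst A c : dep A (fun _ => c).
Proof. intros w w' _ _ _; reflexivity. Qed.

Lemma dep_sum {B} A (l : list B) (f : B -> config -> R) :
  (forall x, In x l -> dep A (f x)) -> dep A (fun w => sum l (fun x => f x w)).
Proof. intros H w w' H1 H2 E. apply sum_ext. intros x Hx. apply (H x Hx); auto. Qed.

Lemma dep_ind A (Q : @config V -> Prop) :
  (forall w w', valid w -> valid w' -> (forall a b, adj a b -> A a b -> w a b = w' a b) -> Q w -> Q w') ->
  dep A (fun w => ind (Q w)).
Proof.
  intros H w w' H1 H2 E. apply ind_iff. split; apply H; auto.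
  intros a b Ha HA; symmetry; apply E; auto.
Qed.

Lemma ex_agree p Es A f w w' :
  all_adj Es -> dep A f -> valid w -> valid w' ->
  (forall a b, adj a b -> A a b ->
     w a b = w' a b \/ exists e, In e Es /\ same_edge (fst e) (snd e) a b) ->
  ex p Es f w = ex p Es f w'.
Proof.
  revert w w'. induction Es as [|e Es IH]; intros w w' Hadj Hf Hw Hw' H; simpl.
  - apply Hf; auto. intros a b Hab HA. destruct (H a b Hab HA) as [?|[? [[] _]]]; auto.
  - assert (He : adj (fst e) (snd e)) by (apply Hadj; left; reflexivity).
    assert (Hb : forall v, ex p Es f (upd w (fst e) (snd e) v) = ex p Es f (upd w' (fst e) (snd e) v)).
    { intros v. apply IH; auto using valid_upd.
      - intros e' He'; apply Hadj; right; exact He'.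
      - intros a b Hab HA. destruct (classic (same_edge (fst e) (snd e) a b)) as [Hs|Hs].
        + left. rewrite !upd_same; auto.
        + rewrite !upd_diff by assumption.
          destruct (H a b Hab HA) as [?|[e' [[<-|He'] Hs']]]; auto; [contradiction|].
          right; exists e'; auto. }
    unfold avg. rewrite !Hb. reflexivity.
Qed.

Lemma ex_le p Es (P : @config V -> Prop) f g w : 0 <= p <= 1 ->
  (forall w' e b, P w' -> In e Es -> P (upd w' (fst e) (snd e) b)) ->
  (forall w', P w' -> f w' <= g w') -> P w -> ex p Es f w <= ex p Es g w.
Proof.
  intros Hp. revert w. induction Es as [|e Es IH]; intros w HP Hfg Hw; simpl; [auto|].
  assert (Hb : forall v, ex p Es f (upd w (fst e) (snd e) v) <= ex p Es g (upd w (fst e) (snd e) v)).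
  { intros v. apply IH; auto.
    - intros w' e' b Hw' He'. apply HP; simpl; auto.
    - apply HP; simpl; auto. }
  unfold avg. pose proof (Hb true). pose proof (Hb false). nra.
Qed.

(** Averaging over [Es] makes [f] constant on valid configurations, so a further average over [Es']
    changes nothing. The two averages commute, hence each equals the double average. *)
Lemma ex_irrel p Es Es' A f : 0 <= p <= 1 ->
  all_adj Es -> all_adj Es' -> covers Es A -> covers Es' A -> dep A f ->
  ex p Es f w0 = ex p Es' f w0.
Proof.
  intros Hp.
  assert (key : forall E1 E2, all_adj E1 -> all_adj E2 -> covers E2 A -> dep A f ->
    ex p E1 (ex p E2 f) w0 = ex p E2 f w0).
  { intros E1 E2 H1 H2 H3 H4.
    assert (Hc : forall w, valid w -> ex p E2 f w = ex p E2 f w0).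
    { intros w Hw. apply (ex_agree p E2 A); auto using valid_w0. }
    rewrite <- (ex_cst p E1 (ex p E2 f w0) w0).
    apply Rle_antisym; apply ex_le with (P := valid); auto using valid_w0, valid_upd;
      intros w Hw; rewrite (Hc w Hw); lra. }
  intros H1 H2 H3 H4 H5.
  rewrite <- (key Es' Es), ex_swap, key; auto.
Qed.

Lemma inb_true (S : list V) y : inb S y = true <-> In y S.
Proof. unfold inb; destruct excluded_middle_informative; split; auto; discriminate. Qed.

Lemma edge_eqb_true (e f : V * V) : edge_eqb e f = true <-> same_edge (fst e) (snd e) (fst f) (snd f).
Proof. unfold edge_eqb; destruct excluded_middle_informative; split; auto; discriminate. Qed.

Lemma dedup_incl (l : list (V * V)) e : In e (dedup_edges l) -> In e l.
Proof.
  induction l as [|a l IH]; simpl; [auto|]. destruct (existsb _ l); simpl; intuition.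
Qed.

Lemma dedup_covers (l : list (V * V)) e : In e l ->
  exists e', In e' (dedup_edges l) /\ same_edge (fst e') (snd e') (fst e) (snd e).
Proof.
  revert e; induction l as [|a l IH]; simpl; [tauto|]. intros e He.
  assert (Hl : In e l -> exists e', In e' (if existsb (edge_eqb a) l then dedup_edges l else a :: dedup_edges l)
    /\ same_edge (fst e') (snd e') (fst e) (snd e)).
  { intros H. destruct (IH e H) as [e' [H1 H2]]. exists e'; split; auto.
    destruct (existsb _ l); simpl; auto. }
  destruct He as [<-|He]; [|auto].
  destruct (existsb (edge_eqb a) l) eqn:E.
  - apply existsb_exists in E. destruct E as [b [Hb E]]. apply edge_eqb_true in E.
    destruct (IH b Hb) as [e' [H1 H2]]. exists e'; split; auto.
    eapply same_edge_trans; [exact H2|]. apply same_edge_sym; exact E.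
  - exists a; split; [left; reflexivity|]. left; auto.
Qed.

(** [NoDup] for undirected edges: the reversal of a listed edge is excluded too. *)
Inductive simple : list (V * V) -> Prop :=
| simple_nil : simple []
| simple_cons e l : (forall e', In e' l -> ~ same_edge (fst e) (snd e) (fst e') (snd e')) ->
    simple l -> simple (e :: l).

Lemma dedup_simple (l : list (V * V)) : simple (dedup_edges l).
Proof.
  induction l as [|a l IH]; simpl; [constructor|]. destruct (existsb (edge_eqb a) l) eqn:E; auto.
  constructor; auto. intros e' He' Hs.
  assert (existsb (edge_eqb a) l = true); [|congruence].
  apply existsb_exists. exists e'; split; [apply dedup_incl; exact He'|]. apply edge_eqb_true; exact Hs.
Qed.

Lemma edges_in_elem S e : In e (edges_in nb S) ->
  adj (fst e) (snd e) /\ In (fst e) S /\ In (snd e) S.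
Proof.
  unfold edges_in. intros H. apply dedup_incl, in_flat_map in H. destruct H as [x [Hx H]].
  apply in_map_iff in H. destruct H as [y [<- H]]. apply filter_In in H. destruct H as [H1 H2].
  apply inb_true in H2. simpl; auto.
Qed.

Lemma edges_in_covers S : covers (edges_in nb S) (inside S).
Proof.
  intros a b Hab [Ha Hb]. apply (dedup_covers _ (a, b)).
  apply in_flat_map. exists a; split; auto. apply in_map, filter_In; split; auto.
  apply inb_true; exact Hb.
Qed.

Lemma edges_in_adj S : all_adj (edges_in nb S).
Proof. intros e He; apply (edges_in_elem S e He). Qed.

Lemma edges_in_simple S : simple (edges_in nb S).
Proof. apply dedup_simple. Qed.

Definition Ex (p : R) (S : list V) (f : @config V -> R) : R := ex p (edges_in nb S) f w0.

Lemma Pcyl_Ex p S Q : Pcyl nb p S Q = Ex p S (fun w => ind (Q w)).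
Proof. apply cyl_prob_ex. Qed.

Lemma Ex_le p S f g : 0 <= p <= 1 ->
  (forall w, valid w -> supp S w -> f w <= g w) -> Ex p S f <= Ex p S g.
Proof.
  intros Hp H. unfold Ex. apply ex_le with (P := fun w => valid w /\ supp S w); auto.
  - intros w' e b [H1 H2] He. apply edges_in_elem in He. destruct He as [He [He1 He2]].
    split; [apply valid_upd|apply supp_upd]; auto.
  - intros w' [? ?]; auto.
  - split; [apply valid_w0|apply supp_w0].
Qed.

Lemma Ex_ext p S f g : 0 <= p <= 1 ->
  (forall w, valid w -> supp S w -> f w = g w) -> Ex p S f = Ex p S g.
Proof.
  intros Hp H; apply Rle_antisym; apply Ex_le; auto; intros; rewrite H; auto; lra.
Qed.

Lemma Ex_plus p S f g : Ex p S (fun w => f w + g w) = Ex p S f + Ex p S g.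
Proof. apply ex_plus. Qed.

Lemma Ex_scal p S c f : Ex p S (fun w => c * f w) = c * Ex p S f.
Proof. apply ex_scal. Qed.

Lemma Ex_cst p S c : Ex p S (fun _ => c) = c.
Proof. apply ex_cst. Qed.

Lemma Ex_minus p S f g : Ex p S (fun w => f w - g w) = Ex p S f - Ex p S g.
Proof.
  unfold Rminus at 2. replace (- Ex p S g) with (-1 * Ex p S g) by lra.
  rewrite <- Ex_scal, <- Ex_plus. unfold Ex. f_equal.
  apply functional_extensionality; intros; lra.
Qed.

Lemma Ex_sum {A} p S (l : list A) (f : A -> config -> R) :
  Ex p S (fun w => sum l (fun x => f x w)) = sum l (fun x => Ex p S (f x)).
Proof.
  induction l as [|x l IH].
  - apply (Ex_cst p S 0).
  - rewrite sum_cons, <- IH, <- Ex_plus. reflexivity.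
Qed.

Lemma Ex_nonneg p S f : 0 <= p <= 1 ->
  (forall w, valid w -> supp S w -> 0 <= f w) -> 0 <= Ex p S f.
Proof. intros Hp H. rewrite <- (Ex_cst p S 0). apply Ex_le; auto. Qed.

Lemma Ex_ind_bound p S Q : 0 <= p <= 1 -> 0 <= Ex p S (fun w => ind (Q w)) <= 1.
Proof.
  intros Hp; split.
  - apply Ex_nonneg; auto; intros; apply ind_bound.
  - rewrite <- (Ex_cst p S 1). apply Ex_le; auto; intros; apply ind_bound.
Qed.

Lemma Ex_irrel p S S' f : 0 <= p <= 1 -> incl S S' -> dep (inside S) f -> Ex p S' f = Ex p S f.
Proof.
  intros Hp Hi Hf. apply ex_irrel with (A := inside S); auto using edges_in_adj, edges_in_covers.
  intros a b Hab [Ha Hb]. apply edges_in_covers; auto. split; apply Hi; assumption.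
Qed.

Lemma ex_absorb p (Es Es' : list (V * V)) f :
  (forall e, In e Es -> exists e', In e' Es' /\ same_edge (fst e') (snd e') (fst e) (snd e)) ->
  ex p Es' (ex p Es f) = ex p Es' f.
Proof.
  assert (one : forall (e e' : V * V) Es' g, In e' Es' -> same_edge (fst e') (snd e') (fst e) (snd e) ->
    ex p Es' (avg p e g) = ex p Es' g).
  { clear. intros e e' Es' g He Hs. induction Es' as [|a Es' IH]; simpl; [destruct He|].
    destruct He as [->|He]; [|rewrite IH by exact He; reflexivity].
    rewrite <- ex_avg. apply avg_idem; exact Hs. }
  revert f. induction Es as [|e Es IH]; intros f H; simpl; [reflexivity|].
  destruct (H e) as [e' [H1 H2]]; [left; reflexivity|].
  rewrite (one e e') by assumption. apply IH. intros; apply H; right; assumption.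
Qed.

Lemma Ex_avg p S f x y : adj x y -> In x S -> In y S ->
  Ex p S f = Ex p S (avg p (x, y) f).
Proof.
  intros Hxy Hx Hy. unfold Ex. change (avg p (x, y) f) with (ex p [(x, y)] f).
  rewrite ex_absorb; [reflexivity|]. intros e [<-|[]].
  apply (edges_in_covers S x y Hxy (conj Hx Hy)).
Qed.

(** Each edge is invisible to [f] or to [g], so one of the two factors can be taken out of the
    average over that edge. *)
Lemma Ex_indep p S A B f g : dep A f -> dep B g ->
  (forall a b, A a b -> B a b \/ B b a -> False) ->
  Ex p S (fun w => f w * g w) = Ex p S f * Ex p S g.
Proof.
  intros Hf Hg Hd. unfold Ex.
  assert (gen : forall Es w, all_adj Es -> valid w ->
    ex p Es (fun w => f w * g w) w = ex p Es f w * ex p Es g w); [|apply gen; auto using edges_in_adj, valid_w0].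
  induction Es as [|e Es IH]; intros w Hadj Hw; simpl; [reflexivity|].
  assert (He : adj (fst e) (snd e)) by (apply Hadj; left; reflexivity).
  assert (Hadj' : all_adj Es) by (intros e' He'; apply Hadj; right; exact He').
  unfold avg. rewrite !IH by auto using valid_upd.
  destruct (classic (A (fst e) (snd e) \/ A (snd e) (fst e))) as [HA|HA].
  - rewrite (ex_agree p Es B g (upd w (fst e) (snd e) true) (upd w (fst e) (snd e) false)); auto using valid_upd; [lra|].
    intros a b Hab HB. left. rewrite !upd_diff; auto; intros [[-> ->]|[-> ->]];
      destruct HA as [HA|HA]; eapply Hd; eauto.
  - rewrite (ex_agree p Es A f (upd w (fst e) (snd e) true) (upd w (fst e) (snd e) false)); auto using valid_upd; [lra|].
    intros a b Hab HA'. left. rewrite !upd_diff; auto; intros [[-> ->]|[-> ->]]; tauto.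
Qed.

(** * Monotone functions and Harris' inequality *)

Definition cfg_le (w w' : @config V) : Prop := forall a b, w a b = true -> w' a b = true.

Definition mono (f : @config V -> R) : Prop := forall w w', cfg_le w w' -> f w <= f w'.

Lemma mono_ind (Q : @config V -> Prop) : (forall w w', cfg_le w w' -> Q w -> Q w') -> mono (fun w => ind (Q w)).
Proof. intros H w w' Hw. apply ind_le. apply H; exact Hw. Qed.

Lemma cfg_le_upd w w' x y b : cfg_le w w' -> cfg_le (upd w x y b) (upd w' x y b).
Proof. intros H a c. unfold upd. destruct excluded_middle_informative; auto. Qed.

Lemma cfg_le_upd_ft (w : @config V) x y : cfg_le (upd w x y false) (upd w x y true).
Proof. intros a c. unfold upd. destruct excluded_middle_informative; auto. Qed.

Lemma cfg_le_open (w : @config V) x y : cfg_le w (upd w x y true).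
Proof. intros a c. unfold upd. destruct excluded_middle_informative; auto. Qed.

Lemma mono_ex p (Es : list (V * V)) f : 0 <= p <= 1 -> mono f -> mono (ex p Es f).
Proof.
  intros Hp Hf. induction Es as [|e Es IH]; [exact Hf|]. intros w w' Hw. simpl. unfold avg.
  pose proof (IH _ _ (cfg_le_upd w w' (fst e) (snd e) true Hw)).
  pose proof (IH _ _ (cfg_le_upd w w' (fst e) (snd e) false Hw)). nra.
Qed.

(** Conditioning on one edge, the covariance is the mean of the two conditional covariances plus
    [p (1 - p) (f1 - f2) (g1 - g2)], whose last two factors are nonnegative by monotonicity. *)
Lemma Harris p S f g : 0 <= p <= 1 -> mono f -> mono g ->
  Ex p S f * Ex p S g <= Ex p S (fun w => f w * g w).
Proof.
  intros Hp Hf Hg. unfold Ex. generalize (edges_in nb S) (@w0 V).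
  induction l as [|e Es IH]; intros w; simpl; [lra|]. unfold avg.
  pose proof (mono_ex p Es f Hp Hf _ _ (cfg_le_upd_ft w (fst e) (snd e))).
  pose proof (mono_ex p Es g Hp Hg _ _ (cfg_le_upd_ft w (fst e) (snd e))).
  pose proof (IH (upd w (fst e) (snd e) true)). pose proof (IH (upd w (fst e) (snd e) false)).
  set (f1 := ex p Es f (upd w (fst e) (snd e) true)) in *.
  set (f2 := ex p Es f (upd w (fst e) (snd e) false)) in *.
  set (g1 := ex p Es g (upd w (fst e) (snd e) true)) in *.
  set (g2 := ex p Es g (upd w (fst e) (snd e) false)) in *.
  assert (0 <= p * (1 - p) * ((f1 - f2) * (g1 - g2))) by (apply Rmult_le_pos; apply Rmult_le_pos; lra).
  nra.
Qed.

Lemma ex_mono_p p q (Es : list (V * V)) f w : 0 <= p -> p <= q -> q <= 1 -> mono f -> ex p Es f w <= ex q Es f w.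
Proof.
  intros Hp Hpq Hq Hf. revert w. induction Es as [|e Es IH]; intros w; simpl; [lra|].
  pose proof (IH (upd w (fst e) (snd e) true)). pose proof (IH (upd w (fst e) (snd e) false)).
  assert (Hp1 : 0 <= p <= 1) by lra.
  pose proof (mono_ex p Es f Hp1 Hf _ _ (cfg_le_upd_ft w (fst e) (snd e))).
  assert (Hq1 : 0 <= q <= 1) by lra.
  pose proof (mono_ex q Es f Hq1 Hf _ _ (cfg_le_upd_ft w (fst e) (snd e))).
  unfold avg. nra.
Qed.

Lemma Ex_mono_p p q S f : 0 <= p -> p <= q -> q <= 1 -> mono f -> Ex p S f <= Ex q S f.
Proof. apply ex_mono_p. Qed.

Lemma ex_mono_base p (Es : list (V * V)) f : 0 <= p <= 1 -> mono f -> f w0 <= ex p Es f w0.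
Proof.
  intros Hp Hf. assert (H0 : forall e : V * V, upd w0 (fst e) (snd e) false = w0) by (intros; apply upd_id; reflexivity).
  induction Es as [|e Es IH]; simpl; [lra|]. unfold avg. rewrite H0.
  pose proof (mono_ex p Es f Hp Hf _ _ (cfg_le_upd_ft w0 (fst e) (snd e))). rewrite H0 in H. nra.
Qed.

(** Edges outside the box are closed, so a larger box turns closed edges into random ones, which can
    only raise an increasing function. This serves when the box need not contain the edges on which
    [f] depends. *)
Lemma Ex_mono_S p S S' f : 0 <= p <= 1 -> mono f -> incl S S' -> Ex p S f <= Ex p S' f.
Proof.
  intros Hp Hm Hi. unfold Ex.
  rewrite <- (ex_absorb p (edges_in nb S) (edges_in nb S')), ex_swap.
  - rewrite ex_swap. apply (ex_mono_base p _ _ Hp), mono_ex; assumption.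
  - intros e He. apply edges_in_elem in He. destruct He as [He [H1 H2]].
    apply edges_in_covers; [exact He|]. split; auto.
Qed.

(** Finite energy: the edge is already open with probability [p], independently of the configuration
    with the edge forced open. *)
Lemma Ex_energy p S f x y : 0 <= p <= 1 -> adj x y -> In x S -> In y S ->
  (forall w, 0 <= f w) -> p * Ex p S (fun w => f (upd w x y true)) <= Ex p S f.
Proof.
  intros Hp Hxy Hx Hy Hf. rewrite (Ex_avg p S f x y) by assumption.
  rewrite <- Ex_scal. apply Ex_le; auto. intros w _ _. unfold avg; simpl.
  pose proof (Hf (upd w x y false)). nra.
Qed.

(** * Automorphisms *)

Definition pull (phi : V -> V) (w : config) : config := fun a b => w (phi a) (phi b).

Lemma aut_inj phi : is_aut nb phi -> forall a b, phi a = phi b -> a = b.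
Proof. intros [[g [Hg _]] _] a b H. rewrite <- (Hg a), <- (Hg b), H; reflexivity. Qed.

Lemma aut_adj phi a b : is_aut nb phi -> adj a b -> adj (phi a) (phi b).
Proof. intros [_ H]; apply H. Qed.

Lemma aut_adj_inv phi a b : is_aut nb phi -> adj (phi a) (phi b) -> adj a b.
Proof. intros [_ H]; apply H. Qed.

Lemma valid_pull phi w : is_aut nb phi -> valid w -> valid (pull phi w).
Proof.
  intros [_ Ha] [H1 H2]. split; unfold pull; [intros; apply H1|].
  intros a b H. apply Ha, H2, H.
Qed.

Lemma ex_pull p phi Es f w : is_aut nb phi ->
  ex p (map (fun e => (phi (fst e), phi (snd e))) Es) (fun w => f (pull phi w)) w = ex p Es f (pull phi w).
Proof.
  intros Hphi. revert w. induction Es as [|e Es IH]; intros w; [reflexivity|].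
  assert (H : forall b, pull phi (upd w (phi (fst e)) (phi (snd e)) b) = upd (pull phi w) (fst e) (snd e) b).
  { intros b. do 2 (apply functional_extensionality; intro). unfold pull, upd.
    repeat destruct excluded_middle_informative; try reflexivity; exfalso.
    - apply n. unfold same_edge in *. destruct s as [[H1 H2]|[H1 H2]];
        apply (aut_inj phi Hphi) in H1, H2; subst; tauto.
    - apply n. unfold same_edge in *. destruct s as [[-> ->]|[-> ->]]; tauto. }
  simpl. unfold avg. simpl. rewrite !IH, !H. reflexivity.
Qed.

Lemma dep_pull phi S f : is_aut nb phi -> dep (inside S) f ->
  dep (inside (map phi S)) (fun w => f (pull phi w)).
Proof.
  intros Hphi Hf w w' Hw Hw' E. apply Hf; auto using valid_pull.
  intros a b Hab [Ha Hb]. apply E; [apply aut_adj; assumption|]. split; apply in_map; assumption.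
Qed.

Lemma Ex_aut p phi S S' f : 0 <= p <= 1 -> is_aut nb phi -> dep (inside S) f ->
  incl (map phi S) S' -> Ex p S' (fun w => f (pull phi w)) = Ex p S f.
Proof.
  intros Hp Hphi Hf Hi.
  rewrite (Ex_irrel p (map phi S) S' (fun w => f (pull phi w)) Hp Hi (dep_pull phi S f Hphi Hf)).
  change (Ex p S f) with (ex p (edges_in nb S) f (pull phi w0)).
  rewrite <- ex_pull by exact Hphi.
  apply ex_irrel with (A := inside (map phi S)); auto using edges_in_adj, edges_in_covers, dep_pull.
  - intros e He. apply in_map_iff in He. destruct He as [e' [<- He]]. apply aut_adj, (edges_in_adj S e' He); exact Hphi.
  - intros a b Hab [Ha Hb]. apply in_map_iff in Ha, Hb.
    destruct Ha as [a' [<- Ha]], Hb as [b' [<- Hb]]. apply (aut_adj_inv phi _ _ Hphi) in Hab.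
    destruct (edges_in_covers S a' b' Hab (conj Ha Hb)) as [e [He Hs]].
    exists (phi (fst e), phi (snd e)). split.
    + apply in_map_iff; exists e; auto.
    + simpl. destruct Hs as [[-> ->]|[-> ->]]; unfold same_edge; tauto.
Qed.

(** * Derivative in [p] *)

(** Russo's formula. The product rule is applied to the average over the first edge; simplicity of
    the list lets the opening or closing of that edge commute with the averages over the others. *)
Lemma ex_derivable p Es f w : all_adj Es -> simple Es -> valid w ->
  derivable_pt_lim (fun q => ex q Es f w) p
    (sum Es (fun e => ex p Es (fun w => f (upd w (fst e) (snd e) true) - f (upd w (fst e) (snd e) false)) w)).
Proof.
  intros Hadj Hs. revert w. induction Hs as [|e Es Hne Hs IH]; intros w Hw.
  - apply derivable_pt_lim_const.
  - assert (Hadj' : all_adj Es) by (intros e' He'; apply Hadj; right; exact He').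
    assert (He : adj (fst e) (snd e)) by (apply Hadj; left; reflexivity).
    specialize (IH Hadj').
    set (df := fun (e : V * V) (w : config) => f (upd w (fst e) (snd e) true) - f (upd w (fst e) (snd e) false)).
    assert (D : forall b, derivable_pt_lim (fun q => ex q Es f (upd w (fst e) (snd e) b)) p
      (sum Es (fun e0 => ex p Es (df e0) (upd w (fst e) (snd e) b))))
      by (intros b; apply (IH _ (valid_upd w (fst e) (snd e) b Hw He))).
    change (derivable_pt_lim (fun q => ex q (e :: Es) f w) p
      (sum (e :: Es) (fun e0 => ex p (e :: Es) (df e0) w))).
    pose proof (D true) as D1. pose proof (D false) as D2.
    assert (E0 : ex p (e :: Es) (df e) w = ex p Es f (upd w (fst e) (snd e) true) - ex p Es f (upd w (fst e) (snd e) false)).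
    { assert (comm : forall b w, ex p Es f (upd w (fst e) (snd e) b)
        = ex p Es (fun w => f (upd w (fst e) (snd e) b)) w).
      { clear - Hne. intros b. induction Es as [|e' Es IH]; intros w; simpl; [reflexivity|].
        unfold avg. rewrite (upd_comm w _ _ _ _ b true), (upd_comm w _ _ _ _ b false) by (apply Hne; left; reflexivity).
        rewrite !IH; [reflexivity| |]; intros; apply Hne; right; assumption. }
      assert (split : forall w, ex p Es (df e) w = ex p Es f (upd w (fst e) (snd e) true) - ex p Es f (upd w (fst e) (snd e) false)).
      { intros w'. rewrite !comm. unfold Rminus at 1.
        replace (- ex p Es (fun w => f (upd w (fst e) (snd e) false)) w')
          with (-1 * ex p Es (fun w => f (upd w (fst e) (snd e) false)) w') by lra.
        rewrite <- ex_scal, <- ex_plus. f_equal. apply functional_extensionality; intro. unfold df; lra. }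
      simpl. unfold avg. rewrite !split.
      rewrite !upd_upd by (left; auto). lra. }
    rewrite sum_cons, E0. simpl.
    replace (sum Es (fun e0 => avg p e (ex p Es (df e0)) w))
      with (p * sum Es (fun e0 => ex p Es (df e0) (upd w (fst e) (snd e) true))
        + (1 - p) * sum Es (fun e0 => ex p Es (df e0) (upd w (fst e) (snd e) false)))
      by (rewrite <- !sum_scal, <- sum_plus; reflexivity).
    pose proof (derivable_pt_lim_mult id _ p _ _ (derivable_pt_lim_id p) D1) as M1.
    pose proof (derivable_pt_lim_mult (fun q => 1 - q) _ p _ _
      (derivable_pt_lim_minus _ _ p _ _ (derivable_pt_lim_const 1 p) (derivable_pt_lim_id p)) D2) as M2.
    pose proof (derivable_pt_lim_plus _ _ p _ _ M1 M2) as M.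
    unfold plus_fct, mult_fct, id in M. unfold avg.
    match type of M with derivable_pt_lim _ _ ?l => match goal with |- derivable_pt_lim _ _ ?l' =>
      replace l' with l; [exact M|] end end.
    lra.
Qed.

Lemma Ex_derivable p S f :
  derivable_pt_lim (fun q => Ex q S f) p
    (sum (edges_in nb S)
      (fun e => Ex p S (fun w => f (upd w (fst e) (snd e) true) - f (upd w (fst e) (snd e) false)))).
Proof. apply ex_derivable; auto using edges_in_adj, edges_in_simple, valid_w0. Qed.

Lemma Ex_continuous S f p : continuity_pt (fun q => Ex q S f) p.
Proof.
  apply derivable_continuous_pt. eexists. apply Ex_derivable.
Qed.

End Graph.

(** * Balls and open clusters *)

Section Clusters.
Context {V : Type} (nb : V -> list V).
Context (nb_sym : forall v w, In w (nb v) -> In v (nb w)).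

Notation adj := (adj nb).
Notation ball := (ball nb).
Notation valid := (valid nb).
Notation dep := (dep nb).
Notation conn := (@open_conn V).

Lemma ball_self v n : In v (ball v n).
Proof. induction n; simpl; [auto|]. apply in_or_app; auto. Qed.

Lemma ball_step v n x y : In x (ball v n) -> adj x y -> In y (ball v (S n)).
Proof.
  intros Hx Hy. simpl. apply in_or_app; right. apply in_flat_map. exists x; auto.
Qed.

Lemma ball_S_inv v n y : In y (ball v (S n)) ->
  In y (ball v n) \/ exists x, In x (ball v n) /\ adj x y.
Proof.
  simpl. intros H. apply in_app_or in H. destruct H as [H|H]; auto.
  apply in_flat_map in H. destruct H as [x [? ?]]; right; exists x; auto.
Qed.

Lemma ball_le v n m : (n <= m)%nat -> incl (ball v n) (ball v m).
Proof.
  induction 1; [apply incl_refl|]. intros x Hx. simpl. apply in_or_app; left; auto.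
Qed.

Lemma ball_trans v n m x y : In x (ball v n) -> In y (ball x m) -> In y (ball v (n + m)).
Proof.
  intros Hx. revert y; induction m as [|m IH]; intros y Hy.
  - simpl in Hy. destruct Hy as [<-|[]]. rewrite Nat.add_0_r; exact Hx.
  - rewrite Nat.add_succ_r. apply ball_S_inv in Hy. destruct Hy as [Hy|[z [Hz Hzy]]].
    + apply (ball_le v (n + m)); [lia|auto].
    + eapply ball_step; eauto.
Qed.

Lemma ball_sym v n x : In x (ball v n) -> In v (ball x n).
Proof.
  revert x; induction n as [|n IH]; intros x Hx.
  - simpl in *; destruct Hx as [<-|[]]; auto.
  - apply ball_S_inv in Hx. destruct Hx as [Hx|[z [Hz Hzx]]].
    + apply (ball_le x n); auto.
    + apply (ball_trans x 1 n z v); auto. apply (ball_step x 0 x); [left; reflexivity|].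
      apply nb_sym; exact Hzx.
Qed.

Lemma ball_aut phi v n x : is_aut nb phi -> In x (ball v n) -> In (phi x) (ball (phi v) n).
Proof.
  intros Hphi. revert x; induction n as [|n IH]; intros x Hx.
  - simpl in *; destruct Hx as [<-|[]]; auto.
  - apply ball_S_inv in Hx. destruct Hx as [Hx|[z [Hz Hzx]]].
    + apply (ball_le _ n); auto.
    + apply (ball_step _ n (phi z)); auto. apply aut_adj; assumption.
Qed.

Lemma ball_connected u v : connected_graph nb -> exists n, In v (ball u n).
Proof.
  intros Hc. specialize (Hc u v). apply clos_rt_rtn1 in Hc. induction Hc as [|y z Hyz _ [n Hn]].
  - exists 0%nat; apply ball_self.
  - exists (S n). eapply ball_step; eauto.
Qed.

Lemma conn_refl w x : conn w x x.
Proof. apply rt_refl. Qed.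

Lemma conn_trans w x y z : conn w x y -> conn w y z -> conn w x z.
Proof. intros; eapply rt_trans; eauto. Qed.

Lemma conn_edge (w : config) x y : w x y = true -> conn w x y.
Proof. intros; apply rt_step; auto. Qed.

Lemma conn_sym w x y : valid w -> conn w x y -> conn w y x.
Proof.
  intros [Hs _]. induction 1.
  - apply conn_edge. rewrite Hs; assumption.
  - apply conn_refl.
  - eapply conn_trans; eauto.
Qed.

Lemma conn_mono w w' x y : cfg_le w w' -> conn w x y -> conn w' x y.
Proof.
  intros H. induction 1; [apply conn_edge; auto|apply conn_refl|eapply conn_trans; eauto].
Qed.

Lemma conn_equiv w u v x : valid w -> conn w u v -> (conn w u x <-> conn w v x).
Proof.
  intros Hw H; split; intros H'; eapply conn_trans; eauto. apply conn_sym; assumption.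
Qed.

Definition restr (P : V -> Prop) (w : @config V) : config :=
  fun a b => if excluded_middle_informative (P a /\ P b) then w a b else false.

Lemma restr_true P w a b : restr P w a b = true <-> P a /\ P b /\ w a b = true.
Proof.
  unfold restr; destruct excluded_middle_informative; intuition discriminate.
Qed.

Lemma restr_le P w : cfg_le (restr P w) w.
Proof. intros a b H; apply restr_true in H; tauto. Qed.

Lemma restr_cfg_le P w w' : cfg_le w w' -> cfg_le (restr P w) (restr P w').
Proof. intros H a b Hab. apply restr_true in Hab. apply restr_true. firstorder. Qed.

Lemma restr_incl (P Q : V -> Prop) w : (forall x, P x -> Q x) -> cfg_le (restr P w) (restr Q w).
Proof. intros H a b Hab. apply restr_true in Hab. apply restr_true. firstorder. Qed.

Lemma valid_restr P w : valid w -> valid (restr P w).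
Proof.
  intros [H1 H2]; split.
  - intros a b. unfold restr. repeat destruct excluded_middle_informative; try tauto. apply H1.
  - intros a b H. apply H2, (restr_le P w), H.
Qed.

Lemma dep_restr P (f : @config V -> R) : dep (fun a b => P a /\ P b) (fun w => f (restr P w)).
Proof.
  intros w w' [_ Hw] [_ Hw'] E. f_equal. do 2 (apply functional_extensionality; intro).
  unfold restr. destruct excluded_middle_informative as [[H1 H2]|]; [|reflexivity].
  destruct (w x x0) eqn:E1, (w' x x0) eqn:E2; try reflexivity; exfalso.
  - rewrite E in E1; auto; congruence.
  - rewrite <- E in E2; auto; congruence.
Qed.

Lemma conn_restr_in P w x y : conn (restr P w) x y -> x = y \/ P y.
Proof.
  intros H. apply clos_rt_rtn1 in H. destruct H as [|y z H _]; auto.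
  apply restr_true in H; tauto.
Qed.

Lemma exit_first (P : V -> Prop) w x y : conn w x y -> P x -> ~ P y ->
  exists a b, conn (restr P w) x a /\ P a /\ ~ P b /\ w a b = true.
Proof.
  intros H. apply clos_rt_rt1n in H. induction H as [x|x y z Hxy H IH]; intros Hx Hz; [tauto|].
  destruct (classic (P y)) as [Py|Py].
  - destruct (IH Py Hz) as [a [b [H1 H2]]]. exists a, b; split; auto.
    apply conn_trans with y; auto. apply conn_edge, restr_true; auto.
  - exists x, y. repeat split; auto. apply conn_refl.
Qed.

(** Cutting at the last exit leaves a final piece that avoids [P] altogether, so that its existence
    can be independent of what was explored in [P]. *)
Lemma exit_last (P : V -> Prop) w x y : conn w x y -> P x -> ~ P y ->
  exists a b, P a /\ ~ P b /\ w a b = true /\ conn (restr (fun z => ~ P z) w) b y.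
Proof.
  intros H. apply clos_rt_rtn1 in H. induction H as [|y z Hyz H IH]; intros Hx Hz; [tauto|].
  destruct (classic (P y)) as [Py|Py].
  - exists y, z. repeat split; auto. apply conn_refl.
  - destruct (IH Hx Py) as [a [b [H1 [H2 [H3 H4]]]]]. exists a, b; repeat split; auto.
    apply conn_trans with y; auto. apply conn_edge, restr_true; auto.
Qed.

Lemma conn_supp S w x y : supp S w -> conn w x y -> In x S -> In y S.
Proof.
  intros Hs H Hx. apply clos_rt_rtn1 in H. destruct H as [|y z H _]; auto. apply (Hs _ _ H).
Qed.

Lemma conn_supp_l S w x y : supp S w -> conn w x y -> In y S -> In x S.
Proof.
  intros Hs H Hy. apply clos_rt_rt1n in H. destruct H as [|y z H _]; auto. apply (Hs _ _ H).
Qed.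

Lemma conn_pull phi w x y : is_aut nb phi -> (conn (pull phi w) x y <-> conn w (phi x) (phi y)).
Proof.
  intros Hphi; split.
  - induction 1; [apply conn_edge; assumption|apply conn_refl|eapply conn_trans; eauto].
  - intros H. destruct Hphi as [[g [Hg Hg']] _].
    rewrite <- (Hg x), <- (Hg y). revert H. generalize (phi x) (phi y).
    induction 1 as [a b H|a|a b c H IH H' IH']; [|apply conn_refl|eapply conn_trans; eauto].
    apply conn_edge. unfold pull. rewrite !Hg'; exact H.
Qed.

Lemma conn_open_split w v y a b : valid w -> conn (upd w v y true) a b ->
  conn w a b \/ (conn w a v /\ conn w y b) \/ (conn w a y /\ conn w v b).
Proof.
  intros Hw H. apply clos_rt_rtn1 in H. induction H as [|b c Hbc H IH]; [left; apply conn_refl|].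
  assert (Hstep : w b c = true \/ same_edge v y b c).
  { destruct (classic (same_edge v y b c)) as [Hs|Hs]; auto. rewrite upd_diff in Hbc by exact Hs. auto. }
  destruct Hstep as [Hs|[[-> ->]|[-> ->]]].
  - apply conn_edge in Hs.
    destruct IH as [IH|[[I1 I2]|[I1 I2]]]; [left|right; left|right; right]; try split; auto;
      eapply conn_trans; eauto.
  - pose proof (conn_refl w y). pose proof (conn_refl w v). intuition.
  - pose proof (conn_refl w y). pose proof (conn_refl w v). intuition.
Qed.

(** * Cluster sizes *)

Lemma NoDup_exceed (L L' : list V) : NoDup L' -> (length L < length L')%nat ->
  exists z, In z L' /\ ~ In z L.
Proof.
  intros Hn Hl. apply NNPP; intros H. assert (incl L' L).
  { intros z Hz. apply NNPP; intros Hz'. apply H; exists z; auto. }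
  apply NoDup_incl_length in H0; auto. lia.
Qed.

(** The set grows by one vertex at a time across an open boundary edge. Being connected by open
    edges within itself, it lies in a ball, and this is what makes [cluster_ge] a cylinder event. *)
Lemma cluster_grow w v n : valid w -> cluster_ge w v (S n) ->
  exists L, NoDup L /\ length L = S n /\ incl L (ball v n) /\ In v L /\
    forall x, In x L -> conn (restr (fun y => In y L) w) v x.
Proof.
  intros Hw. revert v. induction n as [|n IH]; intros v [L2 [Hn2 [Hl2 H2]]].
  - exists [v]. split; [|split; [|split; [|split]]].
    + constructor; [simpl; tauto|constructor].
    + reflexivity.
    + intros x [<-|[]]; left; reflexivity.
    + left; reflexivity.
    + intros x [<-|[]]; apply conn_refl.
  - destruct (IH v) as [L [Hn [Hl [Hb [Hv Hc]]]]].
    { destruct L2 as [|z L2]; [discriminate|]. exists L2. inversion_clear Hn2. simpl in Hl2.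
      repeat split; auto. intros; apply H2; right; assumption. }
    destruct (NoDup_exceed L L2) as [z [Hz HzL]]; [assumption|lia|].
    destruct (exit_first (fun y => In y L) w v z) as [a [b [_ [Ha [Hb' Hab]]]]]; auto.
    exists (b :: L). split; [|split; [|split; [|split]]].
    + constructor; assumption.
    + simpl; lia.
    + intros x [<-|Hx].
      * apply (ball_step v n a); auto. apply Hw; exact Hab.
      * apply (ball_le v n); auto.
    + right; exact Hv.
    + assert (Hle : cfg_le (restr (fun y => In y L) w) (restr (fun y => In y (b :: L)) w))
        by (apply restr_incl; simpl; auto).
      intros x [<-|Hx]; [|eapply conn_mono; eauto].
      apply conn_trans with a; [eapply conn_mono; eauto|].
      apply conn_edge, restr_true; simpl; auto.
Qed.

Lemma cluster_ge_mono (w w' : @config V) v n : cfg_le w w' -> cluster_ge w v n -> cluster_ge w' v n.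
Proof.
  intros H [L [H1 [H2 H3]]]; exists L; repeat split; auto.
  intros x Hx; eapply conn_mono; eauto.
Qed.

Lemma cluster_ge_le (w : @config V) v n m : (m <= n)%nat -> cluster_ge w v n -> cluster_ge w v m.
Proof.
  induction 1 as [|n Hmn IH]; auto. intros [L [H1 [H2 H3]]]. apply IH.
  destruct L as [|z L]; [discriminate|]. exists L. inversion_clear H1. simpl in H2.
  repeat split; auto. intros; apply H3; right; assumption.
Qed.

Lemma cluster_ge_1 (w : @config V) v : cluster_ge w v 1.
Proof.
  exists [v]. repeat split; auto; [constructor; simpl; [tauto|constructor]|].
  intros x [<-|[]]; apply conn_refl.
Qed.

Lemma dep_cluster_ge v n : dep (inside (ball v n)) (fun w => ind (cluster_ge w v n)).
Proof.
  apply dep_ind. intros w w' Hw Hw' E H. destruct n as [|n].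
  - exists []; repeat split; [constructor|intros x []].
  - destruct (cluster_grow w v n Hw H) as [L [H1 [H2 [H3 [_ H4]]]]]. exists L. repeat split; auto.
    intros x Hx. apply (conn_mono (restr (fun y => In y L) w)); auto.
    intros a b Hab. apply restr_true in Hab. destruct Hab as [Ha [Hb Hab]].
    rewrite <- E; auto.
    + apply Hw; exact Hab.
    + split; apply (ball_le v n); auto.
Qed.

Lemma mono_cluster_ge v n : mono (fun w : @config V => ind (cluster_ge w v n)).
Proof. apply mono_ind. intros; eapply cluster_ge_mono; eauto. Qed.

Definition enum (w : config) (v : V) (L : list V) : Prop :=
  NoDup L /\ forall x, In x L <-> conn w v x.

(* The empty list if the cluster is infinite, so that [cs] is then [0]. *)
Definition klist (w : config) (v : V) : list V :=
  match excluded_middle_informative (exists L, enum w v L) with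
  | left H => proj1_sig (constructive_indefinite_description _ H)
  | right _ => []
  end.

Definition cs (w : config) (v : V) : nat := length (klist w v).

Lemma klist_enum w v : (exists L, enum w v L) -> enum w v (klist w v).
Proof.
  intros H. unfold klist. destruct excluded_middle_informative as [H'|]; [|tauto].
  exact (proj2_sig (constructive_indefinite_description _ H')).
Qed.

Lemma cs_enum_eq w v L : enum w v L -> cs w v = length L.
Proof.
  intros HL. destruct (klist_enum w v (ex_intro _ L HL)) as [H1 H2], HL as [H3 H4].
  unfold cs. apply Nat.le_antisymm; apply NoDup_incl_length; auto;
    intros x Hx; [apply H4, H2|apply H2, H4]; exact Hx.
Qed.

Lemma cs_pos_enum w v : (1 <= cs w v)%nat -> enum w v (klist w v).
Proof.
  intros H. apply klist_enum. apply NNPP. intros H'. unfold cs, klist in H.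
  destruct excluded_middle_informative; [tauto|]. simpl in H; lia.
Qed.

Lemma enum_supp S w v : supp S w -> In v S -> enum w v (klist w v).
Proof.
  intros Hs Hv. apply klist_enum.
  exists (nodup eqdec (filter (fun x => if excluded_middle_informative (conn w v x) then true else false) S)).
  split; [apply NoDup_nodup|]. intros x. rewrite nodup_In, filter_In.
  destruct excluded_middle_informative as [H|H].
  - split; auto. intros _; split; auto. eapply conn_supp; eauto.
  - split; [intros [_ ?]; discriminate|tauto].
Qed.

Lemma enum_supp_any S w v : supp S w -> enum w v (klist w v).
Proof.
  intros Hs. apply (enum_supp (v :: S)); [|left; reflexivity].
  intros a b H; destruct (Hs a b H); simpl; auto.
Qed.

Lemma cs_conn w u v : valid w -> conn w u v -> cs w u = cs w v.
Proof.
  intros Hw H. destruct (classic (exists L, enum w u L)) as [Hf|Hf].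
  - pose proof (klist_enum w u Hf) as [H1 H2]. symmetry. apply cs_enum_eq. split; auto.
    intros x. rewrite H2. apply conn_equiv; assumption.
  - assert (~ exists L, enum w v L).
    { intros [L [H1 H2]]. apply Hf. exists L. split; auto. intros x. rewrite H2.
      symmetry; apply conn_equiv; assumption. }
    unfold cs, klist. repeat destruct excluded_middle_informative; tauto.
Qed.

Lemma enum_ge w v L n : enum w v L -> (cluster_ge w v n <-> (n <= length L)%nat).
Proof.
  intros [H1 H2]; split.
  - intros [L' [H3 [<- H4]]]. apply NoDup_incl_length; auto. intros x Hx; apply H2; auto.
  - intros H. apply (cluster_ge_le _ _ (length L)); auto. exists L; repeat split; auto. apply H2.
Qed.

Lemma cs_ge S w v n : supp S w -> (cluster_ge w v n <-> (n <= cs w v)%nat).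
Proof. intros Hs. apply enum_ge. eapply enum_supp_any; eauto. Qed.

Lemma enum_ball w v L : valid w -> enum w v L -> incl L (ball v (length L)).
Proof.
  intros Hw HL. assert (Hv : In v L) by (apply HL, conn_refl).
  destruct L as [|y L0] eqn:EL; [destruct Hv|]. rewrite <- EL in *.
  destruct (cluster_grow w v (length L0) Hw) as [L' [H1 [H2 [H3 [_ H4]]]]].
  { apply (enum_ge w v L); [exact HL|]. rewrite EL; simpl; lia. }
  assert (Hi : incl L' L).
  { intros x Hx. apply HL, (conn_mono (restr (fun z => In z L') w)); auto using restr_le. }
  intros x Hx. apply (ball_le v (length L0)); [rewrite EL; simpl; lia|]. apply H3.
  apply (NoDup_length_incl H1) in Hi; auto. rewrite EL, H2; simpl; lia.
Qed.

(** The edges touching a cluster determine it: the inner ones keep it connected, the closed ones on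
    its boundary keep it from growing. Nothing is asked of the other edges. *)
Lemma enum_agree w w' v L : valid w -> valid w' -> enum w v L ->
  (forall a b, adj a b -> In a L -> w a b = w' a b) -> enum w' v L.
Proof.
  intros Hw Hw' [H1 H2] E. split; auto. intros x; split.
  - intros Hx. apply H2 in Hx. apply clos_rt_rtn1 in Hx.
    induction Hx as [|y z Hyz Hy IH]; [apply conn_refl|].
    apply conn_trans with y; [exact IH|]. apply conn_edge. rewrite <- E; auto.
    + apply Hw; exact Hyz.
    + apply H2, clos_rtn1_rt, Hy.
  - intros Hx. apply NNPP; intros Hn.
    destruct (exit_first (fun z => In z L) w' v x) as [a [b [_ [Ha [Hb Hab]]]]]; auto.
    + apply H2, conn_refl.
    + apply Hb, H2. apply conn_trans with a; [apply H2; exact Ha|]. apply conn_edge.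
      rewrite E; auto. apply Hw'; exact Hab.
Qed.

(** A cluster of at most [N] vertices lies in the ball of radius [N]; the radius [N + 1] is there to
    see its boundary edges as well. *)
Lemma enum_local w w' v N S : valid w -> valid w' -> incl (ball v (Datatypes.S N)) S ->
  (1 <= cs w v <= N)%nat ->
  (forall a b, adj a b -> inside S a b -> w a b = w' a b) ->
  enum w v (klist w v) /\ enum w' v (klist w v) /\ cs w' v = cs w v.
Proof.
  intros Hw Hw' HS [Hc1 Hc2] E. pose proof (cs_pos_enum w v Hc1) as HL.
  assert (HL' : enum w' v (klist w v)).
  { apply (enum_agree w); auto. intros a b Hab Ha. apply E; auto.
    apply (enum_ball w v _ Hw HL) in Ha. apply (ball_le v _ N Hc2) in Ha.
    split; apply HS; [apply (ball_le v N); auto|]. apply (ball_step v N a); auto. }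
  split; [|split]; auto. apply cs_enum_eq; exact HL'.
Qed.

Lemma cs_pull phi w v : is_aut nb phi -> cs (pull phi w) v = cs w (phi v).
Proof.
  intros Hphi. pose proof Hphi as [[g [Hg Hg']] Ha].
  assert (Himg : forall L, enum (pull phi w) v L -> enum w (phi v) (map phi L)).
  { intros L [H1 H2]. split.
    - apply FinFun.Injective_map_NoDup; auto. intros a b; apply (aut_inj nb); assumption.
    - intros x. rewrite in_map_iff. split.
      + intros [y [<- Hy]]. apply (conn_pull phi w v y Hphi), H2, Hy.
      + intros H. exists (g x). split; [apply Hg'|]. apply H2, (conn_pull phi); auto. rewrite Hg'; exact H. }
  assert (Hpre : forall L, enum w (phi v) L -> enum (pull phi w) v (map g L)).
  { intros L [H1 H2]. split.
    - apply FinFun.Injective_map_NoDup; auto. intros a b H. rewrite <- (Hg' a), <- (Hg' b), H; reflexivity.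
    - intros x. rewrite in_map_iff. rewrite (conn_pull phi) by assumption. rewrite <- H2. split.
      + intros [y [<- Hy]]. rewrite Hg'; exact Hy.
      + intros H. exists (phi x); split; auto. }
  destruct (classic (exists L, enum (pull phi w) v L)) as [[L HL]|Hf].
  - rewrite (cs_enum_eq _ _ L HL), (cs_enum_eq _ _ _ (Himg L HL)), length_map. reflexivity.
  - assert (~ exists L, enum w (phi v) L) by (intros [L HL]; apply Hf; eauto).
    unfold cs, klist. repeat destruct excluded_middle_informative; tauto.
Qed.

Lemma cluster_ge_pull phi w v n : is_aut nb phi -> (cluster_ge (pull phi w) v n <-> cluster_ge w (phi v) n).
Proof.
  intros Hphi. pose proof Hphi as [[g [Hg Hg']] Ha]. split; intros [L [H1 [H2 H3]]].
  - exists (map phi L). repeat split.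
    + apply FinFun.Injective_map_NoDup; auto. intros a b; apply (aut_inj nb); assumption.
    + rewrite length_map; exact H2.
    + intros x Hx. apply in_map_iff in Hx. destruct Hx as [y [<- Hy]].
      apply (conn_pull phi w v y Hphi); auto.
  - exists (map g L). repeat split.
    + apply FinFun.Injective_map_NoDup; auto. intros a b H. rewrite <- (Hg' a), <- (Hg' b), H; reflexivity.
    + rewrite length_map; exact H2.
    + intros x Hx. apply in_map_iff in Hx. destruct Hx as [y [<- Hy]].
      apply (conn_pull phi w v (g y) Hphi). rewrite Hg'; auto.
Qed.

(** * The tail of the cluster size *)

Definition psi (p : R) (v : V) (n : nat) : R := P_cluster_ge nb p v n.

Lemma psi_Ex p v n S : 0 <= p <= 1 -> incl (ball v n) S ->
  psi p v n = Ex nb p S (fun w => ind (cluster_ge w v n)).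
Proof.
  intros Hp HS. unfold psi, P_cluster_ge. rewrite Pcyl_Ex. symmetry.
  apply Ex_irrel; auto. apply dep_cluster_ge.
Qed.

Lemma psi_bound p v n : 0 <= p <= 1 -> 0 <= psi p v n <= 1.
Proof. intros Hp. rewrite (psi_Ex p v n (ball v n)); auto using incl_refl. apply Ex_ind_bound; assumption. Qed.

Lemma psi_anti p v n m : 0 <= p <= 1 -> (n <= m)%nat -> psi p v m <= psi p v n.
Proof.
  intros Hp Hnm. rewrite (psi_Ex p v n (ball v m)), (psi_Ex p v m (ball v m)); auto using incl_refl, ball_le.
  apply Ex_le; auto. intros w _ _. apply ind_le. apply cluster_ge_le; exact Hnm.
Qed.

Lemma psi_aut p u v n : 0 <= p <= 1 -> transitive_graph nb -> psi p u n = psi p v n.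
Proof.
  intros Hp Ht. destruct (Ht v u) as [phi [Hphi <-]].
  rewrite (psi_Ex p v n (ball v n)) by auto using incl_refl.
  assert (Hi : incl (map phi (ball v n)) (ball (phi v) n)).
  { intros x Hx. apply in_map_iff in Hx. destruct Hx as [y [<- Hy]]. apply ball_aut; assumption. }
  rewrite (psi_Ex p (phi v) n (ball (phi v) n)) by auto using incl_refl.
  rewrite <- (Ex_aut nb nb_sym p phi (ball v n) _ _ Hp Hphi (dep_cluster_ge v n) Hi).
  apply Ex_ext; auto. intros w _ _. apply ind_iff. symmetry; apply cluster_ge_pull; exact Hphi.
Qed.

Lemma psi_continuous v n p : continuity_pt (fun q => psi q v n) p.
Proof.
  apply (continuity_pt_locally_ext (fun q => Ex nb q (ball v n) (fun w => ind (cluster_ge w v n))) _ 1 p).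
  - lra.
  - intros y _. unfold psi, P_cluster_ge. rewrite Pcyl_Ex. reflexivity.
  - apply Ex_continuous; exact nb_sym.
Qed.

Lemma psi_minus p v s S : 0 <= p <= 1 -> incl (ball v (Datatypes.S s)) S ->
  psi p v s - psi p v (Datatypes.S s) = Ex nb p S (fun w => ind (cs w v = s)).
Proof.
  intros Hp HS.
  rewrite (psi_Ex p v s S), (psi_Ex p v _ S); auto.
  2:{ intros x Hx; apply HS, (ball_le v s); auto. }
  rewrite <- Ex_minus. apply Ex_ext; auto. intros w Hw Hs.
  rewrite (ind_iff _ _ (cs_ge S w v s Hs)), (ind_iff _ _ (cs_ge S w v (Datatypes.S s) Hs)).
  destruct (lt_eq_lt_dec (cs w v) s) as [[H|H]|H].
  - rewrite !ind_false by lia; lra.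
  - rewrite (ind_true (s <= _)%nat), (ind_false (_ <= _)%nat), ind_true by lia; lra.
  - rewrite (ind_true (s <= _)%nat), (ind_true (_ <= _)%nat), ind_false by lia; lra.
Qed.

End Clusters.

(** * Sharpness of the phase transition *)

(** Random subsets of a list [l] appear below as filters of [l]. They keep its order, so the
    finitely many lists in [subs l] are all their possible values. *)
Fixpoint subs {T} (l : list T) : list (list T) :=
  match l with
  | [] => [[]]
  | x :: l' => map (cons x) (subs l') ++ subs l'
  end.

Lemma filter_subs {T} (f : T -> bool) l : In (filter f l) (subs l).
Proof.
  induction l as [|x l IH]; simpl; [auto|]. apply in_or_app.
  destruct (f x); [left; apply in_map; exact IH|right; exact IH].
Qed.

Lemma subs_incl {T} (l l' : list T) : In l' (subs l) -> incl l' l.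
Proof.
  revert l'; induction l as [|x l IH]; simpl; intros l' H.
  - destruct H as [<-|[]]; apply incl_refl.
  - apply in_app_or in H. destruct H as [H|H].
    + apply in_map_iff in H. destruct H as [k [<- H]]. apply incl_cons; [left; reflexivity|].
      apply incl_tl, IH, H.
    + apply incl_tl, IH, H.
Qed.

Lemma subs_NoDup {T} (l l' : list T) : NoDup l -> In l' (subs l) -> NoDup l'.
Proof.
  revert l'; induction l as [|x l IH]; simpl; intros l' Hn H.
  - destruct H as [<-|[]]; constructor.
  - inversion_clear Hn. apply in_app_or in H. destruct H as [H|H]; [|auto].
    apply in_map_iff in H. destruct H as [k [<- H]]. constructor; auto.
    intros Hx; apply (subs_incl _ _ H) in Hx; contradiction.
Qed.

Definition dec (P : Prop) : bool := if excluded_middle_informative P then true else false.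

Lemma dec_true P : dec P = true <-> P.
Proof. unfold dec; destruct excluded_middle_informative; split; auto; discriminate. Qed.

Lemma sum_max_attained {T} (l : list T) (f : T -> R) : l <> [] ->
  exists x, In x l /\ forall y, In y l -> f y <= f x.
Proof.
  induction l as [|x l IH]; [congruence|]. intros _. destruct l as [|x' l].
  - exists x; split; [left; reflexivity|]. intros y [<-|[]]; lra.
  - destruct IH as [z [Hz H]]; [discriminate|]. destruct (Rle_dec (f x) (f z)) as [Hle|Hle].
    + exists z; split; [right; exact Hz|]. intros y [<-|Hy]; auto.
    + exists x; split; [left; reflexivity|]. intros y [<-|Hy]; [lra|]. specialize (H y Hy); lra.
Qed.

Section Sharpness.
Context {V : Type} (nb : V -> list V).
Context (nb_nodup : forall v, NoDup (nb v)).
Context (nb_sym : forall v w, In w (nb v) -> In v (nb w)).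

Notation adj := (adj nb).
Notation ball := (ball nb).
Notation valid := (valid nb).
Notation dep := (dep nb).
Notation conn := (@open_conn V).
Notation Ex := (Ex nb).

Lemma Ex_partition {T} p S (X : config -> T) (l : list T) f : 0 <= p <= 1 -> NoDup l ->
  (forall w, In (X w) l) ->
  Ex p S (fun w => f (X w) w) = sum l (fun t => Ex p S (fun w => ind (X w = t) * f t w)).
Proof.
  intros Hp Hn H. rewrite <- Ex_sum. apply Ex_ext; auto. intros w _ _.
  symmetry. apply (sum_pick l (X w) (fun t => f t w)); auto.
Qed.

Lemma Ex_le_cst p S f c : 0 <= p <= 1 -> (forall w, valid w -> supp S w -> f w <= c) -> Ex p S f <= c.
Proof. intros Hp H. rewrite <- (Ex_cst nb p S c). apply Ex_le; auto. Qed.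

Lemma Ex_edge_le p S x y : 0 <= p <= 1 -> Ex p S (fun w => ind (w x y = true)) <= p.
Proof.
  intros Hp. destruct (classic (adj x y /\ In x S /\ In y S)) as [[H1 [H2 H3]]|H].
  - rewrite (Ex_avg nb p S _ x y) by assumption.
    apply Ex_le_cst; auto. intros w _ _. unfold avg; simpl.
    rewrite !upd_same by (left; auto). rewrite ind_true, ind_false by congruence. lra.
  - apply Ex_le_cst; auto. intros w Hw Hs. rewrite ind_false; [lra|].
    intros E. apply H. split; [apply Hw; exact E|]. apply Hs; exact E.
Qed.

(** The quantity of Duminil-Copin and Tassion: the expected number of open edges leaving [S] from
    vertices connected to [v] inside [S]. The factor [p] is the state of the leaving edge, which the
    connections inside [S] do not see. *)
Definition phi (p : R) (S : list V) (v : V) : R :=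
  p * sum S (fun x => sum (nb x) (fun y =>
    ind (~ In y S) * Ex p S (fun w => ind (conn (restr (fun z => In z S) w) v x)))).

Definition cl (S : list V) (u : V) (w : config) : list V :=
  filter (fun x => dec (conn (restr (fun z => In z S) w) u x)) S.

Lemma cl_In S u w x : In x (cl S u w) <-> In x S /\ conn (restr (fun z => In z S) w) u x.
Proof. unfold cl. rewrite filter_In, dec_true. reflexivity. Qed.

(** To recognise [C] as the cluster of [u] inside [S] it is enough to look at the edges of [S]
    touching [C]. All edges avoiding [C], and all edges leaving [S], stay fresh. *)
Lemma dep_cl S u C : NoDup S -> In u S ->
  dep (fun a b => inside S a b /\ (In a C \/ In b C)) (fun w => ind (cl S u w = C)).
Proof.
  intros HS Hu. apply dep_ind. intros w w' Hw Hw' E <-.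
  assert (He : forall w, enum (restr (fun z => In z S) w) u (cl S u w)).
  { intros w1. split; [apply NoDup_filter; exact HS|]. intros x. rewrite cl_In. split; [tauto|].
    intros H; split; auto. destruct (conn_restr_in _ _ _ _ H) as [<-|]; auto. }
  assert (H : enum (restr (fun z => In z S) w') u (cl S u w)).
  { apply (enum_agree nb (restr (fun z => In z S) w)); auto using valid_restr.
    intros a b Hab Ha. unfold restr. destruct excluded_middle_informative as [[H1 H2]|]; auto.
    apply E; auto. split; [split; assumption|left; exact Ha]. }
  apply filter_ext_in. intros x Hx. apply Bool.eq_iff_eq_true. rewrite !dec_true.
  rewrite <- (proj2 H x), cl_In. tauto.
Qed.

Lemma sum_ind_In_le (l S : list V) : NoDup l -> sum l (fun z => ind (In z S)) <= INR (length S).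
Proof.
  intros Hl. rewrite (sum_ext l _ (fun z => ind (dec (In z S) = true) * 1)).
  - rewrite <- sum_filter, sum_const, Rmult_1_r. apply le_INR, NoDup_incl_length.
    + apply NoDup_filter; exact Hl.
    + intros x Hx. apply filter_In in Hx. apply dec_true; tauto.
  - intros x _. rewrite Rmult_1_r. apply ind_iff. symmetry; apply dec_true.
Qed.

(** A path from [u] to a vertex outside [S] leaves the cluster of [u] in [S] for a last time. The
    edge used must leave [S] itself, since an open edge within [S] would not leave that cluster. *)
Lemma conn_decompose S u z w : In u S -> valid w ->
  ind (conn w u z) <= ind (In z S) + sum S (fun x => sum (nb x) (fun y => ind (~ In y S) *
    (ind (In x (cl S u w)) * (ind (w x y = true) *
      ind (conn (restr (fun a => ~ In a (cl S u w)) w) y z))))).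
Proof.
  intros Hu Hw. set (term := fun x y => ind (~ In y S) *
    (ind (In x (cl S u w)) * (ind (w x y = true) *
      ind (conn (restr (fun a => ~ In a (cl S u w)) w) y z)))).
  change (ind (conn w u z) <= ind (In z S) + sum S (fun x => sum (nb x) (term x))).
  assert (Hpos : forall x y, 0 <= term x y).
  { intros x y. unfold term. repeat apply Rmult_le_pos; apply ind_bound. }
  assert (Hpos' : forall x, 0 <= sum (nb x) (term x)) by (intros; apply sum_nonneg; auto).
  assert (Hp2 : 0 <= sum S (fun x => sum (nb x) (term x))) by (apply sum_nonneg; auto).
  destruct (classic (conn w u z)) as [H|H].
  2:{ rewrite ind_false by exact H. pose proof (ind_bound (In z S)). lra. }
  destruct (classic (In z S)) as [Hz|Hz].
  { rewrite ind_true, ind_true by assumption. lra. }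
  destruct (exit_last (fun a => In a (cl S u w)) w u z) as [a [b [Ha [Hb [Hab Hbz]]]]]; auto.
  { apply cl_In; split; auto. apply conn_refl. }
  { rewrite cl_In; tauto. }
  pose proof Ha as Ha'. apply cl_In in Ha. destruct Ha as [HaS Ha].
  assert (HbS : ~ In b S).
  { intros HbS. apply Hb, cl_In; split; auto. apply conn_trans with a; auto.
    apply conn_edge, restr_true; auto. }
  apply Rle_trans with (0 + sum S (fun x => sum (nb x) (term x))); [|apply Rplus_le_compat_r, ind_bound].
  rewrite Rplus_0_l. apply Rle_trans with (term a b).
  - unfold term. rewrite !ind_true by assumption. lra.
  - apply Rle_trans with (sum (nb a) (term a)).
    + apply sum_ge_term; auto. apply Hw; exact Hab.
    + apply (sum_ge_term S (fun x => sum (nb x) (term x))); auto.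
Qed.

Definition tau (p : R) (L : list V) (u z : V) : R := Ex p L (fun w => ind (conn w u z)).

Lemma mono_conn_restr P u z : mono (fun w => ind (conn (restr P w) u z)).
Proof. apply mono_ind. intros w w' H. apply conn_mono, restr_cfg_le, H. Qed.

(* Revealing the cluster of [u] in [S] leaves the edge [xy] and the connections avoiding that
   cluster independent of what was revealed. *)
Lemma tau_term p L S u z x y : 0 <= p <= 1 -> NoDup S -> In u S -> ~ In y S ->
  Ex p L (fun w => ind (In x (cl S u w)) * (ind (w x y = true) *
      ind (conn (restr (fun a => ~ In a (cl S u w)) w) y z)))
  <= Ex p S (fun w => ind (conn (restr (fun a => In a S) w) u x)) * (p * tau p L y z).
Proof.
  intros Hp HS Hu Hy.
  assert (Htau : 0 <= tau p L y z) by (apply Ex_ind_bound; auto).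
  assert (HX : forall w, In (cl S u w) (nodup eqdec (subs S))).
  { intros w. apply nodup_In, filter_subs. }
  rewrite (Ex_partition p L (cl S u) (nodup eqdec (subs S)) (fun C w =>
    ind (In x C) * (ind (w x y = true) * ind (conn (restr (fun a => ~ In a C) w) y z))));
    auto using NoDup_nodup.
  apply Rle_trans with (sum (nodup eqdec (subs S)) (fun C =>
    Ex p L (fun w => ind (cl S u w = C) * ind (In x C)) * (p * tau p L y z))).
  - apply sum_le. intros C _. destruct (classic (In x C)) as [Hx|Hx].
    2:{ rewrite (Ex_ext nb nb_sym p L _ (fun _ => 0)), Ex_cst; auto.
        - apply Rmult_le_pos; [|apply Rmult_le_pos; lra]. apply Ex_nonneg; auto.
          intros; apply Rmult_le_pos; apply ind_bound.
        - intros w _ _. rewrite (ind_false (In x C)) by assumption. lra. }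
    rewrite (Ex_ext nb nb_sym p L _ (fun w => ind (cl S u w = C) *
      (ind (w x y = true) * ind (conn (restr (fun a => ~ In a C) w) y z)))); auto.
    2:{ intros w _ _. rewrite (ind_true (In x C)) by assumption. lra. }
    rewrite (Ex_ext nb nb_sym p L (fun w => ind (cl S u w = C) * ind (In x C)) (fun w => ind (cl S u w = C))); auto.
    2:{ intros w _ _. rewrite (ind_true (In x C)) by assumption. lra. }
    assert (D1 : dep (fun a b => a = x /\ b = y) (fun w => ind (w x y = true))).
    { intros w w' Hw Hw' E. apply ind_iff. destruct (classic (adj x y)) as [Hxy|Hxy].
      - rewrite (E x y); tauto.
      - split; intros H; exfalso; apply Hxy; [apply Hw|apply Hw']; exact H. }
    pose proof (dep_restr nb (fun a => ~ In a C) (fun w => ind (conn w y z))) as D2.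
    pose proof (dep_cl S u C HS Hu) as D3.
    assert (E : Ex p L (fun w => ind (cl S u w = C) *
      (ind (w x y = true) * ind (conn (restr (fun a => ~ In a C) w) y z))) =
      Ex p L (fun w => ind (cl S u w = C)) * (Ex p L (fun w => ind (w x y = true)) *
        Ex p L (fun w => ind (conn (restr (fun a => ~ In a C) w) y z)))).
    { rewrite (Ex_indep nb nb_sym p L _ (fun a b => (a = x /\ b = y) \/ (~ In a C /\ ~ In b C)) _ _ D3).
      - f_equal. apply (Ex_indep nb nb_sym p L _ _ _ _ D1 D2).
        intros a b [-> ->]; tauto.
      - apply dep_op2; [eapply dep_weaken; [| |exact D1]|eapply dep_weaken; [| |exact D2]]; auto; tauto.
      - unfold inside. intros a b [[Ha Hb] Hc] [[[-> ->]|?]|[[-> ->]|?]]; tauto. }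
    rewrite E. apply Rmult_le_compat_l; [apply Ex_ind_bound; auto|].
    apply Rmult_le_compat; try (apply Ex_ind_bound; auto).
    + apply Ex_edge_le; exact Hp.
    + apply Ex_le; auto. intros w _ _. apply ind_le. apply conn_mono, restr_le.
  - rewrite sum_scal_r. apply Rmult_le_compat_r; [apply Rmult_le_pos; lra|].
    rewrite <- (Ex_partition p L (cl S u) (nodup eqdec (subs S)) (fun C w => ind (In x C)));
      auto using NoDup_nodup.
    apply Rle_trans with (Ex p L (fun w => ind (conn (restr (fun a => In a S) w) u x))).
    + apply Ex_le; auto. intros w _ _. apply ind_le. rewrite cl_In; tauto.
    + rewrite <- (Ex_irrel nb nb_sym p S (S ++ L)); auto.
      * apply Ex_mono_S; auto; [apply mono_conn_restr|apply incl_appr, incl_refl].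
      * apply incl_appl, incl_refl.
      * apply (dep_restr nb (fun a => In a S) (fun w => ind (conn w u x))).
Qed.

(** With [chi u] the expected number of vertices of [L] connected to [u], the decomposition at the
    last exit gives [chi m <= s + r * chi m] at a maximiser [m]. The finite box breaks transitivity,
    which is why a maximum is taken and a set [Sf u] is supplied at every vertex. *)
Lemma susceptibility p L (Sf : V -> list V) s r : 0 <= p <= 1 -> r < 1 -> NoDup L ->
  (forall u, NoDup (Sf u) /\ In u (Sf u) /\ INR (length (Sf u)) <= s /\ phi p (Sf u) u <= r) ->
  forall u, In u L -> sum L (tau p L u) <= s / (1 - r).
Proof.
  intros Hp Hr HL HSf.
  destruct (classic (L = [])) as [->|HL0]; [intros u []|].
  set (chi := fun u => sum L (tau p L u)).
  assert (Hchi0 : forall u, 0 <= chi u) by (intros u; apply sum_nonneg; intros; apply Ex_ind_bound; auto).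
  destruct (sum_max_attained L chi HL0) as [m [Hm Hmax]].
  (* The decomposition may lead to a vertex [y] outside the box; no open edge reaches it, so [chi y]
     is [0]. *)
  assert (Hmax' : forall y, chi y <= chi m).
  { intros y. destruct (classic (In y L)) as [Hy|Hy]; auto.
    replace (chi y) with 0; auto. symmetry. apply sum_0. intros z Hz. unfold tau.
    rewrite <- (Ex_cst nb p L 0). apply Ex_ext; auto. intros w _ Hs. apply ind_false.
    intros H; apply Hy. eapply conn_supp_l; eauto. }
  assert (Hrec : chi m <= s + r * chi m).
  { destruct (HSf m) as [H1 [H2 [H3 H4]]].
    set (S := Sf m) in *.
    apply Rle_trans with (sum L (fun z => ind (In z S) + sum S (fun x => sum (nb x) (fun y =>
      ind (~ In y S) * (Ex p S (fun w => ind (conn (restr (fun a => In a S) w) m x)) * (p * tau p L y z)))))).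
    - apply sum_le. intros z Hz. unfold tau at 1.
      eapply Rle_trans; [apply Ex_le; [auto|auto|]; intros w Hw _; apply (conn_decompose S m z w); auto|].
      rewrite Ex_plus, Ex_cst. apply Rplus_le_compat_l. rewrite Ex_sum. apply sum_le. intros x _.
      rewrite Ex_sum. apply sum_le. intros y _. rewrite Ex_scal.
      destruct (classic (In y S)) as [Hy|Hy].
      + rewrite ind_false by tauto. lra.
      + apply Rmult_le_compat_l; [apply ind_bound|]. apply tau_term; auto.
    - rewrite sum_plus. apply Rplus_le_compat.
      + eapply Rle_trans; [apply sum_ind_In_le; exact HL|exact H3].
      + apply Rle_trans with (phi p S m * chi m); [|apply Rmult_le_compat_r; auto].
        unfold phi. rewrite Rmult_assoc, (Rmult_comm p), <- sum_scal_r, <- sum_scal_r.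
        rewrite sum_swap. apply sum_le. intros x _.
        rewrite sum_swap, <- !sum_scal_r. apply sum_le. intros y _.
        rewrite sum_scal, sum_scal, sum_scal. fold (chi y).
        assert (0 <= ind (~ In y S)) by apply ind_bound.
        assert (0 <= Ex p S (fun w => ind (conn (restr (fun a => In a S) w) m x))) by (apply Ex_ind_bound; auto).
        assert (p * chi y <= p * chi m) by (apply Rmult_le_compat_l; [lra|auto]).
        set (A := ind (~ In y S)) in *. set (B := Ex p S _) in *.
        replace (A * B * chi m * p) with (A * (B * (p * chi m))) by ring.
        apply Rmult_le_compat_l; auto. apply Rmult_le_compat_l; auto. }
  intros u Hu. apply Rle_trans with (chi m); [apply Hmax'|].
  apply Rmult_le_reg_r with (1 - r); [lra|]. unfold Rdiv. rewrite Rmult_assoc, Rinv_l; lra.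
Qed.

Lemma sum_nb_aut f x h : is_aut nb f -> sum (nb (f x)) h = sum (nb x) (fun y => h (f y)).
Proof.
  intros Hf. rewrite <- (sum_map f (nb x) h). apply sum_perm, NoDup_Permutation; auto.
  - apply FinFun.Injective_map_NoDup; auto. intros a b; apply (aut_inj nb); assumption.
  - intros y. rewrite in_map_iff. pose proof Hf as [[g [Hg Hg']] _]. split.
    + intros Hy. exists (g y). split; auto. apply (aut_adj_inv nb f); auto. rewrite Hg'; exact Hy.
    + intros [z [<- Hz]]. apply (aut_adj nb f); auto.
Qed.

Lemma In_map_aut f S x : is_aut nb f -> (In (f x) (map f S) <-> In x S).
Proof.
  intros Hf. rewrite in_map_iff. split.
  - intros [y [H Hy]]. apply (aut_inj nb f Hf) in H; subst; exact Hy.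
  - intros H; exists x; auto.
Qed.

Lemma phi_aut p f S v : 0 <= p <= 1 -> is_aut nb f -> phi p (map f S) (f v) = phi p S v.
Proof.
  intros Hp Hf. unfold phi. f_equal. rewrite sum_map. apply sum_ext. intros x _.
  rewrite sum_nb_aut by exact Hf. apply sum_ext. intros y _.
  rewrite (ind_iff (~ In (f y) (map f S)) (~ In y S)) by (rewrite In_map_aut; tauto).
  f_equal. rewrite <- (Ex_aut nb nb_sym p f S (map f S)); auto using incl_refl.
  - apply Ex_ext; auto. intros w _ _. apply ind_iff.
    rewrite <- (conn_pull nb f) by exact Hf.
    replace (pull f (restr (fun z => In z (map f S)) w)) with (restr (fun z => In z S) (pull f w)); [tauto|].
    do 2 (apply functional_extensionality; intro). unfold pull, restr.
    repeat destruct excluded_middle_informative; try reflexivity; exfalso;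
      rewrite !In_map_aut in * by exact Hf; tauto.
  - apply (dep_restr nb (fun a => In a S) (fun w => ind (conn w v x))).
Qed.

(** Markov's inequality for the cluster in a box containing [ball u n]. An automorphism carries [S]
    to every vertex without changing its size or its [phi]. *)
Lemma tail_from_phi p S v : 0 <= p <= 1 -> transitive_graph nb -> NoDup S -> In v S -> phi p S v < 1 ->
  forall u n, INR n * psi nb p u n <= INR (length S) / (1 - phi p S v).
Proof.
  intros Hp Ht HS Hv Hphi u n.
  assert (HSf : forall u, exists S', NoDup S' /\ In u S' /\ INR (length S') <= INR (length S) /\ phi p S' u <= phi p S v).
  { intros x. destruct (Ht v x) as [f [Hf <-]]. exists (map f S). repeat split.
    - apply FinFun.Injective_map_NoDup; auto. intros a b; apply (aut_inj nb); assumption.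
    - apply in_map; exact Hv.
    - rewrite length_map; lra.
    - rewrite phi_aut by assumption; lra. }
  set (Sf := fun u => proj1_sig (constructive_indefinite_description _ (HSf u))).
  set (L := nodup eqdec (ball u n)).
  assert (HuL : In u L) by (apply nodup_In, ball_self).
  eapply Rle_trans; [|apply (susceptibility p L Sf); auto].
  - rewrite (psi_Ex nb nb_sym p u n L); auto.
    2:{ intros x Hx. apply nodup_In; exact Hx. }
    unfold tau. rewrite <- Ex_sum, <- Ex_scal. apply Ex_le; auto. intros w Hw Hs.
    destruct (classic (cluster_ge w u n)) as [H|H].
    + rewrite ind_true, Rmult_1_r by exact H. apply sum_ind_count.
      destruct H as [K [H1 [H2 H3]]]. exists K; repeat split; auto. eapply conn_supp; eauto.
    + rewrite ind_false, Rmult_0_r by exact H. apply sum_nonneg; intros; apply ind_bound.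
  - apply NoDup_nodup.
  - intros x. exact (proj2_sig (constructive_indefinite_description _ (HSf x))).
  - exact HuL.
Qed.

Lemma phi_mono_p p q S v : 0 <= p -> p <= q -> q <= 1 -> phi p S v <= phi q S v.
Proof.
  intros Hp Hpq Hq. unfold phi. apply Rmult_le_compat; auto.
  - apply sum_nonneg; intros; apply sum_nonneg; intros. apply Rmult_le_pos; [apply ind_bound|].
    apply Ex_ind_bound; auto; lra.
  - apply sum_le; intros; apply sum_le; intros. apply Rmult_le_compat_l; [apply ind_bound|].
    apply Ex_mono_p; auto. apply mono_conn_restr.
Qed.

End Sharpness.

(** The two lists may orient an edge differently, so ordinary list inclusion does not apply; the
    hypothesis on [T] makes orientation irrelevant. *)
Lemma sum_simple_le {V} (l Es : list (V * V)) (T : V * V -> R) : simple l ->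
  (forall e, In e l -> exists e', In e' Es /\ same_edge (fst e') (snd e') (fst e) (snd e)) ->
  (forall e, 0 <= T e) ->
  (forall e e', same_edge (fst e') (snd e') (fst e) (snd e) -> T e' = T e) ->
  sum l T <= sum Es T.
Proof.
  intros Hl Hc Hp Hs. revert Es Hc. induction Hl as [|e l Hne Hl IH]; intros Es Hc.
  - apply sum_nonneg; auto.
  - destruct (Hc e (or_introl eq_refl)) as [e' [He' Hs']].
    apply in_split in He'. destruct He' as [E1 [E2 ->]].
    rewrite sum_app, !sum_cons, (Hs _ _ Hs').
    assert (sum l T <= sum (E1 ++ E2) T); [|rewrite sum_app in H; lra].
    apply IH. intros d Hd. destruct (Hc d (or_intror Hd)) as [d' [Hd' Hsd]].
    exists d'; split; auto. apply in_app_or in Hd'. apply in_or_app.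
    destruct Hd' as [?|[<-|?]]; auto. exfalso. apply (Hne d Hd).
    eapply same_edge_trans; [apply same_edge_sym; exact Hs'|exact Hsd].
Qed.

(** * The differential inequality for escaping a box, and the zero-one law *)

Section Supercritical.
Context {V : Type} (nb : V -> list V).
Context (nb_nodup : forall v, NoDup (nb v)).
Context (nb_sym : forall v w, In w (nb v) -> In v (nb w)).

Notation adj := (adj nb).
Notation ball := (ball nb).
Notation valid := (valid nb).
Notation dep := (dep nb).
Notation conn := (@open_conn V).
Notation Ex := (Ex nb).

Definition escapes (B : list V) (w : config) (x : V) : Prop := exists u, ~ In u B /\ conn w x u.

Definition trapped (B : list V) (w : config) : list V :=
  filter (fun x => dec (~ escapes B w x)) B.

Lemma trapped_In B w x : In x (trapped B w) <-> In x B /\ ~ escapes B w x.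
Proof. unfold trapped. rewrite filter_In, dec_true. reflexivity. Qed.

Lemma escapes_mono B w w' x : cfg_le w w' -> escapes B w x -> escapes B w' x.
Proof. intros H [u [Hu Hc]]; exists u; split; auto. eapply conn_mono; eauto. Qed.

(** The trapped set is found by exploring from outside [B], and this exploration never looks at an
    edge with both ends in [S]. Given that the trapped set is [S], connections inside [S] therefore
    keep their law. *)
Lemma dep_trapped B S : dep (fun a b => ~ (In a S /\ In b S)) (fun w => ind (trapped B w = S)).
Proof.
  apply dep_ind. intros w w' Hw Hw' E <-. symmetry.
  apply filter_ext_in. intros x Hx. apply Bool.eq_iff_eq_true. rewrite !dec_true.
  set (P := fun z => In z (trapped B w)) in *.
  assert (HP : forall z, ~ P z <-> ~ In z B \/ escapes B w z).
  { intros z. unfold P. rewrite trapped_In. destruct (classic (escapes B w z)); tauto. }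
  split; intros Hn He; apply Hn; clear Hn.
  - apply NNPP; intros Hn. assert (Px : P x) by (unfold P; rewrite trapped_In; auto).
    destruct He as [u [Hu Hc]].
    destruct (exit_first P w' x u Hc Px) as [a [b [_ [Ha [Hb Hab]]]]]; [apply HP; auto|].
    assert (Hab' : w a b = true).
    { rewrite E; auto; [apply Hw'; exact Hab|]. unfold P in *; tauto. }
    unfold P in Ha. apply trapped_In in Ha. apply (proj2 Ha). apply HP in Hb.
    destruct Hb as [Hb|[c [Hcb Hbc]]]; [exists b|exists c]; split; auto.
    + apply conn_edge; exact Hab'.
    + apply conn_trans with b; auto. apply conn_edge; exact Hab'.
  - destruct He as [u [Hu Hc]]. exists u; split; auto. clear Hx.
    apply clos_rt_rt1n in Hc. induction Hc as [x|x y u Hxy Hc IH]; [apply conn_refl|].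
    apply conn_trans with y; [|auto]. apply conn_edge. rewrite <- E; [exact Hxy|apply Hw; exact Hxy|].
    intros [_ Hy]. apply trapped_In in Hy. apply (proj2 Hy). exists u; split; auto.
    apply clos_rt1n_rt; exact Hc.
Qed.

Lemma mono_escapes B v : mono (fun w => ind (escapes B w v)).
Proof. apply mono_ind. intros; eapply escapes_mono; eauto. Qed.

Lemma simple_boundary (S0 S : list V) : NoDup S -> incl S S0 ->
  simple (flat_map (fun x => map (fun y => (x, y)) (filter (fun y => dec (~ In y S0)) (nb x))) S).
Proof.
  intros HS. induction HS as [|x S Hx HS IH]; intros Hi; simpl; [constructor|].
  assert (Hi' : incl S S0) by (intros z Hz; apply Hi; right; exact Hz).
  assert (Hx0 : In x S0) by (apply Hi; left; reflexivity).
  specialize (IH Hi').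
  assert (Hr : forall e, In e (flat_map (fun x => map (fun y => (x, y)) (filter (fun y => dec (~ In y S0)) (nb x))) S) ->
    In (fst e) S).
  { intros e He. apply in_flat_map in He. destruct He as [z [Hz He]].
    apply in_map_iff in He. destruct He as [y [<- _]]; exact Hz. }
  revert IH Hr. generalize (flat_map (fun x => map (fun y => (x, y)) (filter (fun y => dec (~ In y S0)) (nb x))) S) as l.
  intros l Hl Hr. pose proof (nb_nodup x) as Hn. induction Hn as [|y k Hy Hk IHk]; simpl; [exact Hl|].
  destruct (dec (~ In y S0)) eqn:Ey; [|exact IHk]. simpl. apply -> dec_true in Ey.
  constructor; [|exact IHk]. intros e He Hs. apply in_app_or in He. simpl in Hs. destruct He as [He|He].
  - apply in_map_iff in He. destruct He as [z [<- Hz]]. apply filter_In in Hz. destruct Hz as [Hz _].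
    destruct Hs as [[_ H]|[H _]]; simpl in H; subst; contradiction.
  - apply Hr in He. destruct Hs as [[H _]|[H1 H2]]; [rewrite H in He; exact (Hx He)|].
    rewrite H1 in He. exact (Ey (Hi' _ He)).
Qed.

(* Closed pivotal edges are exactly the edges leaving the set of trapped vertices whose inner
   endpoint is connected to [v]. *)
Lemma pivotal_lower q B L v : 0 <= q < 1 -> NoDup B -> In v B -> incl B L ->
  (forall x y, In x B -> adj x y -> In x L /\ In y L) ->
  (forall S, In v S -> NoDup S -> 1 <= phi nb q S v) ->
  1 - Ex q L (fun w => ind (escapes B w v)) <=
  (1 - q) * sum (edges_in nb L) (fun e => Ex q L (fun w =>
    ind (escapes B (upd w (fst e) (snd e) true) v) - ind (escapes B (upd w (fst e) (snd e) false) v))).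
Proof.
  intros Hq HB Hv HBL HL Hphi. assert (Hq' : 0 <= q <= 1) by lra.
  (* The discrete derivative at an edge does not see the state of that edge, so the factor [1 - q]
     is absorbed as the event that the edge is closed. *)
  set (T := fun (w : config) (e : V * V) => ind (w (fst e) (snd e) = false) *
    (ind (escapes B (upd w (fst e) (snd e) true) v) - ind (escapes B (upd w (fst e) (snd e) false) v))).
  assert (HT : (1 - q) * sum (edges_in nb L) (fun e => Ex q L (fun w =>
    ind (escapes B (upd w (fst e) (snd e) true) v) - ind (escapes B (upd w (fst e) (snd e) false) v)))
    = Ex q L (fun w => sum (edges_in nb L) (T w))).
  { rewrite Ex_sum, <- sum_scal. apply sum_ext. intros [x y] He. apply edges_in_elem in He. simpl in He.
    destruct He as [Hxy [Hx Hy]]. rewrite (Ex_avg nb q L (fun w => T w (x, y)) x y) by assumption.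
    rewrite <- Ex_scal. apply Ex_ext; auto. intros w _ _. unfold avg, T; simpl.
    rewrite !upd_same by (left; auto). rewrite (ind_false (true = false)), (ind_true (false = false)) by congruence.
    rewrite !upd_upd by (left; auto). lra. }
  rewrite HT. clear HT.
  set (G := fun S w => ind (In v S) * sum S (fun x => sum (nb x) (fun y => ind (~ In y S) *
    ind (conn (restr (fun z => In z S) w) v x)))).
  apply Rle_trans with (Ex q L (fun w => G (trapped B w) w)).
  - assert (HX : forall w, In (trapped B w) (nodup eqdec (subs B))).
    { intros w. apply nodup_In, filter_subs. }
    rewrite (Ex_partition nb nb_sym q L (trapped B) (nodup eqdec (subs B)) G); auto using NoDup_nodup.
    apply Rle_trans with (sum (nodup eqdec (subs B)) (fun S => Ex q L (fun w => ind (trapped B w = S) * ind (In v S)))).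
    + rewrite <- (Ex_partition nb nb_sym q L (trapped B) (nodup eqdec (subs B)) (fun S w => ind (In v S)));
        auto using NoDup_nodup.
      rewrite <- (Ex_cst nb q L 1), <- Ex_minus. apply Ex_le; auto. intros w _ _.
      rewrite <- ind_not. apply ind_le. rewrite trapped_In; tauto.
    + apply sum_le. intros S HS. apply nodup_In in HS.
      assert (HSn : NoDup S) by (eapply subs_NoDup; eauto). apply subs_incl in HS.
      assert (DG : dep (inside S) (G S)).
      { unfold G. apply dep_op2; [apply dep_cst|]. apply dep_sum; intros x _.
        apply dep_sum; intros y _. apply dep_op2; [apply dep_cst|].
        apply (dep_restr nb (fun z => In z S) (fun w => ind (conn w v x))). }
      rewrite (Ex_indep nb nb_sym q L _ (inside S) _ _ (dep_trapped B S) DG).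
      2:{ unfold inside; tauto. }
      rewrite (Ex_ext nb nb_sym q L _ (fun w => ind (In v S) * ind (trapped B w = S))), Ex_scal by (auto; intros; lra).
      rewrite Rmult_comm. apply Rmult_le_compat_l; [apply Ex_ind_bound; auto|].
      destruct (classic (In v S)) as [HvS|HvS].
      2:{ rewrite ind_false by assumption. apply Ex_nonneg; auto. intros w _ _. unfold G.
          rewrite ind_false by assumption. lra. }
      rewrite ind_true by assumption.
      assert (HGS : Ex q L (G S) = sum S (fun x => sum (nb x) (fun y => ind (~ In y S) *
        Ex q S (fun w => ind (conn (restr (fun z => In z S) w) v x))))).
      { unfold G. rewrite Ex_scal, ind_true, Rmult_1_l by assumption.
        rewrite Ex_sum. apply sum_ext; intros x _. rewrite Ex_sum. apply sum_ext; intros y _.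
        rewrite Ex_scal. f_equal. apply Ex_irrel; auto.
        - eapply incl_tran; eauto.
        - apply (dep_restr nb (fun z => In z S) (fun w => ind (conn w v x))). }
      (* [phi] contains the factor [q <= 1], so the sum without it is also at least [1]. *)
      pose proof (Hphi S HvS HSn) as H. unfold phi in H. rewrite HGS.
      set (Z := sum S _) in *.
      assert (0 <= Z).
      { apply sum_nonneg; intros; apply sum_nonneg; intros; apply Rmult_le_pos; [apply ind_bound|].
        apply Ex_ind_bound; auto. }
      nra.
  - apply Ex_le; auto. intros w Hw Hs. unfold G.
    assert (HTn : forall e, 0 <= T w e).
    { intros e. unfold T. apply Rmult_le_pos; [apply ind_bound|].
      pose proof (mono_escapes B v _ _ (cfg_le_upd_ft w (fst e) (snd e))). simpl in H. lra. }
    destruct (classic (In v (trapped B w))) as [Hvt|Hvt].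
    2:{ rewrite ind_false, Rmult_0_l by assumption. apply sum_nonneg; auto. }
    rewrite ind_true, Rmult_1_l by assumption.
    set (S := trapped B w) in *.
    assert (HS : NoDup S) by (apply NoDup_filter; exact HB).
    (* The edge boundary of the trapped set, oriented outwards. *)
    set (l := flat_map (fun x => map (fun y => (x, y)) (filter (fun y => dec (~ In y S)) (nb x))) S).
    apply Rle_trans with (sum l (fun e => ind (conn (restr (fun z => In z S) w) v (fst e)))).
    { unfold l. rewrite sum_flat_map. apply sum_le; intros x _. rewrite sum_map, sum_filter. simpl.
      apply sum_le; intros y _. apply Rmult_le_compat_r; [apply ind_bound|]. apply ind_le, dec_true. }
    assert (Hl : forall e, In e l -> In (fst e) S /\ adj (fst e) (snd e) /\ ~ In (snd e) S).
    { intros e He. apply in_flat_map in He. destruct He as [x [Hx He]].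
      apply in_map_iff in He. destruct He as [y [<- He]]. apply filter_In in He.
      rewrite dec_true in He. simpl; tauto. }
    apply Rle_trans with (sum l (T w)).
    + apply sum_le. intros e He. destruct (Hl e He) as [H1 [H2 H3]].
      destruct (classic (conn (restr (fun z => In z S) w) v (fst e))) as [Hc|Hc].
      2:{ rewrite ind_false by assumption. auto. }
      apply (conn_mono _ w) in Hc; [|apply restr_le].
      assert (Hesc : escapes B (upd w (fst e) (snd e) true) v).
      { assert (Ho : conn (upd w (fst e) (snd e) true) v (snd e)).
        { apply conn_trans with (fst e); [eapply conn_mono; [apply cfg_le_open|exact Hc]|].
          apply conn_edge, upd_same; left; auto. }
        destruct (classic (In (snd e) B)) as [Hb|Hb].
        - assert (He2 : escapes B w (snd e)).
          { apply NNPP; intros Hn. apply H3, trapped_In; auto. }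
          destruct He2 as [u [Hu Huc]]. exists u; split; auto.
          apply conn_trans with (snd e); [exact Ho|]. eapply conn_mono; [apply cfg_le_open|exact Huc].
        - exists (snd e); auto. }
      assert (Hcl : w (fst e) (snd e) = false).
      { destruct (w (fst e) (snd e)) eqn:E; [exfalso|reflexivity]. apply H3.
        apply trapped_In in H1. destruct H1 as [H1 H1'].
        assert (Hx : ~ escapes B w (snd e)).
        { intros [u [Hu Huc]]. apply H1'. exists u; split; auto.
          apply conn_trans with (snd e); auto. apply conn_edge; exact E. }
        apply trapped_In; split; auto. apply NNPP; intros Hb. apply Hx. exists (snd e); split; auto.
        apply conn_refl. }
      unfold T. rewrite (ind_true (w _ _ = false)) by exact Hcl.
      rewrite (upd_id w (fst e) (snd e) false) by (try exact Hcl; rewrite (proj1 Hw); exact Hcl).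
      rewrite (ind_true (escapes B (upd w _ _ true) v)) by exact Hesc.
      rewrite (ind_false (escapes B w v)) by (apply trapped_In in Hvt; tauto).
      pose proof (ind_bound (conn (restr (fun z => In z S) w) v (fst e))). lra.
    + apply sum_simple_le; auto.
      * apply simple_boundary; auto using incl_refl.
      * intros e He. destruct (Hl e He) as [H1 [H2 H3]]. apply edges_in_covers; auto.
        apply trapped_In in H1. apply (HL (fst e) (snd e)); tauto.
      * intros e e' Hs'. unfold T. rewrite !(upd_edge w _ _ _ _ _ Hs'). f_equal.
        apply ind_iff. destruct Hs' as [[-> ->]|[-> ->]]; [tauto|]. rewrite (proj1 Hw). tauto.
Qed.

(** If [th r] is the escape probability, [1 - th <= (1 - r) th'] says that [(1 - th r) / (1 - r)]
    does not increase on [[p, q]]. Comparing the endpoints, with [th p >= 0], gives the bound, which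
    does not depend on the box. *)
Lemma escape_lower p q v B L : 0 <= p < q -> q < 1 -> NoDup B -> In v B -> incl B L ->
  (forall x y, In x B -> adj x y -> In x L /\ In y L) ->
  (forall S, In v S -> NoDup S -> 1 <= phi nb p S v) ->
  (q - p) / (1 - p) <= Ex q L (fun w => ind (escapes B w v)).
Proof.
  intros Hpq Hq HB Hv HBL HL Hphi.
  set (th := fun q => Ex q L (fun w => ind (escapes B w v))).
  set (th' := fun q => sum (edges_in nb L) (fun e => Ex q L (fun w =>
    ind (escapes B (upd w (fst e) (snd e) true) v) - ind (escapes B (upd w (fst e) (snd e) false) v)))).
  assert (HD : forall r, derivable_pt_lim th r (th' r)) by (intros r; exact (Ex_derivable nb nb_sym r L (fun w => ind (escapes B w v)))).
  assert (Hth : forall r, p <= r <= q -> 1 - th r <= (1 - r) * th' r).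
  { intros r Hr. apply pivotal_lower; auto; [lra|]. intros S HS1 HS2.
    eapply Rle_trans; [apply Hphi; eauto|]. apply phi_mono_p; auto; lra. }
  destruct (MVT_cor2 (fun r => (1 - th r) * / (1 - r))
    (fun r => (- th' r) * / (1 - r) + (1 - th r) * (/ (1 - r) * / (1 - r))) p q) as [c [Hc1 Hc2]].
  { lra. }
  { intros c Hc.
    assert (D1 : derivable_pt_lim (fun r => 1 - th r) c (- th' c)).
    { replace (- th' c) with (0 - th' c) by lra.
      apply (derivable_pt_lim_minus (fct_cte 1) th); [apply derivable_pt_lim_const|apply HD]. }
    assert (D2 : derivable_pt_lim (fun r => / (1 - r)) c (/ (1 - c) * / (1 - c))).
    { assert (D3 : derivable_pt_lim (fun r => 1 - r) c (-1)).
      { replace (-1) with (0 - 1) by lra.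
        apply (derivable_pt_lim_minus (fct_cte 1) id); [apply derivable_pt_lim_const|apply derivable_pt_lim_id]. }
      pose proof (derivable_pt_lim_div (fct_cte 1) _ c _ _ (derivable_pt_lim_const 1 c) D3) as D4.
      assert (H1c : 1 - c <> 0) by lra. specialize (D4 H1c).
      apply (derivable_pt_lim_ext (div_fct (fct_cte 1) (fun r => 1 - r))).
      - intros z. unfold div_fct, fct_cte, Rdiv. apply Rmult_1_l.
      - replace (/ (1 - c) * / (1 - c)) with ((0 * (1 - c) - -1 * fct_cte 1 c) / Rsqr (1 - c)); [exact D4|].
        unfold fct_cte, Rsqr. field; exact H1c. }
    apply (derivable_pt_lim_mult _ _ c _ _ D1 D2). }
  assert (Hneg : (- th' c) * / (1 - c) + (1 - th c) * (/ (1 - c) * / (1 - c)) <= 0).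
  { assert (0 < / (1 - c)) by (apply Rinv_0_lt_compat; lra).
    pose proof (Hth c ltac:(lra)).
    assert (th' c = ((1 - c) * th' c) * / (1 - c)) by (field; lra).
    replace (- th' c * / (1 - c) + (1 - th c) * (/ (1 - c) * / (1 - c)))
      with ((/ (1 - c) * / (1 - c)) * ((1 - th c) - (1 - c) * th' c)) by (field; lra).
    assert (0 < / (1 - c) * / (1 - c)) by (apply Rmult_lt_0_compat; assumption). nra. }
  assert (H : (1 - th q) * / (1 - q) <= (1 - th p) * / (1 - p)) by nra.
  assert (H0 : 0 <= th p) by (apply Ex_ind_bound; auto; lra).
  assert (Hip : 0 < / (1 - p)) by (apply Rinv_0_lt_compat; lra).
  assert (H1 : (1 - th q) * / (1 - q) * (1 - q) <= / (1 - p) * (1 - q)).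
  { apply Rmult_le_compat_r; [lra|]. nra. }
  rewrite Rmult_assoc, Rinv_l, Rmult_1_r in H1 by lra. fold (th q).
  replace ((q - p) / (1 - p)) with (1 - / (1 - p) * (1 - q)) by (field; lra). lra.
Qed.

(** A cluster of fewer than [n] vertices cannot leave the ball of radius [n], so escaping from it
    forces at least [n] vertices. *)
Lemma tail_lower p q v n : 0 <= p < q -> q < 1 ->
  (forall S, In v S -> NoDup S -> 1 <= phi nb p S v) ->
  (q - p) / (1 - p) <= psi nb q v n.
Proof.
  intros Hpq Hq Hphi. set (B := nodup eqdec (ball v n)).
  assert (HBi : forall x, In x B <-> In x (ball v n)) by (intros; apply nodup_In).
  eapply Rle_trans; [apply (escape_lower p q v B (ball v (S n))); auto|].
  - apply NoDup_nodup.
  - apply HBi, ball_self.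
  - intros x Hx. apply HBi in Hx. apply (ball_le nb v n); auto.
  - intros x y Hx Hxy. apply HBi in Hx. split; [apply (ball_le nb v n); auto|].
    apply (ball_step nb v n x); auto.
  - rewrite (psi_Ex nb nb_sym q v n (ball v (S n))) by (try lra; apply ball_le; auto).
    apply Ex_le; auto; [lra|]. intros w Hw Hs. apply ind_le. intros [u [Hu Hc]].
    pose proof (enum_supp_any _ _ v Hs) as HL. apply (cs_ge _ _ _ _ Hs).
    destruct (le_lt_dec n (cs w v)) as [H|H]; auto. exfalso. apply Hu, HBi.
    apply (ball_le nb v (cs w v)); [lia|]. apply (enum_ball nb w v _ Hw HL), HL, Hc.
Qed.

Definition reaches (F : list V) (n : nat) (w : config) : Prop := exists u, In u F /\ cluster_ge w u n.

Lemma dep_reaches F n : dep (inside (flat_map (fun u => ball u n) F)) (fun w => ind (reaches F n w)).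
Proof.
  apply dep_ind. intros w w' Hw Hw' E [u [Hu Hc]]. exists u; split; auto.
  assert (H : ind (cluster_ge w u n) = ind (cluster_ge w' u n)).
  { apply (dep_cluster_ge nb u n); auto. intros a b Hab [Ha Hb]. apply E; auto.
    split; apply in_flat_map; exists u; auto. }
  rewrite (ind_true (cluster_ge w u n)) in H by assumption.
  apply NNPP; intros Hn. rewrite (ind_false _ Hn) in H. lra.
Qed.

Lemma P_union_Ex p F n S : 0 <= p <= 1 -> incl (flat_map (fun u => ball u n) F) S ->
  P_union_ge nb p F n = Ex p S (fun w => ind (reaches F n w)).
Proof.
  intros Hp HS. unfold P_union_ge. rewrite Pcyl_Ex. symmetry.
  apply Ex_irrel; auto. apply dep_reaches.
Qed.

Lemma flat_ball_le F n m : (n <= m)%nat ->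
  incl (flat_map (fun u => ball u n) F) (flat_map (fun u => ball u m) F).
Proof.
  intros H x Hx. apply in_flat_map in Hx. destruct Hx as [u [Hu Hx]]. apply in_flat_map.
  exists u; split; auto. apply (ball_le nb u n); auto.
Qed.

Lemma P_union_anti p F n m : 0 <= p <= 1 -> (n <= m)%nat -> P_union_ge nb p F m <= P_union_ge nb p F n.
Proof.
  intros Hp Hnm. rewrite (P_union_Ex p F n (flat_map (fun u => ball u m) F)) by auto using flat_ball_le.
  rewrite (P_union_Ex p F m (flat_map (fun u => ball u m) F)) by auto using incl_refl.
  apply Ex_le; auto. intros w _ _. apply ind_le. intros [u [Hu Hc]]. exists u; split; auto.
  eapply cluster_ge_le; eauto.
Qed.

(** If [S] lies in the ball of radius [R] about [v], moving [v] to distance more than [2R] takes [S]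
    off itself. *)
Lemma disjoint_translate S : connected_graph nb -> transitive_graph nb ->
  (forall v n, exists u, ~ In u (ball v n)) ->
  exists f, is_aut nb f /\ forall x, In x S -> ~ In x (map f S).
Proof.
  intros Hc Ht Hinf. destruct S as [|v S'].
  - destruct (classic (exists v : V, True)) as [[v _]|Hv].
    + destruct (Ht v v) as [f [Hf _]]. exists f; split; auto.
    + exists (fun x => x). split; [|intros x []]. split; [exists (fun x => x); auto|tauto].
  - set (S := v :: S').
    assert (HR : exists R, incl S (ball v R)).
    { induction S as [|y K [R HR]]; [exists 0%nat; intros x []|].
      destruct (ball_connected nb v y Hc) as [m Hm]. exists (R + m)%nat. intros x [<-|Hx].
      - apply (ball_le nb v m); [lia|auto].
      - apply (ball_le nb v R); [lia|auto]. }
    destruct HR as [R HR]. destruct (Hinf v (R + R)%nat) as [u Hu].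
    destruct (Ht v u) as [f [Hf Hfu]]. exists f; split; auto. intros x Hx Hx'.
    apply in_map_iff in Hx'. destruct Hx' as [y [<- Hy]]. apply Hu.
    apply (ball_trans nb v R R (f y)); [apply HR; exact Hx|]. apply (ball_sym nb nb_sym).
    rewrite <- Hfu. apply ball_aut; auto.
Qed.

Lemma reaches_pull f F n w : is_aut nb f -> (reaches F n (pull f w) <-> reaches (map f F) n w).
Proof.
  intros Hf. split.
  - intros [u [Hu Hc]]. exists (f u). split; [apply in_map; exact Hu|].
    exact (proj1 (cluster_ge_pull nb f w u n Hf) Hc).
  - intros [u [Hu Hc]]. apply in_map_iff in Hu. destruct Hu as [x [<- Hx]]. exists x; split; auto.
    exact (proj2 (cluster_ge_pull nb f w x n Hf) Hc).
Qed.

Lemma P_union_aut p f F n : 0 <= p <= 1 -> is_aut nb f -> P_union_ge nb p (map f F) n = P_union_ge nb p F n.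
Proof.
  intros Hp Hf. set (S := flat_map (fun u => ball u n) F).
  rewrite (P_union_Ex p F n S) by auto using incl_refl.
  assert (Hi : incl (map f S) (flat_map (fun u => ball u n) (map f F))).
  { intros x Hx. apply in_map_iff in Hx. destruct Hx as [y [<- Hy]]. apply in_flat_map in Hy.
    destruct Hy as [u [Hu Hy]]. apply in_flat_map. exists (f u); split; [apply in_map; auto|].
    apply ball_aut; auto. }
  rewrite (P_union_Ex p (map f F) n _ Hp (incl_refl _)).
  rewrite <- (Ex_aut nb nb_sym p f S _ _ Hp Hf (dep_reaches F n) Hi).
  apply Ex_ext; auto. intros w _ _. apply ind_iff. symmetry. apply reaches_pull; exact Hf.
Qed.

(* Zero-one law: let [s] be the supremum over finite [F] of the probability that [F] meets an
   infinite cluster. Translating [F] off itself makes the two events asymptotically independent,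
   whence [s >= 2 s - s^2]. *)
Lemma zero_one q v d : 0 <= q <= 1 -> connected_graph nb -> transitive_graph nb -> 0 < d ->
  (forall n, d <= psi nb q v n) -> as_infinite_cluster nb q.
Proof.
  intros Hq Hc Ht Hd Hpsi.
  (* On a finite graph no cluster has more vertices than the graph, which contradicts the lower
     bound [d] on every tail. *)
  assert (Hinf : forall v n, exists u, ~ In u (ball v n)).
  { intros x n. apply NNPP; intros Hn.
    assert (Hall : forall u, In u (ball x n)) by (intros u; apply NNPP; intros H; apply Hn; exists u; auto).
    set (m := S (length (ball x n))). pose proof (Hpsi m) as H.
    rewrite (psi_Ex nb nb_sym q v m (ball v m)) in H by auto using incl_refl.
    assert (Ex q (ball v m) (fun w => ind (cluster_ge w v m)) <= 0); [|lra].
    apply Ex_le_cst; auto. intros w _ _. rewrite ind_false; [lra|].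
    intros [K [H1 [H2 _]]]. assert (incl K (ball x n)) by (intros z _; apply Hall).
    apply NoDup_incl_length in H0; auto. unfold m in H2. lia. }
  set (E := fun t => exists F, forall n, P_union_ge nb q F n >= t).
  assert (Hbound : forall F n, 0 <= P_union_ge nb q F n <= 1).
  { intros F n. rewrite (P_union_Ex q F n _ Hq (incl_refl _)). apply Ex_ind_bound; auto. }
  assert (HEd : E d).
  { exists [v]. intros n. rewrite (P_union_Ex q [v] n (ball v n)); auto.
    - apply Rle_ge. eapply Rle_trans; [apply Hpsi|].
      rewrite (psi_Ex nb nb_sym q v n (ball v n)) by auto using incl_refl.
      apply Ex_le; auto. intros w _ _. apply ind_le. intros H; exists v; simpl; auto.
    - simpl. rewrite app_nil_r. apply incl_refl. }
  destruct (completeness E) as [s [Hs1 Hs2]].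
  { exists 1. intros t [F HF]. specialize (HF 0%nat). destruct (Hbound F 0%nat). lra. }
  { exists d; exact HEd. }
  assert (Hsd : d <= s) by (apply Hs1; exact HEd).
  assert (Happ : forall eps, 0 < eps -> exists t, E t /\ s - eps < t).
  { intros eps He. apply NNPP; intros Hn. assert (s <= s - eps); [|lra].
    apply Hs2. intros t Ht'. apply Rnot_lt_le; intros Hlt. apply Hn; exists t; auto. }
  (* Inclusion-exclusion for [F] and a translate: each event has probability at least [t > s - eps]
     at every level, and the joint event at the fixed level [n0], where the two are independent, has
     probability at most [(s + eps)^2]. *)
  assert (Hstep : forall eps, 0 < eps -> 2 * (s - eps) - (s + eps) * (s + eps) <= s).
  { intros eps He. destruct (Happ eps He) as [t [[F HF] Hst]].
    assert (Hn0 : exists n0, P_union_ge nb q F n0 < s + eps).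
    { apply NNPP; intros Hn. assert (s + eps <= s); [|lra]. apply Hs1. exists F. intros n.
      apply Rle_ge, Rnot_lt_le. intros Hlt; apply Hn; exists n; exact Hlt. }
    destruct Hn0 as [n0 Hn0].
    set (S0 := flat_map (fun u => ball u n0) F).
    destruct (disjoint_translate S0 Hc Ht Hinf) as [f [Hf Hdis]].
    apply Rle_trans with (2 * t - (s + eps) * (s + eps)); [lra|]. apply Hs1.
    exists (F ++ map f F). intros n. apply Rle_ge.
    (* The probability decreases with the level, so the level may be raised above [n0]; an event at
       level [n1] then implies the one at level [n0], for which the translate was chosen. *)
    set (n1 := max n n0).
    apply Rle_trans with (P_union_ge nb q (F ++ map f F) n1); [|apply P_union_anti; auto; unfold n1; lia].
    set (S1 := flat_map (fun u => ball u n1) (F ++ map f F)).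
    assert (HiF : incl (flat_map (fun u => ball u n1) F) S1).
    { unfold S1. rewrite flat_map_app. apply incl_appl, incl_refl. }
    assert (HifF : incl (flat_map (fun u => ball u n1) (map f F)) S1).
    { unfold S1. rewrite flat_map_app. apply incl_appr, incl_refl. }
    rewrite (P_union_Ex q (F ++ map f F) n1 S1) by auto using incl_refl.
    pose proof (HF n1) as HF1. pose proof HF1 as HF2. rewrite <- (P_union_aut q f F n1 Hq Hf) in HF2.
    rewrite (P_union_Ex q F n1 S1 Hq HiF) in HF1.
    rewrite (P_union_Ex q (map f F) n1 S1 Hq HifF) in HF2.
    assert (Hn01 : (n0 <= n1)%nat) by (unfold n1; lia).
    assert (Hprod : Ex q S1 (fun w => ind (reaches F n0 w) * ind (reaches (map f F) n0 w)) <= (s + eps) * (s + eps)).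
    { rewrite (Ex_indep nb nb_sym q S1 (inside S0) (inside (flat_map (fun u => ball u n0) (map f F)))).
      - rewrite <- (P_union_Ex q F n0 S1), <- (P_union_Ex q (map f F) n0 S1), P_union_aut; auto.
        + destruct (Hbound F n0). apply Rmult_le_compat; lra.
        + eapply incl_tran; [|exact HifF]. apply flat_ball_le; auto.
        + eapply incl_tran; [|exact HiF]. apply flat_ball_le; auto.
      - apply dep_reaches.
      - apply dep_reaches.
      - assert (Hmem : forall x, In x (flat_map (fun u => ball u n0) (map f F)) -> In x (map f S0)).
        { intros x Hx. apply in_flat_map in Hx. destruct Hx as [u [Hu Hx]].
          apply in_map_iff in Hu. destruct Hu as [z [<- Hz]].
          pose proof Hf as [[g [Hg Hg']] _]. rewrite <- (Hg' x). apply in_map.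
          apply in_flat_map. exists z; split; auto. rewrite <- (Hg z).
          apply ball_aut; auto. split.
          - exists f; auto.
          - intros a b. rewrite <- (Hg' a) at 1. rewrite <- (Hg' b) at 1. symmetry. apply Hf. }
        intros a b [Ha Hb] [[Ha' _]|[_ Ha']]; apply (Hdis a Ha), Hmem; assumption. }
    assert (Hincl : Ex q S1 (fun w => ind (reaches F n1 w)) + Ex q S1 (fun w => ind (reaches (map f F) n1 w))
      <= Ex q S1 (fun w => ind (reaches (F ++ map f F) n1 w)) +
         Ex q S1 (fun w => ind (reaches F n0 w) * ind (reaches (map f F) n0 w))).
    { rewrite <- !Ex_plus. apply Ex_le; auto. intros w _ _.
      assert (Hr : forall F', reaches F' n1 w -> reaches F' n0 w).
      { intros F' [u [Hu Hr]]. exists u; split; auto. eapply cluster_ge_le; eauto. }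
      assert (Ha : reaches F n1 w \/ reaches (map f F) n1 w -> reaches (F ++ map f F) n1 w).
      { intros [[u [Hu Hr']]|[u [Hu Hr']]]; exists u; split; auto; apply in_or_app; auto. }
      pose proof (ind_bound (reaches F n0 w)). pose proof (ind_bound (reaches (map f F) n0 w)).
      pose proof (ind_bound (reaches (F ++ map f F) n1 w)).
      destruct (classic (reaches F n1 w)) as [R1|R1], (classic (reaches (map f F) n1 w)) as [R2|R2].
      - rewrite !ind_true by auto. lra.
      - rewrite (ind_true (reaches F n1 w)), (ind_false (reaches (map f F) n1 w)), (ind_true (reaches (F ++ _) _ _)) by auto. nra.
      - rewrite (ind_false (reaches F n1 w)), (ind_true (reaches (map f F) n1 w)), (ind_true (reaches (F ++ _) _ _)) by auto. nra.
      - rewrite (ind_false (reaches F n1 w)), (ind_false (reaches (map f F) n1 w)) by auto. nra. }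
    lra. }
  assert (Hs : 1 <= s).
  { apply Rnot_lt_le; intros Hs. set (e := s * (1 - s) / 8).
    assert (0 < s * (1 - s)) by (apply Rmult_lt_0_compat; lra).
    assert (He : 0 < e) by (unfold e; lra). pose proof (Hstep e He).
    assert (e <= 1) by (unfold e; nra).
    assert (e * e <= e) by nra. assert (s * e <= e) by nra.
    assert (8 * e = s * (1 - s)) by (unfold e; field). nra. }
  intros eps He. destruct (Happ eps He) as [t [[F HF] Ht']]. exists F. intros n. specialize (HF n). lra.
Qed.

Lemma subcritical_tail p q : 0 <= p < q -> q < 1 -> connected_graph nb -> transitive_graph nb ->
  ~ as_infinite_cluster nb q -> forall v : V, exists X, forall n, INR n * psi nb p v n <= X.
Proof.
  intros Hpq Hq Hc Ht Hn v.
  assert (HS : exists S, In v S /\ NoDup S /\ phi nb p S v < 1).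
  { apply NNPP; intros H. apply Hn. apply (zero_one q v ((q - p) / (1 - p))); auto; [lra| |].
    - apply Rdiv_lt_0_compat; lra.
    - intros n. apply tail_lower; auto. intros S HvS HS. apply Rnot_lt_le; intros Hlt.
      apply H; exists S; auto. }
  destruct HS as [S [HvS [HS Hphi]]]. exists (INR (length S) / (1 - phi nb p S v)).
  intros n. apply tail_from_phi; auto. lra.
Qed.

End Supercritical.

(** * Mass transport *)

Section MassTransport.
Context {V : Type} (nb : V -> list V).
Context (nb_sym : forall v w, In w (nb v) -> In v (nb w)).
Context (Htrans : transitive_graph nb) (Hunim : unimodular nb).

Notation ball := (ball nb).
Notation valid := (valid nb).
Notation dep := (dep nb).
Notation Ex := (Ex nb).

Lemma aut_inv f : is_aut nb f -> exists g, is_aut nb g /\ (forall x, g (f x) = x) /\ (forall y, f (g y) = y).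
Proof.
  intros [[g [Hg Hg']] Ha]. exists g. repeat split; auto.
  - exists f; auto.
  - intros H. apply (proj2 (Ha _ _)). rewrite !Hg'; exact H.
  - intros H. rewrite <- (Hg' x), <- (Hg' y). apply (proj1 (Ha _ _)); exact H.
Qed.

Lemma aut_comp f f' : is_aut nb f -> is_aut nb f' -> is_aut nb (fun x => f (f' x)).
Proof.
  intros [[g [Hg Hg']] Ha] [[k [Hk Hk']] Hb]. split.
  - exists (fun x => k (g x)). split; intros; [rewrite Hg, Hk|rewrite Hk', Hg']; reflexivity.
  - intros x y. rewrite Hb, Ha. reflexivity.
Qed.

(** An automorphism taking the pair [(u, v)] to [(v, u')] turns mass sent from [u] to [v] into mass
    sent from [v] to [u']. For given [u], these [u'] form an orbit of the stabilizer of [v]. *)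
Definition reflected (v u u' : V) : Prop := exists f, is_aut nb f /\ f u = v /\ f v = u'.

Lemma reflected_sym v u u' : reflected v u u' -> reflected v u' u.
Proof.
  intros [f [Hf [H1 H2]]]. destruct (aut_inv f Hf) as [g [Hg [Hg1 Hg2]]].
  exists g. split; [exact Hg|]. split; [rewrite <- H2|rewrite <- H1]; apply Hg1.
Qed.

Lemma reflected_stab v u u' x : reflected v u u' -> (reflected v u x <-> stab_orbit nb v u' x).
Proof.
  intros [f [Hf [H1 H2]]]. destruct (aut_inv f Hf) as [g [Hg [Hg1 Hg2]]].
  assert (G1 : g v = u) by (rewrite <- H1; apply Hg1).
  assert (G2 : g u' = v) by (rewrite <- H2; apply Hg1). split.
  - intros [k [Hk [H3 H4]]]. exists (fun z => k (g z)). split; [apply aut_comp; assumption|].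
    rewrite G1, G2; auto.
  - intros [k [Hk [H3 H4]]]. exists (fun z => k (f z)). split; [apply aut_comp; assumption|].
    rewrite H1, H2; auto.
Qed.

(** The automorphism carries the orbit of [v] under the stabilizer of [u] to the orbit of [u'] under
    the stabilizer of [v]; unimodularity compares the former with the orbit of [u] under the
    stabilizer of [v]. *)
Lemma stab_card v u u' n : reflected v u u' ->
  has_card (stab_orbit nb v u) n -> has_card (stab_orbit nb v u') n.
Proof.
  intros [f [Hf [H1 H2]]] Hn. apply Hunim in Hn. destruct Hn as [L [Hn [Hl HL]]].
  destruct (aut_inv f Hf) as [g [Hg [Hg1 Hg2]]].
  assert (G1 : g v = u) by (rewrite <- H1; apply Hg1).
  assert (G2 : g u' = v) by (rewrite <- H2; apply Hg1).
  exists (map f L). split; [|split].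
  - apply FinFun.Injective_map_NoDup; auto. intros a b; apply (aut_inj nb); assumption.
  - rewrite length_map; exact Hl.
  - intros x. rewrite in_map_iff. split.
    + intros [y [<- Hy]]. apply HL in Hy. destruct Hy as [k [Hk [H3 H4]]].
      exists (fun z => f (k (g z))). split; [apply aut_comp; auto; apply aut_comp; auto|].
      split.
      * rewrite G1, H3; exact H1.
      * rewrite G2, H4; reflexivity.
    + intros [k [Hk [H3 H4]]]. exists (g x). split; [apply Hg2|]. apply HL.
      exists (fun z => g (k (f z))). split; [apply aut_comp; auto; apply aut_comp; auto|].
      split; [rewrite H1, H3; exact G1|rewrite H2, H4; reflexivity].
Qed.

Lemma sum_ind_card (L : list V) (A : V -> Prop) n : NoDup L -> (forall x, A x -> In x L) ->
  has_card A n -> sum L (fun x => ind (A x)) = INR n.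
Proof.
  intros HL HA [K [H1 [H2 H3]]].
  rewrite (sum_support L K); auto.
  - rewrite (sum_ext K _ (fun _ => 1)), sum_const, H2; [lra|].
    intros x Hx. apply ind_true, H3, Hx.
  - intros x Hx. destruct (classic (A x)) as [HAx|HAx].
    + split; auto. intros _; apply H3; exact HAx.
    + rewrite ind_false in Hx by exact HAx. lra.
Qed.

Lemma has_card_exists (L : list V) (A : V -> Prop) : (forall x, A x -> In x L) -> exists n, has_card A n.
Proof.
  intros HA. exists (length (filter (fun x => dec (A x)) (nodup eqdec L))).
  exists (filter (fun x => dec (A x)) (nodup eqdec L)). split; [apply NoDup_filter, NoDup_nodup|].
  split; [reflexivity|]. intros x. rewrite filter_In, nodup_In, dec_true. split; [tauto|auto].
Qed.

(** Vertices [u] and [u'] are paired when [reflected v u u']. This relation is symmetric, paired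
    vertices have the same number [N] of partners by unimodularity, and [f v u' = f u v] on pairs;
    so a double count proves the principle without choosing orbit representatives. *)
Lemma mass_transport f r v :
  (forall phi u x, is_aut nb phi -> f (phi u) (phi x) = f u x) ->
  (forall u x, f u x <> 0 -> In x (ball u r)) ->
  let L := nodup eqdec (ball v r) in
  sum L (fun u => f v u) = sum L (fun u => f u v).
Proof.
  intros Hf Hsupp L.
  assert (HL : forall x, In x L <-> In x (ball v r)) by (intros; apply nodup_In).
  assert (HLn : NoDup L) by apply NoDup_nodup.
  set (N := fun u => sum L (fun x => ind (reflected v u x))).
  assert (Hin : forall u x, In u L -> reflected v u x -> In x L).
  { intros u x Hu [k [Hk [H1 H2]]]. apply HL. rewrite <- H1, <- H2. apply ball_aut; auto.
    apply (ball_sym nb nb_sym), HL, Hu. }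
  assert (HN : forall u u', In u L -> reflected v u u' -> N u = N u').
  { intros u u' Hu Hr. assert (Hu' := Hin u u' Hu Hr).
    assert (Hr' := reflected_sym v u u' Hr).
    destruct (has_card_exists L (stab_orbit nb v u)) as [n Hn].
    { intros x Hx. apply (Hin u' x Hu'). apply (reflected_stab v u' u x Hr'); exact Hx. }
    assert (Hn' := stab_card v u u' n Hr Hn).
    transitivity (INR n); [|symmetry]; unfold N.
    - rewrite <- (sum_ind_card L (stab_orbit nb v u') n); auto.
      + apply sum_ext; intros x _. apply ind_iff, reflected_stab; exact Hr.
      + intros x Hx. apply (Hin u x Hu). apply (reflected_stab v u u' x Hr); exact Hx.
    - rewrite <- (sum_ind_card L (stab_orbit nb v u) n); auto.
      + apply sum_ext; intros x _. apply ind_iff, reflected_stab; exact Hr'.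
      + intros x Hx. apply (Hin u' x Hu'). apply (reflected_stab v u' u x Hr'); exact Hx. }
  assert (HNpos : forall u, In u L -> 0 < N u).
  { intros u Hu. destruct (Htrans u v) as [k [Hk H1]].
    assert (Hr : reflected v u (k v)) by (exists k; auto).
    apply Rlt_le_trans with (ind (reflected v u (k v))); [rewrite ind_true by exact Hr; lra|].
    apply (sum_ge_term L (fun x => ind (reflected v u x))); [intros; apply ind_bound|].
    apply (Hin u); auto. }
  (* Each term [f v u'] is shared equally among the [N u'] partners of [u']. *)
  transitivity (sum L (fun u => sum L (fun u' => ind (reflected v u u') * (f v u' * / N u')))).
  - rewrite sum_swap. apply sum_ext. intros u' Hu'. rewrite sum_scal_r.
    rewrite (sum_ext L _ (fun x => ind (reflected v u' x))).
    + fold (N u'). pose proof (HNpos u' Hu'). field. lra.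
    + intros x _. apply ind_iff. split; apply reflected_sym.
  - apply sum_ext. intros u Hu.
    rewrite (sum_ext L _ (fun u' => ind (reflected v u u') * (f u v * / N u))).
    + rewrite sum_scal_r. fold (N u). pose proof (HNpos u Hu). field. lra.
    + intros u' Hu'. destruct (classic (reflected v u u')) as [Hr|Hr].
      * rewrite (HN u u') by assumption. f_equal. f_equal.
        destruct Hr as [k [Hk [H1 H2]]]. rewrite <- (Hf k u v Hk), H1, H2. reflexivity.
      * rewrite ind_false by exact Hr. lra.
Qed.

(** The functions transported below vanish unless a cluster is small. Only where they do not vanish
    is the cluster visible in a bounded region, and by symmetry it suffices to compare
    configurations starting from there. *)
Lemma dep_by_support A (G : config -> R) :
  (forall w w', valid w -> valid w' -> (forall a b, adj nb a b -> A a b -> w a b = w' a b) ->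
    G w <> 0 -> G w' = G w) -> dep A G.
Proof.
  intros H w w' Hw Hw' E. destruct (Req_dec (G w) 0) as [H0|H0].
  - destruct (Req_dec (G w') 0) as [H0'|H0']; [lra|]. apply H; auto. intros; symmetry; auto.
  - symmetry; apply H; auto.
Qed.

Lemma mass_transport_Ex p v r m S (F : V -> V -> config -> R) : 0 <= p <= 1 ->
  (forall u x w, valid w -> F u x w <> 0 -> In x (ball u r)) ->
  (forall u x, dep (inside (ball u m)) (F u x)) ->
  (forall phi u x w, is_aut nb phi -> valid w -> F (phi u) (phi x) w = F u x (pull phi w)) ->
  incl (ball v (r + m)) S ->
  let L := nodup eqdec (ball v r) in
  Ex p S (fun w => sum L (fun u => F v u w)) = Ex p S (fun w => sum L (fun u => F u v w)).
Proof.
  intros Hp H1 H2 H3 HS L.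
  rewrite !Ex_sum. set (f := fun u x => Ex p (ball u m) (F u x)).
  assert (Hmt := mass_transport f r v). simpl in Hmt. fold L in Hmt.
  rewrite (sum_ext L (fun u => Ex p S (F v u)) (fun u => f v u)).
  - rewrite Hmt.
    + apply sum_ext. intros u Hu. symmetry. apply Ex_irrel; auto.
      intros x Hx. apply HS. apply nodup_In in Hu. apply (ball_trans nb v r m u); auto.
    + intros phi u x Hphi. unfold f.
      rewrite <- (Ex_aut nb nb_sym p phi (ball u m) (ball (phi u) m) (F u x)); auto.
      * apply Ex_ext; auto.
      * intros y Hy. apply in_map_iff in Hy. destruct Hy as [z [<- Hz]]. apply ball_aut; auto.
    + intros u x Hne. apply NNPP; intros Hx. apply Hne. unfold f.
      rewrite <- (Ex_cst nb p (ball u m) 0). apply Ex_ext; auto. intros w Hw _.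
      apply NNPP; intros Hn. apply Hx, (H1 u x w); auto.
  - intros u Hu. apply Ex_irrel; auto. intros x Hx. apply HS, (ball_le nb v m); [lia|auto].
Qed.

End MassTransport.

(** * Exploring a cluster *)

Lemma ex_perm {V} p (Es Es' : list (V * V)) f : Permutation Es Es' -> ex p Es f = ex p Es' f.
Proof.
  induction 1; simpl; [reflexivity|congruence|apply avg_comm|congruence].
Qed.

Lemma ex_reach_ext {V} p (Es : list (V * V)) f g w :
  (forall w', (forall a b, (forall e, In e Es -> ~ same_edge (fst e) (snd e) a b) -> w' a b = w a b) ->
    f w' = g w') -> ex p Es f w = ex p Es g w.
Proof.
  revert w. induction Es as [|e Es IH]; intros w H; simpl; [apply H; auto|].
  unfold avg. f_equal; f_equal; apply IH; intros w' Hw'; apply H; intros a b Hab;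
    (rewrite Hw'; [apply upd_diff; apply Hab; left; reflexivity|intros; apply Hab; right; assumption]).
Qed.

Lemma simple_NoDup {V} (l : list (V * V)) : simple l -> NoDup l.
Proof.
  induction 1 as [|e l H _ IH]; constructor; auto. intros He. apply (H e He). left; auto.
Qed.

Lemma simple_filter {V} (l : list (V * V)) b : simple l -> simple (filter b l).
Proof.
  induction 1 as [|e l H Hl IH]; simpl; [constructor|]. destruct (b e); auto.
  constructor; auto. intros e' He'. apply H. apply filter_In in He'; tauto.
Qed.

Lemma simple_unique {V} (l : list (V * V)) e e' : simple l -> In e l -> In e' l ->
  same_edge (fst e) (snd e) (fst e') (snd e') -> e = e'.
Proof.
  induction 1 as [|d l H Hl IH]; intros He He' Hs; [destruct He|].
  destruct He as [<-|He], He' as [<-|He']; auto; exfalso.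
  - apply (H e' He' Hs).
  - apply (H e He). apply same_edge_sym; exact Hs.
Qed.

Section Exploration.
Context {V : Type} (nb : V -> list V).
Context (nb_sym : forall v w, In w (nb v) -> In v (nb w)).

Notation adj := (adj nb).
Notation ball := (ball nb).
Notation valid := (valid nb).
Notation conn := (@open_conn V).
Notation Ex := (Ex nb).

Definition bit (w : @config V) (e : V * V) : R := ind (w (fst e) (snd e) = true).

Definition revealed (H : list (V * V)) (w : @config V) : config :=
  fun a b => if excluded_middle_informative (exists e, In e H /\ same_edge (fst e) (snd e) a b)
    then w a b else false.

Definition frontier (Es H : list (V * V)) (v : V) (w : @config V) (e : V * V) : Prop :=
  In e Es /\ ~ In e H /\ (conn w v (fst e) \/ conn w v (snd e)).

(** Any choice of a frontier edge will do, provided that it is a function of the revealed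
    configuration alone: this makes the exploration predictable. *)
Definition next (Es H : list (V * V)) (v : V) (w : @config V) : option (V * V) :=
  match excluded_middle_informative (exists e, frontier Es H v w e) with
  | left h => Some (proj1_sig (constructive_indefinite_description _ h))
  | right _ => None
  end.

Lemma next_some Es H v w e : next Es H v w = Some e -> frontier Es H v w e.
Proof.
  unfold next. destruct excluded_middle_informative as [h|]; [|discriminate].
  intros [= <-]. exact (proj2_sig (constructive_indefinite_description _ h)).
Qed.

Lemma next_none Es H v w e : next Es H v w = None -> ~ frontier Es H v w e.
Proof.
  unfold next. destruct excluded_middle_informative as [|h]; [discriminate|]. intros _ He. apply h; eauto.
Qed.

(* The value after [t] steps of the martingale that reveals one by one the edges touching the
   cluster of [v]; [H] lists the edges already revealed. *)
Fixpoint fluct (p : R) (Es : list (V * V)) (v : V) (t : nat) (H : list (V * V)) (w : config) : R :=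
  match t with
  | O => 0
  | S t' => match next Es H v (revealed H w) with
            | None => 0
            | Some e => (p - bit w e) + fluct p Es v t' (e :: H) w
            end
  end.

Definition rest (Es H : list (V * V)) : list (V * V) := filter (fun e => dec (~ In e H)) Es.

Lemma rest_In Es H e : In e (rest Es H) <-> In e Es /\ ~ In e H.
Proof. unfold rest. rewrite filter_In, dec_true. reflexivity. Qed.

Lemma rest_nil Es : rest Es [] = Es.
Proof.
  unfold rest. induction Es as [|e l IH]; [reflexivity|]. cbn [filter].
  rewrite (proj2 (dec_true (~ In e []))) by (intros []). f_equal. exact IH.
Qed.

Lemma rest_cons Es H e : NoDup Es -> In e Es -> ~ In e H ->
  Permutation (rest Es H) (e :: rest Es (e :: H)).
Proof.
  intros HE He HH. apply NoDup_Permutation.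
  - apply NoDup_filter; exact HE.
  - constructor; [|apply NoDup_filter; exact HE]. rewrite rest_In. simpl; tauto.
  - intros d. simpl. rewrite !rest_In. simpl. destruct (eqdec e d) as [<-|Hd]; tauto.
Qed.

(** Averaging over [rest Es H] conditions on the revealed edges [H]. Each step adds a centred
    variable of variance [p (1 - p)], and cross terms vanish because the remaining sum has
    conditional mean [0]. *)
Lemma fluct_moments p Es v t : 0 <= p <= 1 -> simple Es -> forall H w, incl H Es ->
  ex p (rest Es H) (fluct p Es v t H) w = 0 /\
  ex p (rest Es H) (fun w => fluct p Es v t H w * fluct p Es v t H w) w <= INR t * (p * (1 - p)).
Proof.
  intros Hp HEs. assert (HEn := simple_NoDup _ HEs).
  induction t as [|t IH]; intros H w HH.
  - simpl. rewrite !ex_cst. lra.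
  - set (o := next Es H v (revealed H w)).
    (* Averaging over unrevealed edges leaves the revealed configuration alone, so the choice of the
       next edge is constant under the average. *)
    assert (Hrev : forall w', (forall a b, (forall e, In e (rest Es H) -> ~ same_edge (fst e) (snd e) a b) ->
      w' a b = w a b) -> revealed H w' = revealed H w).
    { intros w' E. do 2 (apply functional_extensionality; intro). unfold revealed.
      destruct excluded_middle_informative as [[e [He Hs]]|]; [|reflexivity]. apply E.
      intros e' He' Hs'. apply rest_In in He'. destruct He' as [He' Hn]. apply Hn.
      rewrite (simple_unique Es e' e); auto.
      eapply same_edge_trans; [exact Hs'|apply same_edge_sym; exact Hs]. }
    destruct o as [e|] eqn:Eo.
    2:{ assert (Hz : forall g, (forall x, x = 0 -> g x = 0) ->
          ex p (rest Es H) (fun w => g (fluct p Es v (S t) H w)) w = 0).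
        { intros g Hg. rewrite <- (ex_cst p (rest Es H) 0 w). apply ex_reach_ext. intros w' E.
          apply Hg. simpl. rewrite (Hrev w' E). fold o. rewrite Eo. reflexivity. }
        split; [apply (Hz (fun x => x)); auto|].
        rewrite (Hz (fun x => x * x)) by (intros; subst; lra).
        apply Rmult_le_pos; [apply pos_INR|nra]. }
    pose proof (next_some _ _ _ _ _ Eo) as [HeE [HeH _]].
    assert (HH' : incl (e :: H) Es) by (apply incl_cons; assumption).
    assert (Hperm := rest_cons Es H e HEn HeE HeH).
    (* Once the state [b] of the chosen edge is fixed, the increment is a constant and the rest is
       the exploration started from [e :: H]. *)
    assert (step : forall (g : R -> R) b,
      ex p (rest Es (e :: H)) (fun w => g (fluct p Es v (S t) H w)) (upd w (fst e) (snd e) b) =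
      ex p (rest Es (e :: H)) (fun w => g ((p - (if b then 1 else 0)) + fluct p Es v t (e :: H) w))
        (upd w (fst e) (snd e) b)).
    { intros g b. apply ex_reach_ext. intros w' E.
      assert (Ee : w' (fst e) (snd e) = b).
      { rewrite E; [apply upd_same; left; auto|]. intros e' He' Hs. apply rest_In in He'.
        apply (proj2 He'). left. apply (simple_unique Es e e'); auto; [tauto|apply same_edge_sym; exact Hs]. }
      simpl fluct. rewrite (Hrev w').
      - fold o. rewrite Eo. unfold bit. rewrite Ee. destruct b.
        + rewrite ind_true by reflexivity. reflexivity.
        + rewrite ind_false by discriminate. reflexivity.
      - intros a c Hac. rewrite E.
        + apply upd_diff. apply Hac, rest_In; auto.
        + intros e' He'. apply Hac. apply rest_In in He'. apply rest_In. simpl in He'. tauto. }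
    assert (IHb : forall b, _) by (intros b; exact (IH (e :: H) (upd w (fst e) (snd e) b) HH')).
    set (Rs := rest Es (e :: H)) in *. set (Y := fluct p Es v t (e :: H)) in *.
    assert (E1 : forall c b, ex p Rs (fun w => c + Y w) (upd w (fst e) (snd e) b) = c).
    { intros c b. rewrite ex_plus, ex_cst. fold (fluct p Es v t (e :: H)).
      change (fun w => Y w) with Y. rewrite (proj1 (IHb b)). lra. }
    assert (E2 : forall c b, ex p Rs (fun w => (c + Y w) * (c + Y w)) (upd w (fst e) (snd e) b)
      <= c * c + INR t * (p * (1 - p))).
    { intros c b. replace (fun w => (c + Y w) * (c + Y w))
        with (fun w => (c * c + (2 * c) * Y w) + Y w * Y w) by (apply functional_extensionality; intros; ring).
      rewrite ex_plus, ex_plus, ex_cst, ex_scal. change (fun w => Y w) with Y.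
      rewrite (proj1 (IHb b)). pose proof (proj2 (IHb b)). lra. }
    rewrite !(ex_perm p _ _ _ Hperm). cbn [ex]. unfold avg. split.
    + assert (E3 : forall b, ex p Rs (fluct p Es v (S t) H) (upd w (fst e) (snd e) b) = p - (if b then 1 else 0))
        by (intros b; etransitivity; [exact (step (fun x => x) b)|apply E1]).
      rewrite !E3. ring.
    + rewrite (step (fun x => x * x) true), (step (fun x => x * x) false).
      pose proof (E2 (p - 1) true). pose proof (E2 (p - 0) false).
      rewrite S_INR.
      apply Rle_trans with (p * ((p - 1) * (p - 1) + INR t * (p * (1 - p))) +
        (1 - p) * ((p - 0) * (p - 0) + INR t * (p * (1 - p)))).
      * apply Rplus_le_compat; apply Rmult_le_compat_l; auto; lra.
      * apply Req_le. ring.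
Qed.

Definition touching (S : list V) (v : V) (w : config) : list (V * V) :=
  filter (fun e => dec (conn w v (fst e) \/ conn w v (snd e))) (edges_in nb S).

Lemma touching_In S v w e : In e (touching S v w) <->
  In e (edges_in nb S) /\ (conn w v (fst e) \/ conn w v (snd e)).
Proof. unfold touching. rewrite filter_In, dec_true. reflexivity. Qed.

Lemma revealed_le H w : cfg_le (revealed H w) w.
Proof. intros a b. unfold revealed. destruct excluded_middle_informative; [auto|discriminate]. Qed.

(** The exploration cannot stop early: if an edge touching the cluster is unrevealed, either it
    touches the revealed cluster, or an open path to it leaves the revealed cluster through an
    unrevealed edge. Both provide a frontier edge. *)
Lemma fluct_full p S v t w : valid w -> supp S w -> forall H, NoDup H -> incl H (touching S v w) ->
  (length (touching S v w) <= length H + t)%nat ->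
  fluct p (edges_in nb S) v t H w = sum (rest (touching S v w) H) (fun e => p - bit w e).
Proof.
  intros Hw Hs. assert (HDn : NoDup (touching S v w)) by apply NoDup_filter, simple_NoDup, edges_in_simple.
  induction t as [|t IH]; intros H HHn HH Hl.
  - simpl. symmetry. assert (Hinc : incl (touching S v w) H).
    { apply NoDup_length_incl; auto; lia. }
    replace (rest (touching S v w) H) with (@nil (V * V)); [reflexivity|].
    symmetry. destruct (rest (touching S v w) H) as [|e l] eqn:E; [reflexivity|exfalso].
    assert (He : In e (rest (touching S v w) H)) by (rewrite E; left; reflexivity).
    apply rest_In in He. apply (proj2 He), Hinc, He.
  - simpl. destruct (next (edges_in nb S) H v (revealed H w)) as [e|] eqn:En.
    + apply next_some in En. destruct En as [HeE [HeH Hec]].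
      assert (HeD : In e (touching S v w)).
      { apply touching_In; split; auto. destruct Hec as [Hc|Hc]; [left|right];
          (eapply conn_mono; [apply revealed_le|exact Hc]). }
      rewrite IH.
      * rewrite (sum_perm _ _ _ (rest_cons _ H e HDn HeD HeH)), sum_cons. reflexivity.
      * constructor; assumption.
      * apply incl_cons; assumption.
      * simpl; lia.
    + symmetry. apply sum_0. intros e He. exfalso. apply rest_In in He. destruct He as [He HeH].
      apply touching_In in He. destruct He as [HeE Hec].
      assert (Hx : exists x, conn w v x /\ (fst e = x \/ snd e = x)) by (destruct Hec; eauto).
      destruct Hx as [x [Hx Hex]].
      destruct (classic (conn (revealed H w) v x)) as [Hc|Hc].
      * apply (next_none _ _ _ _ e En). split; [exact HeE|]. split; [exact HeH|].
        destruct Hex as [<-|<-]; auto.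
      * destruct (exit_first (fun z => conn (revealed H w) v z) w v x Hx (conn_refl _ _) Hc)
          as [a [b [_ [Ha [Hb Hab]]]]].
        destruct (edges_in_covers nb S a b) as [d [Hd Hsd]]; [apply Hw; exact Hab|apply Hs; exact Hab|].
        assert (HdH : ~ In d H).
        { intros HdH. apply Hb. apply conn_trans with a; auto. apply conn_edge. unfold revealed.
          destruct excluded_middle_informative as [_|Hn]; [exact Hab|]. exfalso; apply Hn; eauto. }
        apply (next_none _ _ _ _ d En). split; [exact Hd|]. split; [exact HdH|].
        destruct Hsd as [[<- <-]|[<- <-]]; auto.
Qed.

Lemma touching_length S v w d : (forall x, (length (nb x) <= d)%nat) -> valid w ->
  (1 <= cs w v)%nat -> (length (touching S v w) <= d * cs w v)%nat.
Proof.
  intros Hd Hw Hc. pose proof (cs_pos_enum w v Hc) as HL.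
  set (l2 := flat_map (fun x => map (fun y => (x, y)) (nb x)) (klist w v)).
  assert (H : sum (touching S v w) (fun _ => 1) <= sum l2 (fun _ => 1)).
  { apply sum_simple_le; try (intros; lra); [apply simple_filter, edges_in_simple|].
    intros [x y] He. apply touching_In in He. destruct He as [He Hxy].
    apply edges_in_elem in He. destruct He as [He _]. simpl in *.
    destruct Hxy as [Hx|Hy].
    - exists (x, y). split; [|left; auto]. apply in_flat_map. exists x. split; [apply HL; exact Hx|].
      apply in_map; exact He.
    - exists (y, x). split; [|right; auto]. apply in_flat_map. exists y. split; [apply HL; exact Hy|].
      apply in_map. apply nb_sym; exact He. }
  rewrite !sum_const, !Rmult_1_r in H. apply INR_le in H.
  eapply Nat.le_trans; [exact H|]. unfold l2, cs. clear - Hd.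
  induction (klist w v) as [|x l IH]; simpl; [lia|].
  rewrite length_app, length_map. specialize (Hd x). lia.
Qed.

(** A cluster of at most [s] vertices touches at most [d * s] edges, so on this event the
    exploration is complete after [d * s] steps and the sum is the final value of the martingale. *)
Lemma second_moment p S v s d : 0 <= p <= 1 -> (forall x, (length (nb x) <= d)%nat) ->
  Ex p S (fun w => ind (1 <= cs w v <= s)%nat *
    (sum (touching S v w) (fun e => p - bit w e) * sum (touching S v w) (fun e => p - bit w e)))
  <= INR (d * s) * (p * (1 - p)).
Proof.
  intros Hp Hd. set (Z := fluct p (edges_in nb S) v (d * s) []).
  apply Rle_trans with (Ex p S (fun w => Z w * Z w)).
  - apply Ex_le; auto. intros w Hw Hs.
    destruct (classic (1 <= cs w v <= s)%nat) as [Hc|Hc].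
    + rewrite ind_true, Rmult_1_l by exact Hc. unfold Z.
      rewrite (fluct_full p S v (d * s) w Hw Hs []).
      * rewrite rest_nil; lra.
      * constructor.
      * intros e [].
      * simpl. eapply Nat.le_trans; [apply (touching_length S v w d); auto; lia|].
        apply Nat.mul_le_mono_l; lia.
    + rewrite ind_false, Rmult_0_l by exact Hc. nra.
  - destruct (fluct_moments p (edges_in nb S) v (d * s) Hp (edges_in_simple nb S) [] w0) as [_ H].
    { intros e []. }
    rewrite rest_nil in H. exact H.
Qed.

End Exploration.

(** * Two large distinct clusters rarely meet *)

(** The share of one vertex in the weight [gw] of its cluster; [gw] itself is [min(s/n, 1)], cut to
    [0] above [N]. The cut gives the transport below a finite range. *)
Definition qw (n N s : nat) : R := if dec (1 <= s <= N)%nat then / INR (max n s) else 0.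

Definition gw (n N s : nat) : R := INR s * qw n N s.

Lemma qw_nonneg n N s : 0 <= qw n N s.
Proof.
  unfold qw. destruct (dec _) eqn:E; [|lra]. apply -> dec_true in E.
  left. apply Rinv_0_lt_compat, lt_0_INR. lia.
Qed.

Lemma qw_pos n N s : qw n N s <> 0 -> (1 <= s <= N)%nat.
Proof. unfold qw. destruct (dec _) eqn:E; [|congruence]. intros _. apply -> dec_true in E. exact E. Qed.

Lemma qw_0 n N s : ~ (1 <= s <= N)%nat -> qw n N s = 0.
Proof. intros H. apply NNPP; intros Hn. apply H, (qw_pos n N s Hn). Qed.

Lemma qw_val n N s : (1 <= s <= N)%nat -> qw n N s = / INR (max n s).
Proof. intros H. unfold qw. rewrite (proj2 (dec_true _) H). reflexivity. Qed.

(** Up to [N] the weight is concave with value [0] at [0], hence subadditive, and two sizes of at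
    least [n] give [1 + 1 - 1]. If the merged size exceeds [N], its weight is [0] and the gain is
    only larger. *)
Lemma gw_gain n N a b : (1 <= n)%nat -> (1 <= a)%nat -> (1 <= b)%nat ->
  ind ((n <= a <= N)%nat /\ (n <= b <= N)%nat) <= gw n N a + gw n N b - gw n N (a + b).
Proof.
  intros Hn Ha Hb.
  assert (Hpos : forall s, 0 <= gw n N s) by (intros; apply Rmult_le_pos; [apply pos_INR|apply qw_nonneg]).
  assert (Hone : forall s, (n <= s <= N)%nat -> gw n N s = 1).
  { intros s Hs. unfold gw. rewrite qw_val by lia. replace (max n s) with s by lia.
    apply Rinv_r. apply not_0_INR; lia. }
  destruct (classic (a + b <= N)%nat) as [Hab|Hab].
  - assert (Hle : forall s, (1 <= s <= N)%nat -> (s <= a + b)%nat -> INR s * / INR (max n (a + b)) <= gw n N s).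
    { intros s Hs Hs'. unfold gw. rewrite qw_val by assumption. apply Rmult_le_compat_l; [apply pos_INR|].
      apply Rinv_le_contravar; [apply lt_0_INR; lia|]. apply le_INR; lia. }
    destruct (classic ((n <= a <= N)%nat /\ (n <= b <= N)%nat)) as [[H1 H2]|H].
    + rewrite ind_true by auto. rewrite (Hone a), (Hone b), (Hone (a + b)%nat) by lia. lra.
    + rewrite ind_false by exact H. pose proof (Hle a ltac:(lia) ltac:(lia)). pose proof (Hle b ltac:(lia) ltac:(lia)).
      unfold gw at 3. rewrite qw_val by lia. rewrite plus_INR. lra.
  - assert (Hz : gw n N (a + b) = 0) by (unfold gw; rewrite qw_0 by lia; lra). rewrite Hz.
    destruct (classic ((n <= a <= N)%nat /\ (n <= b <= N)%nat)) as [[H1 H2]|H].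
    + rewrite ind_true by auto. rewrite (Hone a), (Hone b) by assumption. lra.
    + rewrite ind_false by exact H. pose proof (Hpos a). pose proof (Hpos b). lra.
Qed.

Section TwoGhost.
Context {V : Type} (nb : V -> list V).
Context (nb_nodup : forall v, NoDup (nb v)).
Context (nb_sym : forall v w, In w (nb v) -> In v (nb w)).
Context (nb_irrefl : forall v, ~ In v (nb v)).
Context (Htrans : transitive_graph nb) (Hunim : unimodular nb).
Context (d : nat) (Hd : forall x, (length (nb x) <= d)%nat).
Context (p : R) (Hp : 0 <= p <= 1).
Context (n N : nat) (Hn : (1 <= n)%nat).

Notation adj := (adj nb).
Notation ball := (ball nb).
Notation valid := (valid nb).
Notation dep := (dep nb).
Notation conn := (@open_conn V).
Notation Ex := (Ex nb).

(** Each edge at [u] sends its signed mass [p - w_e] to every vertex of the clusters it touches, in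
    proportion to the vertex weight [qw]. What [u] sends is a sum over its edges of cluster weights;
    what [x] receives involves only the cluster of [x]. *)
Definition transport (u x : V) (w : config) : R :=
  sum (nb u) (fun y => ind (conn w u x \/ conn w y x) * qw n N (cs w x) * (p - ind (w u y = true))).

Lemma in_cluster_ball w x z : valid w -> (1 <= cs w x <= N)%nat -> conn w x z -> In z (ball x N).
Proof.
  intros Hw Hc Hz. pose proof (cs_pos_enum w x (proj1 Hc)) as HL.
  apply (ball_le nb x (cs w x)); [lia|]. apply (enum_ball nb w x _ Hw HL), HL, Hz.
Qed.

Lemma touch_ball w u y x : valid w -> adj u y -> (1 <= cs w x <= N)%nat ->
  conn w u x \/ conn w y x -> In x (ball u (S N)).
Proof.
  intros Hw Huy Hc [H|H].
  - apply (ball_le nb u N); [lia|]. apply (ball_sym nb nb_sym), (in_cluster_ball w); auto.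
    apply (conn_sym nb); auto.
  - apply (ball_trans nb u 1 N y); [apply (ball_step nb u 0 u); [left; reflexivity|exact Huy]|].
    apply (ball_sym nb nb_sym), (in_cluster_ball w); auto. apply (conn_sym nb); auto.
Qed.

Lemma transport_support u x w : valid w -> transport u x w <> 0 -> In x (ball u (S N)).
Proof.
  intros Hw H. apply NNPP; intros Hx. apply H. apply sum_0. intros y Hy.
  destruct (classic (1 <= cs w x <= N)%nat) as [Hc|Hc].
  - destruct (classic (conn w u x \/ conn w y x)) as [Ht|Ht].
    + exfalso. apply Hx, (touch_ball w u y); auto.
    + rewrite ind_false by exact Ht. lra.
  - rewrite qw_0 by exact Hc. lra.
Qed.

Lemma transport_dep u x : dep (inside (ball u (2 * N + 3))) (transport u x).
Proof.
  unfold transport. apply dep_sum. intros y Hy. apply (dep_op2 nb _ Rmult).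
  - apply (dep_by_support nb). intros w w' Hw Hw' E H0.
    assert (Hc : (1 <= cs w x <= N)%nat).
    { apply (qw_pos n N). intros Hq; apply H0; rewrite Hq; lra. }
    assert (Ht : conn w u x \/ conn w y x).
    { apply NNPP; intros Hq; apply H0; rewrite (ind_false _ Hq); lra. }
    assert (Hx : In x (ball u (S N))) by (apply (touch_ball w u y); auto).
    destruct (enum_local nb w w' x N (ball u (2 * N + 3)) Hw Hw') as [H1 [H2 H3]]; auto.
    { intros z Hz. apply (ball_le nb u (S N + S N)); [lia|]. apply (ball_trans nb u (S N) (S N) x); auto. }
    rewrite H3. f_equal. apply ind_iff.
    assert (Hcc : forall z, conn w z x <-> conn w' z x).
    { intros z. split; intros Hz; apply (conn_sym nb); auto; apply (conn_sym nb) in Hz; auto.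
      - apply H2, H1; exact Hz.
      - apply H1, H2; exact Hz. }
    rewrite !Hcc. tauto.
  - intros w w' Hw Hw' E. rewrite (E u y Hy); [reflexivity|]. split.
    + apply ball_self.
    + apply (ball_le nb u 1); [lia|]. apply (ball_step nb u 0 u); [left; reflexivity|exact Hy].
Qed.

Lemma transport_aut f u x w : is_aut nb f -> valid w -> transport (f u) (f x) w = transport u x (pull f w).
Proof.
  intros Hf Hw. unfold transport. rewrite sum_nb_aut by assumption. apply sum_ext. intros y _.
  rewrite (cs_pull nb f w x Hf). f_equal. f_equal. apply ind_iff.
  rewrite !(conn_pull nb f) by exact Hf. tauto.
Qed.

Lemma cluster_sum w z (L : list V) (f : nat -> R) : valid w -> NoDup L -> (f (cs w z) <> 0 -> (1 <= cs w z <= N)%nat) ->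
  incl (ball z N) L ->
  sum L (fun x => ind (conn w z x) * f (cs w x)) = INR (cs w z) * f (cs w z).
Proof.
  intros Hw HL Hf Hi. rewrite (sum_ext L _ (fun x => ind (conn w z x) * f (cs w z))).
  - rewrite sum_scal_r. destruct (Req_dec (f (cs w z)) 0) as [H0|H0]; [rewrite H0; lra|].
    f_equal. specialize (Hf H0). pose proof (cs_pos_enum w z (proj1 Hf)) as [H1 H2].
    rewrite (sum_support L (klist w z)); auto.
    + rewrite (sum_ext _ _ (fun _ => 1)), sum_const; [unfold cs; lra|].
      intros x Hx. apply ind_true, H2, Hx.
    + intros x Hx. destruct (classic (conn w z x)) as [Hc|Hc].
      * split; intros _; [apply H2; exact Hc|]. apply Hi, (in_cluster_ball w); auto.
      * rewrite ind_false in Hx by exact Hc. lra.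
  - intros x _. destruct (classic (conn w z x)) as [Hc|Hc].
    + rewrite (cs_conn nb w z x Hw Hc). reflexivity.
    + rewrite ind_false by exact Hc. lra.
Qed.

Definition mass (L : list V) (v y : V) (w : config) : R :=
  sum L (fun x => ind (conn w v x \/ conn w y x) * qw n N (cs w x)).

Lemma mass_val L v y w : valid w -> NoDup L -> incl (ball v N) L -> incl (ball y N) L ->
  mass L v y w = gw n N (cs w v) + ind (~ conn w v y) * gw n N (cs w y).
Proof.
  intros Hw HL Hv Hy. unfold gw.
  rewrite <- (cluster_sum w v L (qw n N)), <- (cluster_sum w y L (qw n N)); auto; try apply qw_pos.
  rewrite <- sum_scal, <- sum_plus. apply sum_ext. intros x _.
  rewrite <- Rmult_assoc, <- Rmult_plus_distr_r. f_equal.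
  destruct (classic (conn w v y)) as [Hc|Hc].
  - rewrite (ind_false (~ _)) by tauto. rewrite Rmult_0_l, Rplus_0_r. apply ind_iff.
    pose proof (conn_equiv nb w v y x Hw Hc). tauto.
  - rewrite (ind_true (~ _)) by tauto. rewrite Rmult_1_l.
    destruct (classic (conn w v x)) as [H1|H1], (classic (conn w y x)) as [H2|H2].
    + exfalso. apply Hc. apply conn_trans with x; auto. apply (conn_sym nb); auto.
    + rewrite (ind_true (_ \/ _)), (ind_true (conn w v x)), ind_false by auto. lra.
    + rewrite (ind_true (_ \/ _)), (ind_false (conn w v x)), ind_true by auto. lra.
    + rewrite (ind_false (_ \/ _)), (ind_false (conn w v x)), ind_false by tauto. lra.
Qed.

Definition apart (v y : V) (w : config) : Prop :=
  ~ conn w v y /\ (n <= cs w v <= N)%nat /\ (n <= cs w y <= N)%nat.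

(** Opening the edge either changes no cluster or merges two of them, whose sizes add; in the second
    case [gw_gain] applies. *)
Lemma mass_gain S L v y w : valid w -> supp S w -> In v S -> In y S -> adj v y -> NoDup L ->
  incl (ball v N) L -> incl (ball y N) L ->
  ind (apart v y (upd w v y false)) <= mass L v y (upd w v y false) - mass L v y (upd w v y true).
Proof.
  intros Hw Hs Hv Hy Hvy HL HvL HyL.
  assert (Hw0 := valid_upd nb nb_sym w v y false Hw Hvy).
  assert (Hw1 := valid_upd nb nb_sym w v y true Hw Hvy).
  assert (Hs0 := supp_upd S w v y false Hs Hv Hy).
  assert (Hs1 := supp_upd S w v y true Hs Hv Hy).
  replace (upd w v y true) with (upd (upd w v y false) v y true) in * by (apply upd_upd; left; auto).
  set (w0 := upd w v y false) in *. set (w1 := upd w0 v y true) in *.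
  assert (Hvy1 : conn w1 v y) by (apply conn_edge, upd_same; left; auto).
  assert (Hle : cfg_le w0 w1) by apply cfg_le_open.
  rewrite !mass_val by auto. rewrite (ind_false (~ conn w1 v y)) by tauto.
  rewrite Rmult_0_l, Rplus_0_r.
  pose proof (enum_supp_any S w0 v Hs0) as [Ev1 Ev2]. pose proof (enum_supp_any S w0 y Hs0) as [Ey1 Ey2].
  destruct (classic (conn w0 v y)) as [Hc|Hc].
  - rewrite (ind_false (~ conn w0 v y)) by tauto. rewrite ind_false by (unfold apart; tauto).
    replace (cs w1 v) with (cs w0 v); [lra|]. symmetry. apply cs_enum_eq. split; [exact Ev1|].
    intros x. rewrite Ev2. split; [apply conn_mono; exact Hle|]. intros H.
    apply (conn_open_split nb) in H; auto. pose proof (conn_refl w0 v).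
    destruct H as [H|[[_ H]|[_ H]]]; auto. apply conn_trans with y; auto.
  - rewrite (ind_true (~ conn w0 v y)), Rmult_1_l by exact Hc.
    assert (Hsum : cs w1 v = (cs w0 v + cs w0 y)%nat).
    { unfold cs at 2 3. rewrite <- length_app. apply cs_enum_eq. split.
      - apply NoDup_app; auto. intros x H1 H2. apply Ev2 in H1. apply Ey2 in H2. apply Hc.
        apply conn_trans with x; auto. apply (conn_sym nb); auto.
      - intros x. rewrite in_app_iff, Ev2, Ey2. split.
        + intros [H|H]; [eapply conn_mono; eauto|]. apply conn_trans with y; auto. eapply conn_mono; eauto.
        + intros H. apply (conn_open_split nb) in H; auto. tauto. }
    rewrite Hsum. eapply Rle_trans; [|apply gw_gain; auto].
    + apply ind_le. unfold apart; tauto.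
    + apply (enum_ge w0 v _ 1 (conj Ev1 Ev2)), cluster_ge_1.
    + apply (enum_ge w0 y _ 1 (conj Ey1 Ey2)), cluster_ge_1.
Qed.

Lemma apart_le_mass S L v y : In v S -> In y S -> adj v y -> NoDup L ->
  incl (ball v N) L -> incl (ball y N) L ->
  p * Ex p S (fun w => ind (w v y = false /\ apart v y w)) <=
  Ex p S (fun w => mass L v y w * (p - ind (w v y = true))).
Proof.
  intros Hv Hy Hvy HL HvL HyL.
  rewrite (Ex_avg nb p S (fun w => mass L v y w * _) v y) by assumption.
  rewrite (Ex_avg nb p S (fun w => ind (w v y = false /\ _)) v y) by assumption.
  rewrite <- Ex_scal. apply Ex_le; auto. intros w Hw Hs. unfold avg; simpl.
  rewrite !upd_same by (left; auto).
  rewrite (ind_true (true = true)), (ind_false (false = true)) by congruence.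
  rewrite (ind_false (true = false /\ _)) by (intros [? _]; congruence).
  rewrite (ind_iff (false = false /\ apart v y (upd w v y false)) (apart v y (upd w v y false))) by tauto.
  pose proof (mass_gain S L v y w Hw Hs Hv Hy Hvy HL HvL HyL) as H.
  assert (0 <= p * (1 - p)) by nra. nra.
Qed.

(** The factor [2] appears because each touching edge sends mass from both of its ends. The oriented
    edges are the touching edges and their reversals, two disjoint lists since the graph has no
    loops. *)
Lemma transport_in S v w : valid w -> supp S w -> incl (ball v (N + 2)) S ->
  sum (nodup eqdec (ball v (Datatypes.S N))) (fun u => transport u v w) =
  qw n N (cs w v) * (2 * sum (touching nb S v w) (fun e => p - bit w e)).
Proof.
  intros Hw Hs HS. set (L := nodup eqdec (ball v (Datatypes.S N))).
  destruct (Req_dec (qw n N (cs w v)) 0) as [H0|H0].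
  { rewrite H0, Rmult_0_l. apply sum_0. intros u _. apply sum_0. intros y _. rewrite H0; lra. }
  apply qw_pos in H0.
  set (D := touching nb S v w).
  set (l1 := filter (fun e => dec (conn w (fst e) v \/ conn w (snd e) v)) (flat_map (fun u => map (pair u) (nb u)) L)).
  assert (E1 : sum L (fun u => transport u v w) = qw n N (cs w v) * sum l1 (fun e => p - bit w e)).
  { unfold l1. rewrite sum_filter, sum_flat_map, <- sum_scal. apply sum_ext. intros u _.
    rewrite sum_map, <- sum_scal. apply sum_ext. intros y _. simpl.
    rewrite (ind_iff _ _ (dec_true _)). unfold bit; simpl. ring. }
  rewrite E1. f_equal.
  assert (HD : forall e, In e D -> adj (fst e) (snd e)).
  { intros e He. apply touching_In in He. destruct He as [He _]. apply edges_in_elem in He; tauto. }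
  assert (E2 : sum (D ++ map (fun e => (snd e, fst e)) D) (fun e => p - bit w e) = 2 * sum D (fun e => p - bit w e)).
  { rewrite sum_app, sum_map. rewrite (sum_ext D (fun x => p - bit w (snd x, fst x)) (fun e => p - bit w e)); [lra|].
    intros e _. unfold bit; simpl. rewrite (proj1 Hw). reflexivity. }
  rewrite <- E2. apply sum_perm, NoDup_Permutation.
  - apply NoDup_filter. unfold L. generalize (NoDup_nodup eqdec (ball v (Datatypes.S N))).
    generalize (nodup eqdec (ball v (Datatypes.S N))). induction 1 as [|u K Hu HK IH]; simpl; [constructor|].
    apply NoDup_app; auto.
    + apply FinFun.Injective_map_NoDup; auto. intros a b [= H]; exact H.
    + intros e He He'. apply in_map_iff in He. destruct He as [y [<- _]].
      apply in_flat_map in He'. destruct He' as [u' [Hu' He']]. apply in_map_iff in He'.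
      destruct He' as [y' [[= <- _] _]]. contradiction.
  - assert (HDs : simple D) by apply simple_filter, edges_in_simple.
    apply NoDup_app.
    + apply simple_NoDup; exact HDs.
    + apply FinFun.Injective_map_NoDup; [|apply simple_NoDup; exact HDs].
      intros [a b] [a' b'] H. simpl in H. congruence.
    + intros e He He'. apply in_map_iff in He'. destruct He' as [e' [<- He']].
      assert (E : e' = (snd e', fst e')) by (apply (simple_unique D); auto; right; auto).
      apply (nb_irrefl (fst e')). assert (Ha := HD _ He'). rewrite E in Ha at 2. exact Ha.
  - intros [u y]. unfold l1. rewrite filter_In, dec_true, in_app_iff, in_map_iff, in_flat_map. simpl.
    assert (Hsym : forall z, conn w z v <-> conn w v z) by (intros z; split; apply (conn_sym nb); auto).
    rewrite !Hsym. split.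
    + intros [[u' [Hu Huy]] Ht]. apply in_map_iff in Huy. destruct Huy as [y' [[= -> ->] Huy]].
      assert (HuS : In u S).
      { apply HS. unfold L in Hu. apply nodup_In in Hu. apply (ball_le nb v (Datatypes.S N)); [lia|auto]. }
      assert (HyS : In y S).
      { apply HS. unfold L in Hu. apply nodup_In in Hu. replace (N + 2)%nat with (Datatypes.S (Datatypes.S N)) by lia.
        apply (ball_step nb v _ u); auto. }
      destruct (edges_in_covers nb S u y Huy (conj HuS HyS)) as [[a b] [He Hse]].
      simpl in Hse. destruct Hse as [[-> ->]|[-> ->]].
      * left. apply touching_In; auto.
      * right. exists (a, b). split; [reflexivity|]. apply touching_In. simpl; tauto.
    + intros H.
      assert (Huy : adj u y /\ (conn w v u \/ conn w v y)).
      { destruct H as [H|[[a b] [[= -> ->] H]]]; pose proof (HD _ H) as Ha; apply touching_In in H; simpl in *.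
        - tauto.
        - split; [apply nb_sym; exact Ha|tauto]. }
      destruct Huy as [Huy Ht]. split; [|exact Ht]. exists u. split; [|apply in_map; exact Huy].
      unfold L. apply nodup_In, (ball_sym nb nb_sym), (touch_ball w u y); auto. rewrite !Hsym; exact Ht.
Qed.

Lemma two_ghost_transport S v y : adj v y -> incl (ball v (3 * N + 4)) S ->
  p * Ex p S (fun w => ind (w v y = false /\ apart v y w)) <=
  Ex p S (fun w => qw n N (cs w v) * (2 * sum (touching nb S v w) (fun e => p - bit w e))).
Proof.
  intros Hvy HS. set (L := nodup eqdec (ball v (Datatypes.S N))).
  assert (HL : NoDup L) by apply NoDup_nodup.
  assert (HLi : incl (ball v (Datatypes.S N)) L) by (intros x Hx; apply nodup_In; exact Hx).
  assert (Hv : In v S) by (apply HS, ball_self).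
  assert (Hnb : forall z, adj v z -> In z (ball v 1)) by (intros z Hz; apply (ball_step nb v 0 v); [left; reflexivity|exact Hz]).
  assert (HnbS : forall z, adj v z -> In z S) by (intros z Hz; apply HS, (ball_le nb v 1); [lia|auto]).
  assert (HLv : incl (ball v N) L) by (intros x Hx; apply HLi, (ball_le nb v N); [lia|auto]).
  assert (HLz : forall z, adj v z -> incl (ball z N) L).
  { intros z Hz x Hx. apply HLi, (ball_trans nb v 1 N z); auto. }
  (* Mass transport needs all the edges at [v] together; the other neighbours contribute nonnegative
     terms, by the same inequality. *)
  apply Rle_trans with (sum (nb v) (fun z => Ex p S (fun w => mass L v z w * (p - ind (w v z = true))))).
  - eapply Rle_trans; [apply (apart_le_mass S L v y); auto|].
    apply (sum_ge_term (nb v) (fun z => Ex p S (fun w => mass L v z w * (p - ind (w v z = true))))); auto.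
    intros z Hz. eapply Rle_trans; [|apply (apart_le_mass S L v z); auto].
    apply Rmult_le_pos; [lra|]. apply Ex_ind_bound; auto.
  - rewrite <- Ex_sum.
    rewrite (Ex_ext nb nb_sym p S _ (fun w => sum L (fun u => transport v u w))); auto.
    + unfold L. rewrite (mass_transport_Ex nb nb_sym Htrans Hunim p v (Datatypes.S N) (2 * N + 3) S transport); auto.
      * apply Req_le, Ex_ext; auto. intros w Hw Hs. apply transport_in; auto.
        intros x Hx. apply HS, (ball_le nb v (N + 2)); [lia|auto].
      * apply transport_support.
      * apply transport_dep.
      * apply transport_aut.
      * intros x Hx. apply HS, (ball_le nb v (Datatypes.S N + (2 * N + 3))); [lia|auto].
    + intros w _ _. unfold transport, mass. rewrite sum_swap. apply sum_ext. intros z _.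
      rewrite <- sum_scal_r. reflexivity.
Qed.

End TwoGhost.

Lemma INR_pow4 i : INR (4 ^ i) = 4 ^ i.
Proof. rewrite pow_INR. f_equal. simpl; lra. Qed.

Lemma pow4_pow2 i : 4 ^ i = 2 ^ i * 2 ^ i.
Proof. rewrite <- Rpow_mult_distr. f_equal; lra. Qed.

Lemma geometric_tail j m : sum (seq j m) (fun i => / 2 ^ i) <= 2 / 2 ^ j.
Proof.
  assert (H : forall m j, sum (seq j m) (fun i => / 2 ^ i) <= 2 / 2 ^ j - / 2 ^ (j + m)).
  { clear. induction m as [|m IH]; intros j.
    - unfold sum; simpl. rewrite Nat.add_0_r. unfold Rdiv.
      assert (0 < / 2 ^ j) by (apply Rinv_0_lt_compat, pow_lt; lra). lra.
    - simpl seq. rewrite sum_cons. specialize (IH (S j)). replace (j + S m)%nat with (S j + m)%nat by lia.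
      eapply Rle_trans; [apply Rplus_le_compat_l; exact IH|].
      assert (2 / 2 ^ j = / 2 ^ j + 2 / 2 ^ S j); [|lra].
      simpl. field. apply pow_nonzero; lra. }
  assert (0 < / 2 ^ (j + m)) by (apply Rinv_0_lt_compat, pow_lt; lra).
  specialize (H m j). lra.
Qed.

Lemma dyadic_band c j m : (c <= 4 ^ (j + S m))%nat ->
  exists i, (j <= i <= j + m)%nat /\ (c <= 4 ^ S i)%nat /\ (i = j \/ 4 ^ i < c)%nat.
Proof.
  induction m as [|m IH]; intros H.
  - exists j. replace (S j) with (j + 1)%nat by lia. repeat split; auto; lia.
  - destruct (le_lt_dec c (4 ^ (j + S m))) as [Hc|Hc].
    + destruct (IH Hc) as [i [H1 [H2 H3]]]. exists i; repeat split; auto; lia.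
    + exists (j + S m)%nat. replace (S (j + S m)) with (j + S (S m))%nat by lia.
      repeat split; auto; lia.
Qed.

Section TwoGhostBound.
Context {V : Type} (nb : V -> list V).
Context (nb_nodup : forall v, NoDup (nb v)).
Context (nb_sym : forall v w, In w (nb v) -> In v (nb w)).
Context (nb_irrefl : forall v, ~ In v (nb v)).
Context (Htrans : transitive_graph nb) (Hunim : unimodular nb).
Context (d : nat) (Hd : forall x, (length (nb x) <= d)%nat).

Notation adj := (adj nb).
Notation ball := (ball nb).
Notation Ex := (Ex nb).

(** On the band of sizes up to [4^(i+1)], [qw] is at most [4^(-i)] and the square of [X] has mean at
    most [d * 4^i], the bound [p (1 - p) <= 1/4] cancelling one factor [4]. The band contributes at
    most [(d + 1) / 2^i], and the bands form a geometric series. *)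
Lemma two_ghost p j J S v y : 0 <= p <= 1 -> (j < J)%nat -> adj v y -> incl (ball v (3 * 4 ^ J + 4)) S ->
  p * Ex p S (fun w => ind (w v y = false /\ apart (4 ^ j) (4 ^ J) v y w)) <= 2 * (INR d + 1) / 2 ^ j.
Proof.
  intros Hp HjJ Hvy HS.
  assert (H4 : forall i, (1 <= 4 ^ i)%nat) by (intros i; pose proof (Nat.pow_nonzero 4 i); lia).
  assert (H2 : forall i, 0 < 2 ^ i) by (intros; apply pow_lt; lra).
  eapply Rle_trans; [apply (two_ghost_transport nb nb_nodup nb_sym nb_irrefl Htrans Hunim p Hp); auto|].
  set (X := fun w => sum (touching nb S v w) (fun e => p - bit w e)).
  apply Rle_trans with (sum (seq j (J - j)) (fun i => Ex p S (fun w =>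
    / 4 ^ i * (/ 2 ^ i * (ind (1 <= cs w v <= 4 ^ Datatypes.S i)%nat * (X w * X w)) + 2 ^ i)))).
  - rewrite <- Ex_sum. apply Ex_le; auto. intros w Hw Hs. fold (X w).
    assert (Hterm : forall i, 0 <= / 4 ^ i * (/ 2 ^ i * (ind (1 <= cs w v <= 4 ^ Datatypes.S i)%nat * (X w * X w)) + 2 ^ i)).
    { intros i. apply Rmult_le_pos; [left; apply Rinv_0_lt_compat, pow_lt; lra|].
      pose proof (Rinv_0_lt_compat _ (H2 i)). pose proof (ind_bound (1 <= cs w v <= 4 ^ Datatypes.S i)%nat).
      pose proof (H2 i). assert (0 <= X w * X w) by nra.
      apply Rplus_le_le_0_compat; [|lra]. apply Rmult_le_pos; [lra|]. apply Rmult_le_pos; lra. }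
    destruct (Req_dec (qw (4 ^ j) (4 ^ J) (cs w v)) 0) as [H0|H0].
    { rewrite H0, Rmult_0_l. apply sum_nonneg; auto. }
    apply qw_pos in H0.
    destruct (dyadic_band (cs w v) j (J - j - 1)) as [i [Hi1 [Hi2 Hi3]]].
    { replace (j + Datatypes.S (J - j - 1))%nat with J by lia. lia. }
    eapply Rle_trans; [|apply (sum_ge_term (seq j (J - j)) (fun i =>
      / 4 ^ i * (/ 2 ^ i * (ind (1 <= cs w v <= 4 ^ Datatypes.S i)%nat * (X w * X w)) + 2 ^ i)) i); auto].
    2:{ apply in_seq; lia. }
    rewrite ind_true, Rmult_1_l by lia.
    assert (Hq : 0 <= qw (4 ^ j) (4 ^ J) (cs w v) <= / 4 ^ i).
    { split; [apply qw_nonneg|]. rewrite qw_val by exact H0. rewrite <- INR_pow4.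
      apply Rinv_le_contravar; [apply lt_0_INR; pose proof (H4 i); lia|]. apply le_INR.
      destruct Hi3 as [->|Hi3]; lia. }
    (* Young's inequality at the scale [2^i], the standard deviation expected on this band, instead
       of Cauchy-Schwarz. *)
    assert (Hx : 2 * X w <= / 2 ^ i * (X w * X w) + 2 ^ i).
    { pose proof (H2 i) as Ha. assert (/ 2 ^ i * (X w * X w) + 2 ^ i - 2 * X w = / 2 ^ i * ((X w - 2 ^ i) * (X w - 2 ^ i))) by (field; lra).
      assert (0 <= / 2 ^ i * ((X w - 2 ^ i) * (X w - 2 ^ i))).
      { apply Rmult_le_pos; [left; apply Rinv_0_lt_compat; exact Ha|apply (Rle_0_sqr (X w - 2 ^ i))]. }
      lra. }
    assert (Hx' : 0 <= / 2 ^ i * (X w * X w) + 2 ^ i).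
    { pose proof (H2 i) as Ha. apply Rplus_le_le_0_compat; [|lra].
      apply Rmult_le_pos; [left; apply Rinv_0_lt_compat; exact Ha|apply (Rle_0_sqr (X w))]. }
    apply Rle_trans with (qw (4 ^ j) (4 ^ J) (cs w v) * (/ 2 ^ i * (X w * X w) + 2 ^ i)).
    + apply Rmult_le_compat_l; [apply Hq|exact Hx].
    + apply Rmult_le_compat_r; [exact Hx'|apply Hq].
  - apply Rle_trans with (sum (seq j (J - j)) (fun i => (INR d + 1) * / 2 ^ i)).
    + apply sum_le. intros i _. rewrite Ex_scal, Ex_plus, Ex_scal, Ex_cst.
      pose proof (second_moment nb nb_sym p S v (4 ^ Datatypes.S i) d Hp Hd) as Hm. fold X in Hm.
      change (fun w => ind (1 <= cs w v <= 4 ^ Datatypes.S i)%nat *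
        (sum (touching nb S v w) (fun e => p - bit w e) * sum (touching nb S v w) (fun e => p - bit w e)))
        with (fun w => ind (1 <= cs w v <= 4 ^ Datatypes.S i)%nat * (X w * X w)) in Hm.
      rewrite mult_INR, INR_pow4 in Hm. set (E := Ex p S _) in *.
      assert (HE : E <= INR d * (2 ^ i * 2 ^ i)).
      { eapply Rle_trans; [exact Hm|]. simpl. rewrite pow4_pow2. pose proof (pos_INR d).
        assert (p * (1 - p) <= / 4) by (pose proof (Rle_0_sqr (p - / 2)) as Hsq; unfold Rsqr in Hsq; lra). pose proof (H2 i).
        assert (0 <= INR d * (2 ^ i * 2 ^ i)) by (apply Rmult_le_pos; [lra|nra]). nra. }
      rewrite pow4_pow2. pose proof (H2 i) as Ha.
      apply Rle_trans with (/ (2 ^ i * 2 ^ i) * (/ 2 ^ i * (INR d * (2 ^ i * 2 ^ i)) + 2 ^ i)).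
      * apply Rmult_le_compat_l; [left; apply Rinv_0_lt_compat; nra|]. apply Rplus_le_compat_r.
        apply Rmult_le_compat_l; [left; apply Rinv_0_lt_compat; exact Ha|exact HE].
      * apply Req_le. field. lra.
    + rewrite sum_scal. pose proof (geometric_tail j (J - j)). pose proof (pos_INR d).
      unfold Rdiv in *. nra.
Qed.

End TwoGhostBound.

(** * Random walk in a finite set *)

Lemma cauchy_schwarz {A} (l : list A) f g :
  sum l (fun x => f x * g x) * sum l (fun x => f x * g x) <=
  sum l (fun x => f x * f x) * sum l (fun x => g x * g x).
Proof.
  induction l as [|x l IH]; [unfold sum; simpl; lra|]. rewrite !sum_cons.
  assert (HA : 0 <= sum l (fun x => f x * f x)) by (apply sum_nonneg; intros; nra).
  assert (HB : 0 <= sum l (fun x => g x * g x)) by (apply sum_nonneg; intros; nra).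
  set (A1 := sum l (fun x => f x * f x)) in *. set (B1 := sum l (fun x => g x * g x)) in *.
  set (S1 := sum l (fun x => f x * g x)) in *. set (a := f x). set (b := g x).
  clearbody A1 B1 S1 a b.
  assert (H : 2 * S1 * a * b <= A1 * (b * b) + B1 * (a * a)).
  { destruct (Req_dec A1 0) as [H0|H0].
    - assert (S1 = 0) by nra. rewrite H, H0. nra.
    - apply Rmult_le_reg_l with A1; [lra|].
      pose proof (Rle_0_sqr (A1 * b - S1 * a)) as H1. unfold Rsqr in H1.
      assert (S1 * S1 * (a * a) <= A1 * B1 * (a * a)) by (apply Rmult_le_compat_r; [apply Rle_0_sqr|exact IH]). lra. }
  lra.
Qed.

Lemma ln_le x y : 0 < x -> x <= y -> ln x <= ln y.
Proof. intros Hx [H| ->]; [left; apply ln_increasing; assumption|lra]. Qed.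

(** The logarithm of [b] has nondecreasing increments, so it lies below the chord from [0] to [m],
    and the fraction [k / m] of the decay is already present at [k]. *)
Lemma log_convex_interp (b : nat -> R) k m lam : (forall j, 0 < b j) ->
  (forall j, b (S j) * b (S j) <= b j * b (S (S j))) -> (k <= m)%nat -> (1 <= m)%nat ->
  b m <= b 0%nat * exp (- lam) -> b k <= b 0%nat * exp (- (INR k / INR m * lam)).
Proof.
  intros Hb Hc Hkm Hm Hbm. set (L := fun j => ln (b j)).
  assert (HD : forall j, L (S j) - L j <= L (S (S j)) - L (S j)).
  { intros j. specialize (Hc j). apply ln_le in Hc; [|apply Rmult_lt_0_compat; apply Hb].
    rewrite !ln_mult in Hc by apply Hb. unfold L; lra. }
  assert (H1 : forall j, L j - L 0%nat <= INR j * (L (S j) - L j)).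
  { induction j as [|j IH]; [simpl; lra|]. rewrite S_INR. specialize (HD j). pose proof (pos_INR j). nra. }
  assert (HDm : forall j, (k <= j)%nat -> L (S k) - L k <= L (S j) - L j).
  { induction 1 as [|j _ IH]; [lra|]. specialize (HD j). lra. }
  assert (H2 : INR m * (L k - L 0%nat) <= INR k * (L m - L 0%nat)).
  { clear Hm Hbm. induction Hkm as [|m Hkm IH]; [lra|]. rewrite S_INR.
    specialize (HDm m Hkm). specialize (H1 k). pose proof (pos_INR k). nra. }
  assert (H3 : L m - L 0%nat <= - lam).
  { apply ln_le in Hbm; [|apply Hb]. rewrite ln_mult, ln_exp in Hbm by (try apply Hb; apply exp_pos).
    unfold L; lra. }
  assert (Hm0 : 0 < INR m) by (apply lt_0_INR; lia).
  assert (H4 : L k <= L 0%nat - INR k / INR m * lam).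
  { apply Rmult_le_reg_l with (INR m); [lra|]. replace (INR m * (L 0%nat - INR k / INR m * lam))
      with (INR m * L 0%nat - INR k * lam) by (field; lra). pose proof (pos_INR k). nra. }
  rewrite <- (exp_ln (b k)), <- (exp_ln (b 0%nat)) by apply Hb. rewrite <- exp_plus.
  destruct H4 as [H4|H4]; [left; apply exp_increasing|right; f_equal]; unfold L in H4; lra.
Qed.

Section Walk.
Context {V : Type} (nb : V -> list V).
Context (nb_nodup : forall v, NoDup (nb v)).
Context (nb_sym : forall v w, In w (nb v) -> In v (nb w)).
Context (d : nat) (Hd : forall x, length (nb x) = d) (Hd0 : (1 <= d)%nat).

Notation adj := (adj nb).
Notation ball := (ball nb).
Notation wp := (walk_prob nb).

Lemma wp_S k x y : wp (S k) x y = / INR d * sum (nb x) (fun z => wp k z y).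
Proof. simpl. unfold deg. rewrite Hd. rewrite <- sum_scal. reflexivity. Qed.

(** [walk_prob] unfolds at the first step; on a regular graph it also unfolds at the last, which
    yields the symmetry of the walk. *)
Lemma wp_S_r k x y : wp (S k) x y = / INR d * sum (nb y) (fun z => wp k x z).
Proof.
  revert x y. induction k as [|k IH]; intros x y.
  - rewrite wp_S. f_equal. simpl.
    assert (H : forall l : list V, NoDup l -> forall z, sum l (fun u => ind (z = u)) = ind (In z l)).
    { intros l Hl z. destruct (classic (In z l)) as [Hz|Hz].
      - rewrite ind_true by exact Hz. rewrite <- (sum_pick l z (fun _ => 1) Hl Hz).
        apply sum_ext; intros; lra.
      - rewrite ind_false by exact Hz. apply sum_0. intros u Hu. apply ind_false. intros <-; auto. }
    rewrite H by auto. rewrite (sum_ext _ _ (fun u => ind (y = u))) by (intros; apply ind_iff; split; auto).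
    rewrite H by auto. apply ind_iff. split; apply nb_sym.
  - rewrite wp_S. f_equal. rewrite (sum_ext (nb x) _ (fun z => / INR d * sum (nb y) (fun u => wp k z u))) by auto.
    rewrite sum_scal, sum_swap, <- sum_scal. apply sum_ext. intros u _. rewrite wp_S. reflexivity.
Qed.

Lemma wp_sym k x y : wp k x y = wp k y x.
Proof.
  revert x y; induction k as [|k IH]; intros x y.
  - simpl. apply ind_iff; split; auto.
  - rewrite wp_S, wp_S_r. f_equal. apply sum_ext; auto.
Qed.

Lemma wp_nonneg k x y : 0 <= wp k x y.
Proof.
  revert x; induction k as [|k IH]; intros x; [apply ind_bound|]. rewrite wp_S.
  apply Rmult_le_pos; [left; apply Rinv_0_lt_compat, lt_0_INR; lia|]. apply sum_nonneg; auto.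
Qed.

Lemma wp_mass k x (L : list V) : NoDup L -> incl (ball x k) L -> sum L (wp k x) = 1.
Proof.
  intros HL. revert x; induction k as [|k IH]; intros x Hi.
  - simpl. rewrite <- (sum_pick L x (fun _ => 1) HL); [apply sum_ext; intros; lra|]. apply Hi; left; auto.
  - rewrite (sum_ext L _ (fun y => / INR d * sum (nb x) (fun z => wp k z y))) by (intros; apply wp_S).
    rewrite sum_scal, sum_swap. rewrite (sum_ext (nb x) _ (fun _ => 1)).
    + rewrite sum_const, Hd. field. apply not_0_INR; lia.
    + intros z Hz. apply IH. intros y Hy. apply Hi, (ball_trans nb x 1 k z); auto.
      apply (ball_step nb x 0 x); [left; reflexivity|exact Hz].
Qed.

Lemma wp_chapman i j x y (L : list V) : NoDup L -> incl (ball x i) L ->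
  sum L (fun z => wp i x z * wp j z y) = wp (i + j) x y.
Proof.
  intros HL. revert x; induction i as [|i IH]; intros x Hi.
  - apply (sum_pick L x (fun z => wp j z y) HL). apply Hi; left; auto.
  - rewrite (sum_ext L _ (fun z => / INR d * sum (nb x) (fun u => wp i u z * wp j z y))).
    + rewrite sum_scal, sum_swap. simpl plus. rewrite wp_S. f_equal. apply sum_ext. intros u Hu.
      apply IH. intros z Hz. apply Hi, (ball_trans nb x 1 i u); auto.
      apply (ball_step nb x 0 x); [left; reflexivity|exact Hu].
    + intros z _. rewrite wp_S, sum_scal_r. ring.
Qed.

Lemma wp_aut f k x y : is_aut nb f -> wp k (f x) (f y) = wp k x y.
Proof.
  intros Hf. revert x; induction k as [|k IH]; intros x.
  - simpl. apply ind_iff. split; [apply (aut_inj nb f Hf)|intros ->; reflexivity].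
  - rewrite !wp_S, sum_nb_aut by assumption. f_equal. apply sum_ext; auto.
Qed.

Definition kernel (K : list V) (k : nat) : R := sum K (fun x => sum K (fun y => wp k x y)).

Lemma kernel_split K i j (L : list V) : NoDup L -> (forall x, In x K -> incl (ball x i) L) ->
  kernel K (i + j) = sum L (fun z => sum K (fun x => wp i x z) * sum K (fun y => wp j y z)).
Proof.
  intros HL Hi. unfold kernel.
  rewrite (sum_ext L _ (fun z => sum K (fun x => sum K (fun y => wp i x z * wp j z y)))).
  - symmetry. rewrite sum_swap. apply sum_ext. intros x Hx. rewrite sum_swap. apply sum_ext. intros y _.
    apply wp_chapman; auto.
  - intros z _. rewrite <- sum_scal_r. apply sum_ext. intros x _. rewrite <- sum_scal.
    apply sum_ext. intros y _. rewrite (wp_sym j). reflexivity.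
Qed.

(** At even times the kernel is the squared norm of the [i]-step distribution started from [K],
    whose total mass is [|K|]. Positivity is what allows taking logarithms. *)
Lemma kernel_pos K i : K <> [] -> 0 < kernel K (i + i).
Proof.
  intros HK. set (L := nodup eqdec (flat_map (fun x => ball x i) K)).
  assert (HL : NoDup L) by apply NoDup_nodup.
  assert (Hi : forall x, In x K -> incl (ball x i) L).
  { intros x Hx y Hy. apply nodup_In, in_flat_map. exists x; auto. }
  rewrite (kernel_split K i i L HL Hi).
  set (u := fun z => sum K (fun x => wp i x z)).
  assert (Hu : sum L u = INR (length K)).
  { unfold u. rewrite sum_swap, (sum_ext K _ (fun _ => 1)), sum_const; [lra|].
    intros x Hx. apply wp_mass; auto. }
  assert (HK0 : 0 < INR (length K)) by (apply lt_0_INR; destruct K; [congruence|simpl; lia]).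
  destruct (Rle_lt_or_eq_dec 0 (sum L (fun z => u z * u z))) as [H|H]; auto.
  { apply sum_nonneg; intros; nra. }
  exfalso. assert (Hz : sum L u = 0); [|lra]. apply sum_0. intros z Hz.
  pose proof (sum_ge_term L (fun z => u z * u z) z ltac:(intros; nra) Hz). simpl in H0. nra.
Qed.

Lemma kernel_log_convex K j : kernel K (S j + S j) * kernel K (S j + S j) <=
  kernel K (j + j) * kernel K (S (S j) + S (S j)).
Proof.
  set (L := nodup eqdec (flat_map (fun x => ball x (S (S j))) K)).
  assert (HL : NoDup L) by apply NoDup_nodup.
  assert (Hi : forall i x, (i <= S (S j))%nat -> In x K -> incl (ball x i) L).
  { intros i x Hle Hx y Hy. apply nodup_In, in_flat_map. exists x; split; auto. apply (ball_le nb x i); auto. }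
  replace (S j + S j)%nat with (j + S (S j))%nat by lia.
  rewrite (kernel_split K j j L), (kernel_split K (S (S j)) (S (S j)) L), (kernel_split K j (S (S j)) L) by auto.
  apply cauchy_schwarz.
Qed.

Lemma kernel_bound gamma c K m : HK nb gamma c -> (1 <= m)%nat ->
  kernel K (m + m) <= INR (length K) * INR (length K) * exp (- c * Rpower (INR (m + m)) gamma).
Proof.
  intros Hhk Hm. assert (H : forall x y, wp (m + m) x y <= exp (- c * Rpower (INR (m + m)) gamma)).
  { intros x y. set (L := nodup eqdec (ball x m ++ ball y m)).
    assert (HL : NoDup L) by apply NoDup_nodup.
    assert (H1 : incl (ball x m) L) by (intros z Hz; apply nodup_In, in_or_app; auto).
    assert (H2 : incl (ball y m) L) by (intros z Hz; apply nodup_In, in_or_app; auto).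
    pose proof (Hhk x (m + m)%nat ltac:(lia)) as Hx. pose proof (Hhk y (m + m)%nat ltac:(lia)) as Hy.
    rewrite <- (wp_chapman m m x x L HL H1) in Hx. rewrite <- (wp_chapman m m y y L HL H2) in Hy.
    rewrite <- (wp_chapman m m x y L HL H1).
    (* Off-diagonal probabilities at even times are at most the mean of the two return
       probabilities. *)
    apply Rle_trans with (/ 2 * (sum L (fun z => wp m x z * wp m z x) + sum L (fun z => wp m y z * wp m z y))); [|lra].
    rewrite <- sum_plus, <- sum_scal. apply sum_le. intros z _.
    rewrite (wp_sym m z x), (wp_sym m z y).
    pose proof (Rle_0_sqr (wp m x z - wp m y z)). unfold Rsqr in H. lra. }
  unfold kernel. rewrite Rmult_assoc, <- sum_const. apply sum_le. intros x _.
  rewrite <- sum_const. apply sum_le; auto.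
Qed.

(** The condition on [m] makes the heat kernel factor at time [2m] at most [|K|^(-2)], so the kernel
    there is at most [1], that is [|K| exp(- ln |K|)]; the interpolation passes this to time
    [2k]. *)
Lemma kernel_decay gamma c K k m : HK nb gamma c -> NoDup K -> K <> [] -> (k <= m)%nat -> (1 <= m)%nat ->
  2 * ln (INR (length K)) <= c * Rpower (INR (m + m)) gamma ->
  kernel K (k + k) <= INR (length K) * exp (- (INR k / INR m * ln (INR (length K)))).
Proof.
  intros Hhk HKn HK Hkm Hm Hs.
  assert (HK0 : 0 < INR (length K)) by (apply lt_0_INR; destruct K; [congruence|simpl; lia]).
  assert (H0 : kernel K (0 + 0) = INR (length K)).
  { unfold kernel. simpl. rewrite (sum_ext K _ (fun _ => 1)), sum_const; [lra|].
    intros x Hx. rewrite <- (sum_pick K x (fun _ => 1) HKn Hx). apply sum_ext; intros; lra. }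
  pose proof (log_convex_interp (fun j => kernel K (j + j)) k m (ln (INR (length K)))) as H.
  cbv beta in H. rewrite H0 in H. apply H; auto.
  - intros; apply kernel_pos; exact HK.
  - intros; apply kernel_log_convex.
  - rewrite exp_Ropp, exp_ln, Rinv_r by lra.
    eapply Rle_trans; [apply (kernel_bound gamma c K m Hhk Hm)|].
    set (s := INR (length K)) in *.
    apply Rle_trans with (s * s * exp (- (2 * ln s))).
    + apply Rmult_le_compat_l; [nra|]. destruct (Rle_lt_or_eq_dec _ _ Hs) as [Hlt|Heq].
      * left; apply exp_increasing; lra.
      * right; f_equal; lra.
    + rewrite exp_Ropp. replace (2 * ln s) with (ln s + ln s) by lra. rewrite exp_plus, exp_ln by exact HK0.
      right. field. lra.
Qed.

End Walk.

(** * The self-consistent inequality for the tail *)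

Section SelfBound.
Context {V : Type} (nb : V -> list V).
Context (nb_nodup : forall v, NoDup (nb v)).
Context (nb_sym : forall v w, In w (nb v) -> In v (nb w)).
Context (nb_irrefl : forall v, ~ In v (nb v)).
Context (Htrans : transitive_graph nb) (Hunim : unimodular nb).
Context (d : nat) (Hd : forall x, length (nb x) = d) (Hd0 : (1 <= d)%nat).
Context (p : R) (Hp : 0 <= p <= 1).

Notation adj := (adj nb).
Notation ball := (ball nb).
Notation valid := (valid nb).
Notation dep := (dep nb).
Notation conn := (@open_conn V).
Notation Ex := (Ex nb).
Notation wp := (walk_prob nb).
Notation psi := (psi nb).

(** A vertex in a cluster of size [s] distributes its probability of being in its own cluster at
    time [k] evenly over that cluster. *)
Definition spread (s k : nat) (u x : V) (w : config) : R :=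
  ind (cs w u = s /\ conn w u x) * (/ INR s * sum (klist w u) (fun z => wp k u z)).

Lemma enum_perm (w : config) v (K K' : list V) : enum w v K -> enum w v K' -> Permutation K K'.
Proof.
  intros [H1 H2] [H3 H4]. apply NoDup_Permutation; auto. intros x. rewrite H2, H4. tauto.
Qed.

Lemma klist_pull f w u : is_aut nb f -> (1 <= cs w (f u))%nat ->
  Permutation (klist w (f u)) (map f (klist (pull f w) u)).
Proof.
  intros Hf Hc. assert (Hc' : (1 <= cs (pull f w) u)%nat) by (rewrite (cs_pull nb); assumption).
  pose proof (cs_pos_enum _ _ Hc) as H1. pose proof (cs_pos_enum _ _ Hc') as [H2 H3].
  apply (enum_perm w (f u)); auto. split.
  - apply FinFun.Injective_map_NoDup; auto. intros a b; apply (aut_inj nb); assumption.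
  - intros x. pose proof Hf as [[g [Hg Hg']] _]. rewrite in_map_iff. split.
    + intros [y [<- Hy]]. apply (proj1 (conn_pull nb f w u y Hf)), H3, Hy.
    + intros H. exists (g x). split; [apply Hg'|]. apply H3, (conn_pull nb f w u (g x) Hf).
      rewrite Hg'; exact H.
Qed.

(** The walk started at [v] may be replaced by one started at a uniform vertex of the cluster of
    [v], and for the latter the probability of being in the cluster is [kernel / s]. *)
Lemma walk_return_mtp s k v S : (1 <= s)%nat -> incl (ball v (2 * s + 1)) S ->
  Ex p S (fun w => ind (cs w v = s) * sum (klist w v) (fun z => wp k v z)) =
  Ex p S (fun w => ind (cs w v = s) * (/ INR s * kernel nb (klist w v) k)).
Proof.
  intros Hs HS. assert (Hs0 : INR s <> 0) by (apply not_0_INR; lia).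
  set (L := nodup eqdec (ball v s)).
  assert (HL : forall w (h : V -> R), valid w -> cs w v = s ->
    sum L (fun u => ind (conn w v u) * h u) = sum (klist w v) h).
  { intros w h Hw Hc. assert (HK : enum w v (klist w v)) by (apply cs_pos_enum; lia).
    pose proof HK as [H1 H2].
    rewrite (sum_support L (klist w v)); auto; [|apply NoDup_nodup|].
    - apply sum_ext. intros x Hx. rewrite ind_true; [lra|]. apply H2; exact Hx.
    - intros x Hx. assert (Hcx : conn w v x).
      { apply NNPP; intros Hn. apply Hx. rewrite ind_false by exact Hn. lra. }
      split; intros _; [apply H2; exact Hcx|]. apply nodup_In.
      rewrite <- Hc. apply (enum_ball nb w v (klist w v) Hw HK), H2, Hcx. }
  rewrite (Ex_ext nb nb_sym p S _ (fun w => sum L (fun u => spread s k v u w))); auto.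
  - unfold L. rewrite (mass_transport_Ex nb nb_sym Htrans Hunim p v s (s + 1) S (spread s k)); auto.
    + apply Ex_ext; auto. intros w Hw Hsu. fold L. destruct (Nat.eq_dec (cs w v) s) as [Hc|Hc].
      * rewrite ind_true, Rmult_1_l by exact Hc. unfold kernel. rewrite <- sum_scal, <- (HL w) by assumption.
        apply sum_ext. intros u _. unfold spread. destruct (classic (conn w v u)) as [Hu|Hu].
        -- pose proof (cs_conn nb w v u Hw Hu) as Hcu.
           rewrite !ind_true; auto; [|split; [lia|apply (conn_sym nb); auto]]. rewrite !Rmult_1_l. f_equal.
           apply sum_perm. apply (enum_perm w v); [|apply cs_pos_enum; lia].
           assert (Hu2 : enum w u (klist w u)) by (apply cs_pos_enum; lia). destruct Hu2 as [Hu2 Hu3].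
           split; auto. intros x. rewrite Hu3. symmetry. apply (conn_equiv nb); auto.
        -- rewrite !ind_false; auto; [lra|]. intros [_ H]. apply Hu, (conn_sym nb); auto.
      * rewrite ind_false, Rmult_0_l by exact Hc. apply sum_0. intros u _. unfold spread.
        rewrite ind_false; [lra|]. intros [H1 H2]. apply Hc. rewrite <- H1. symmetry. apply (cs_conn nb); auto.
    + intros u x w Hw H. assert (Hx : cs w u = s /\ conn w u x).
      { apply NNPP; intros Hn. apply H. unfold spread. rewrite ind_false by exact Hn. lra. }
      destruct Hx as [Hx1 Hx2]. assert (HK : enum w u (klist w u)) by (apply cs_pos_enum; lia).
      rewrite <- Hx1. apply (enum_ball nb w u _ Hw HK), HK, Hx2.
    + intros u x. apply (dep_by_support nb). intros w w' Hw Hw' E H0.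
      assert (Hx : cs w u = s /\ conn w u x).
      { apply NNPP; intros Hn. apply H0. unfold spread. rewrite ind_false by exact Hn. lra. }
      destruct Hx as [Hx1 Hx2].
      destruct (enum_local nb w w' u s (ball u (s + 1)) Hw Hw') as [H1 [H2 H3]]; auto; try lia.
      { replace (s + 1)%nat with (Datatypes.S s) by lia. apply incl_refl. }
      unfold spread. rewrite !ind_true; [f_equal; f_equal| |].
      * apply sum_perm, (enum_perm w' u); [apply cs_pos_enum; lia|exact H2].
      * split; auto.
      * split; [lia|]. apply H2, H1; exact Hx2.
    + intros f u x w Hf Hw. unfold spread. rewrite (cs_pull nb f w u Hf).
      rewrite (ind_iff (cs w (f u) = s /\ conn (pull f w) u x) (cs w (f u) = s /\ conn w (f u) (f x)))
        by (rewrite (conn_pull nb f) by exact Hf; tauto).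
      destruct (classic (cs w (f u) = s /\ conn w (f u) (f x))) as [[H1 H2]|H].
      * f_equal. f_equal. rewrite (sum_perm _ _ _ (klist_pull f w u Hf ltac:(lia))), sum_map.
        apply sum_ext. intros z _. apply (wp_aut nb nb_nodup d Hd); exact Hf.
      * rewrite ind_false by exact H. lra.
    + intros x Hx. apply HS, (ball_le nb v (s + (s + 1))); [lia|auto].
  - intros w Hw Hsu. destruct (Nat.eq_dec (cs w v) s) as [Hc|Hc].
    + rewrite ind_true, Rmult_1_l by exact Hc.
      rewrite (sum_ext L _ (fun u => ind (conn w v u) * (/ INR s * sum (klist w v) (fun z => wp k v z)))).
      * rewrite HL by assumption. rewrite sum_const. fold (cs w v). rewrite Hc. field. exact Hs0.
      * intros u _. unfold spread. f_equal. apply ind_iff. tauto.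
    + rewrite ind_false, Rmult_0_l by exact Hc. symmetry. apply sum_0. intros u _. unfold spread.
      rewrite ind_false; [lra|tauto].
Qed.

(** One size [s] at a time, because the time scale [m] fed to the heat kernel bound will depend on
    [s]. *)
Lemma walk_return gamma c s k m v S : HK nb gamma c -> (1 <= s)%nat -> (k <= m)%nat -> (1 <= m)%nat ->
  2 * ln (INR s) <= c * Rpower (INR (m + m)) gamma -> incl (ball v (2 * s + 1)) S ->
  sum (nodup eqdec (ball v (k + k))) (fun z => wp (k + k) v z * Ex p S (fun w => ind (cs w v = s /\ conn w v z)))
  <= (psi p v s - psi p v (Datatypes.S s)) * exp (- (INR k / INR m * ln (INR s))).
Proof.
  intros Hhk Hs Hkm Hm Hsm HS. set (B := nodup eqdec (ball v (k + k))).
  assert (Hs0 : 0 < INR s) by (apply lt_0_INR; lia).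
  apply Rle_trans with (Ex p S (fun w => ind (cs w v = s) * sum (klist w v) (fun z => wp (k + k) v z))).
  - rewrite (sum_ext B _ (fun z => Ex p S (fun w => wp (k + k) v z * ind (cs w v = s /\ conn w v z))))
      by (intros; symmetry; apply Ex_scal).
    rewrite <- Ex_sum. apply Ex_le; auto. intros w Hw _.
    destruct (Nat.eq_dec (cs w v) s) as [Hc|Hc].
    + rewrite ind_true, Rmult_1_l by exact Hc.
      assert (HK' : enum w v (klist w v)) by (apply cs_pos_enum; lia). destruct HK' as [H1 H2].
      apply Rle_trans with (sum (filter (fun z => dec (conn w v z)) B) (fun z => wp (k + k) v z)).
      * rewrite sum_filter. apply sum_le. intros z _. rewrite Rmult_comm.
        apply Rmult_le_compat_r; [apply (wp_nonneg nb d Hd Hd0)|]. apply ind_le. rewrite dec_true; tauto.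
      * apply sum_incl; [apply NoDup_filter, NoDup_nodup| |intros; apply (wp_nonneg nb d Hd Hd0)].
        intros z Hz. apply filter_In in Hz. rewrite dec_true in Hz. apply H2; tauto.
    + rewrite ind_false, Rmult_0_l by exact Hc. apply Req_le, sum_0. intros z _.
      rewrite ind_false by tauto. lra.
  - rewrite walk_return_mtp by assumption.
    rewrite (psi_minus nb nb_sym p v s S Hp).
    + rewrite Rmult_comm, <- Ex_scal. apply Ex_le; auto. intros w Hw _.
      destruct (Nat.eq_dec (cs w v) s) as [Hc|Hc].
      * rewrite ind_true, Rmult_1_l, Rmult_1_r by exact Hc.
        assert (HK' : enum w v (klist w v)) by (apply cs_pos_enum; lia). destruct HK' as [H1 H2].
        assert (Hkd := kernel_decay nb nb_nodup nb_sym d Hd Hd0 gamma c (klist w v) k m Hhk H1).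
        fold (cs w v) in Hkd. rewrite Hc in Hkd.
        apply Rmult_le_reg_l with (INR s); [exact Hs0|]. rewrite <- Rmult_assoc, Rinv_r, Rmult_1_l by lra.
        apply Hkd; auto. intros E. unfold cs in Hc. rewrite E in Hc. simpl in Hc; lia.
      * rewrite ind_false by exact Hc. lra.
    + intros x Hx. apply HS, (ball_le nb v (Datatypes.S s)); [lia|auto].
Qed.

Definition separated (n : nat) (x z : V) (w : config) : Prop :=
  (n <= cs w x)%nat /\ (n <= cs w z)%nat /\ ~ conn w x z.

(** After [xy] is opened, either [y] is still cut off from [z] and has inherited the large cluster
    of [x], or [y] was already in the large cluster of [z] and [xy] is a closed edge between two
    large clusters. *)
Lemma separated_step n x y z w S : valid w -> supp S w -> adj x y -> In x S -> In y S ->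
  separated n x z w ->
  (w x y = false /\ separated n x y w) \/ separated n y z (upd w x y true).
Proof.
  intros Hw Hs Hxy Hx Hy [H1 [H2 H3]].
  set (w1 := upd w x y true).
  assert (Hle : cfg_le w w1) by apply cfg_le_open.
  assert (Hs1 : supp S w1) by (apply supp_upd; auto).
  assert (Hw1 : valid w1) by (apply (valid_upd nb); auto).
  assert (Hxy1 : conn w1 x y) by (apply conn_edge, upd_same; left; auto).
  assert (Hmono : forall u, (cs w u <= cs w1 u)%nat).
  { intros u. apply (cs_ge S w1 u _ Hs1), (cluster_ge_mono w); auto. apply (cs_ge S w u _ Hs). lia. }
  destruct (classic (conn w1 y z)) as [Hyz|Hyz].
  - left. assert (Hxz : conn w1 x z) by (apply conn_trans with y; auto).
    apply (conn_open_split nb) in Hxz; auto.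
    assert (Hyz' : conn w y z /\ ~ conn w x y).
    { destruct Hxz as [H|[[_ H]|[Ha Hb]]]; [tauto| |].
      - split; auto. intros Hc. apply H3. apply conn_trans with y; auto.
      - exfalso; apply H3. exact Hb. }
    destruct Hyz' as [Hyz' Hnc]. split.
    + destruct (w x y) eqn:E; auto. exfalso. apply Hnc, conn_edge, E.
    + split; [exact H1|]. split; [|exact Hnc]. rewrite (cs_conn nb w y z Hw Hyz'). exact H2.
  - right. split; [|split; [|exact Hyz]].
    + rewrite <- (cs_conn nb w1 x y Hw1 Hxy1). specialize (Hmono x). lia.
    + specialize (Hmono z). lia.
Qed.

(** A path from [z] to [x] is opened edge by edge. Each opening costs a factor [1/p] by finite
    energy, and each step may fail through the event of probability at most [eta]; when the
    endpoints coincide, separation is impossible. *)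
Lemma path_separated n x eta S k : 0 < p -> 0 <= eta ->
  incl (ball x k) S ->
  (forall a b, adj a b -> In a (ball x k) ->
    Ex p S (fun w => ind (w a b = false /\ separated n a b w)) <= eta) ->
  forall i z, (i <= k)%nat -> In z (ball x i) ->
  Ex p S (fun w => ind (separated n z x w)) <= INR i * / p ^ i * eta.
Proof.
  intros Hp0 Heta HS Hedge. induction i as [|i IH]; intros z Hi Hz.
  - destruct Hz as [<-|[]]. simpl. rewrite !Rmult_0_l. apply (Ex_le_cst nb nb_sym); auto. intros w _ _.
    rewrite ind_false; [lra|]. intros [_ [_ H]]. apply H, conn_refl.
  - assert (Hpi : 0 < / p ^ i) by (apply Rinv_0_lt_compat, pow_lt; exact Hp0).
    assert (Hip : 1 <= / p) by (rewrite <- Rinv_1; apply Rinv_le_contravar; lra).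
    assert (Hpow1 : 1 <= / p ^ Datatypes.S i).
    { rewrite <- Rinv_1. apply Rinv_le_contravar; [apply pow_lt; exact Hp0|].
      rewrite <- (pow1 (Datatypes.S i)). apply pow_incr; lra. }
    rewrite S_INR. pose proof (pos_INR i) as Hi0.
    apply ball_S_inv in Hz. destruct Hz as [Hz|[y [Hy Hyz]]].
    + eapply Rle_trans; [apply IH; [lia|exact Hz]|].
      apply Rmult_le_compat_r; [exact Heta|]. apply Rmult_le_compat; try lra.
      simpl. rewrite Rinv_mult. nra.
    + assert (HyS : In y S) by (apply HS, (ball_le nb x i); [lia|exact Hy]).
      assert (HzS : In z S).
      { apply HS, (ball_le nb x (Datatypes.S i)); [lia|]. apply (ball_step nb x i y); auto. }
      assert (Hzy : adj z y) by (apply nb_sym; exact Hyz).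
      apply Rle_trans with (Ex p S (fun w => ind (w z y = false /\ separated n z y w))
        + Ex p S (fun w => ind (separated n y x (upd w z y true)))).
      * rewrite <- Ex_plus. apply Ex_le; auto. intros w Hw Hs.
        pose proof (ind_bound (w z y = false /\ separated n z y w)).
        pose proof (ind_bound (separated n y x (upd w z y true))).
        destruct (classic (separated n z x w)) as [H1|H1]; [|rewrite (ind_false _ H1); lra].
        rewrite (ind_true _ H1). destruct (separated_step n z y x w S Hw Hs Hzy HzS HyS H1) as [H2|H2];
          rewrite (ind_true _ H2); lra.
      * assert (E1 : Ex p S (fun w => ind (w z y = false /\ separated n z y w)) <= eta).
        { apply Hedge; auto. apply (ball_le nb x (Datatypes.S i)); [lia|]. apply (ball_step nb x i y); auto. }
        assert (E2 : p * Ex p S (fun w => ind (separated n y x (upd w z y true))) <= INR i * / p ^ i * eta).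
        { eapply Rle_trans; [|apply (IH y); [lia|exact Hy]].
          apply (Ex_energy nb nb_sym p S (fun w => ind (separated n y x w)) z y); auto. intros; apply ind_bound. }
        set (E := Ex p S (fun w => ind (separated n y x (upd w z y true)))) in *.
        assert (E3 : E <= / p * (INR i * / p ^ i * eta)).
        { apply Rmult_le_reg_l with p; [exact Hp0|]. rewrite <- Rmult_assoc, Rinv_r, Rmult_1_l by lra. exact E2. }
        replace ((INR i + 1) * / p ^ Datatypes.S i * eta) with (/ p * (INR i * / p ^ i * eta) + / p ^ Datatypes.S i * eta)
          by (simpl; field; split; [apply pow_nonzero; lra|lra]).
        assert (eta <= / p ^ Datatypes.S i * eta) by nra. lra.
Qed.

(** The inequality is proved for every endpoint [z] within distance [2k] and then averaged over the
    law of the walk: only the connected case uses the average, through [walk_return]. All clusters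
    above [4^J] are charged to the tail beyond [4^J], which vanishes later as [J] grows. *)
Lemma self_bound gamma c v j J k (m : nat -> nat) : HK nb gamma c -> 0 < p -> (j < J)%nat ->
  (forall s, (4 ^ j <= s)%nat -> (k <= m s)%nat /\ (1 <= m s)%nat /\
    2 * ln (INR s) <= c * Rpower (INR (m s + m s)) gamma) ->
  psi p v (4 ^ j) * psi p v (4 ^ j) <=
  sum (seq (4 ^ j) (4 ^ J + 1 - 4 ^ j)) (fun s =>
    (psi p v s - psi p v (S s)) * exp (- (INR k / INR (m s) * ln (INR s))))
  + psi p v (S (4 ^ J))
  + INR (k + k) * / p ^ (k + k) * (2 * (INR d + 1) / (2 ^ j * p) + 2 * psi p v (S (4 ^ J))).
Proof.
  intros Hhk Hp0 HjJ Hm. set (n := (4 ^ j)%nat) in *. set (N := (4 ^ J)%nat).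
  assert (Hn : (1 <= n)%nat) by (unfold n; pose proof (Nat.pow_nonzero 4 j); lia).
  assert (HnN : (n <= N)%nat) by (apply Nat.pow_le_mono_r; lia).
  (* Room for the two-ghost inequality, which needs radius [3N + 4], around every vertex within [2k]
     of [v]. *)
  set (S := ball v (k + k + (3 * N + 10))).
  set (B := nodup eqdec (ball v (k + k))).
  assert (HBS : forall z r, In z (ball v (k + k)) -> (r <= 3 * N + 10)%nat -> incl (ball z r) S).
  { intros z r Hz Hr x Hx. unfold S. apply (ball_le nb v (k + k + r)); [lia|].
    apply (ball_trans nb v (k + k) r z); auto. }
  assert (Hv : In v (ball v (k + k))) by apply ball_self.
  assert (Hpsi0 := psi_bound nb nb_sym p v (Datatypes.S N) Hp).
  set (eta := 2 * (INR d + 1) / (2 ^ j * p) + 2 * psi p v (Datatypes.S N)).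
  assert (H2j : 0 < 2 ^ j) by (apply pow_lt; lra).
  assert (Heta : 0 <= eta).
  { unfold eta. apply Rplus_le_le_0_compat; [|lra]. apply Rmult_le_pos; [pose proof (pos_INR d); lra|].
    left; apply Rinv_0_lt_compat, Rmult_lt_0_compat; assumption. }
  assert (Hedge : forall a b, adj a b -> In a (ball v (k + k)) ->
    Ex p S (fun w => ind (w a b = false /\ separated n a b w)) <= eta).
  { intros a b Hab Ha.
    assert (HbS : incl (ball b (Datatypes.S N)) S).
    { intros x Hx. apply (HBS a (1 + Datatypes.S N)%nat Ha ltac:(lia)).
      apply (ball_trans nb a 1 (Datatypes.S N) b); auto. apply (ball_step nb a 0 a); [left; reflexivity|exact Hab]. }
    pose proof (two_ghost nb nb_nodup nb_sym nb_irrefl Htrans Hunim d ltac:(intros x; rewrite Hd; lia)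
      p j J S a b Hp HjJ Hab (HBS a (3 * N + 4)%nat Ha ltac:(lia))) as Htg. fold n N in Htg.
    rewrite (psi_aut nb nb_sym p v a) in Hpsi0 by assumption.
    apply Rle_trans with (Ex p S (fun w => ind (w a b = false /\ apart n N a b w))
      + (Ex p S (fun w => ind (cluster_ge w a (Datatypes.S N))) + Ex p S (fun w => ind (cluster_ge w b (Datatypes.S N))))).
    - rewrite <- !Ex_plus. apply Ex_le; auto. intros w Hw Hs.
      pose proof (ind_bound (w a b = false /\ apart n N a b w)).
      pose proof (ind_bound (cluster_ge w a (Datatypes.S N))).
      pose proof (ind_bound (cluster_ge w b (Datatypes.S N))).
      destruct (classic (w a b = false /\ separated n a b w)) as [H2|H2]; [|rewrite (ind_false _ H2); lra].
      rewrite (ind_true _ H2). destruct H2 as [H2 [H3 [H4 H5]]].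
      destruct (le_lt_dec (cs w a) N) as [Ha1|Ha1].
      + destruct (le_lt_dec (cs w b) N) as [Hb1|Hb1].
        * rewrite (ind_true (w a b = false /\ apart n N a b w)); [lra|]. unfold apart; tauto.
        * rewrite (ind_true (cluster_ge w b _)); [lra|]. apply (cs_ge S w b _ Hs). lia.
      + rewrite (ind_true (cluster_ge w a _)); [lra|]. apply (cs_ge S w a _ Hs). lia.
    - rewrite <- (psi_Ex nb nb_sym p a (Datatypes.S N) S Hp) by (apply HBS; [exact Ha|lia]).
      rewrite <- (psi_Ex nb nb_sym p b (Datatypes.S N) S Hp HbS).
      rewrite (psi_aut nb nb_sym p a v), (psi_aut nb nb_sym p b v) by assumption.
      unfold eta. apply Rplus_le_compat; [|lra].
      apply Rmult_le_reg_l with p; [exact Hp0|]. eapply Rle_trans; [exact Htg|]. right. field. lra. }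
  assert (Hpath : forall z, In z (ball v (k + k)) ->
    Ex p S (fun w => ind (separated n z v w)) <= INR (k + k) * / p ^ (k + k) * eta).
  { intros z Hz. apply (path_separated n v eta S (k + k)); auto. unfold S. apply ball_le; lia. }
  assert (HB : forall z, In z B -> In z (ball v (k + k))) by (intros z Hz; apply nodup_In in Hz; exact Hz).
  assert (Hwp0 := wp_nonneg nb d Hd Hd0 (k + k) v).
  assert (Hmass : sum B (wp (k + k) v) = 1).
  { apply (wp_mass nb d Hd Hd0); [apply NoDup_nodup|]. intros x Hx. apply nodup_In; exact Hx. }
  set (l := seq n (N + 1 - n)).
  set (P2 := psi p v n * psi p v n).
  set (err := INR (k + k) * / p ^ (k + k) * eta) in *.
  (* By Harris and transitivity the square is at most the probability that both clusters are large;
     then they coincide with a size in [[n, N]], or the size exceeds [N], or they are separated. *)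
  assert (Hz : forall z, In z B -> P2 <= sum l (fun s => Ex p S (fun w => ind (cs w v = s /\ conn w v z)))
    + (psi p v (Datatypes.S N) + err)).
  { intros z Hz. apply HB in Hz. unfold P2. rewrite (psi_aut nb nb_sym p v z) at 2 by assumption.
    rewrite (psi_Ex nb nb_sym p v n S Hp) by (apply HBS; [exact Hv|lia]).
    rewrite (psi_Ex nb nb_sym p z n S Hp) by (apply HBS; [exact Hz|lia]).
    eapply Rle_trans; [apply Harris; auto; apply mono_cluster_ge|].
    apply Rle_trans with (sum l (fun s => Ex p S (fun w => ind (cs w v = s /\ conn w v z)))
      + (psi p v (Datatypes.S N) + Ex p S (fun w => ind (separated n z v w)))).
    2:{ pose proof (Hpath z Hz). lra. }
    rewrite (psi_Ex nb nb_sym p v (Datatypes.S N) S Hp) by (apply HBS; [exact Hv|lia]).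
    rewrite <- Ex_sum, <- !Ex_plus. apply Ex_le; auto. intros w Hw Hs.
    rewrite <- ind_and. pose proof (ind_bound (cluster_ge w v (Datatypes.S N))).
    pose proof (ind_bound (separated n z v w)).
    assert (Hsum : 0 <= sum l (fun s => ind (cs w v = s /\ conn w v z))) by (apply sum_nonneg; intros; apply ind_bound).
    destruct (classic (cluster_ge w v n /\ cluster_ge w z n)) as [H2|H2]; [|rewrite (ind_false _ H2); lra].
    rewrite (ind_true _ H2). destruct H2 as [H2 H3].
    apply (cs_ge S w v n Hs) in H2. apply (cs_ge S w z n Hs) in H3.
    destruct (classic (conn w v z)) as [Hc|Hc].
    - destruct (le_lt_dec (cs w v) N) as [Hv1|Hv1].
      + pose proof (sum_ge_term l (fun s => ind (cs w v = s /\ conn w v z)) (cs w v)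
          ltac:(intros; apply ind_bound) ltac:(apply in_seq; lia)) as Hge. simpl in Hge.
        rewrite (ind_true (cs w v = cs w v /\ _)) in Hge by auto. lra.
      + rewrite (ind_true (cluster_ge w v _)); [lra|]. apply (cs_ge S w v _ Hs). lia.
    - rewrite (ind_true (separated n z v w)); [lra|]. split; [exact H3|]. split; [exact H2|].
      intros Hc'. apply Hc, (conn_sym nb); auto. }
  assert (Htot : P2 <= sum B (fun z => wp (k + k) v z * sum l (fun s => Ex p S (fun w => ind (cs w v = s /\ conn w v z))))
    + (psi p v (Datatypes.S N) + err)).
  { rewrite <- (Rmult_1_l P2), <- Hmass, <- sum_scal_r.
    rewrite <- (Rmult_1_l (psi p v (Datatypes.S N) + err)), <- Hmass, <- sum_scal_r, <- sum_plus.
    apply sum_le. intros z Hzz. rewrite <- Rmult_plus_distr_l. apply Rmult_le_compat_l; auto. }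
  eapply Rle_trans; [exact Htot|]. rewrite <- Rplus_assoc. apply Rplus_le_compat_r, Rplus_le_compat_r.
  rewrite (sum_ext B _ (fun z => sum l (fun s => wp (k + k) v z * Ex p S (fun w => ind (cs w v = s /\ conn w v z)))))
    by (intros; symmetry; apply sum_scal).
  rewrite sum_swap. apply sum_le. intros s Hs. apply in_seq in Hs.
  destruct (Hm s ltac:(lia)) as [Hm1 [Hm2 Hm3]].
  apply (walk_return gamma c); auto; [lia|]. apply HBS; [exact Hv|lia].
Qed.

End SelfBound.

(** * The bootstrap *)

Lemma exp_le x y : x <= y -> exp x <= exp y.
Proof. intros [H| ->]; [left; apply exp_increasing; exact H|lra]. Qed.

Lemma Rpower_pos x y : 0 < Rpower x y.
Proof. apply exp_pos. Qed.

Lemma Rpower_base_le x y b : 0 <= b -> 0 < x -> x <= y -> Rpower x b <= Rpower y b.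
Proof. intros. apply Rle_Rpower_l; auto. Qed.

(** The two terms cross where [x^(b' - b) = A / k]: beyond, the difference is nonpositive; before,
    the first term is below its value there. *)
Lemma power_gap A k b b' : 0 < A -> 0 < k -> 0 < b -> b < b' ->
  exists K, forall x, 0 < x -> A * Rpower x b - k * Rpower x b' <= K.
Proof.
  intros HA Hk Hb Hbb. exists (A * Rpower (A / k) (b / (b' - b))). intros x Hx.
  set (t := Rpower x (b' - b)).
  assert (Ht : Rpower x b' = Rpower x b * t).
  { unfold t. rewrite <- Rpower_plus. f_equal; lra. }
  assert (Hxb := Rpower_pos x b). assert (Ht0 : 0 < t) by apply Rpower_pos.
  rewrite Ht. destruct (Rle_lt_dec (A / k) t) as [H|H].
  - assert (HAk : A <= k * t).
    { apply Rmult_le_reg_r with (/ k); [apply Rinv_0_lt_compat; exact Hk|].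
      replace (k * t * / k) with t by (field; lra). exact H. }
    assert (0 < A * Rpower (A / k) (b / (b' - b))) by (apply Rmult_lt_0_compat; [exact HA|apply Rpower_pos]).
    assert (Rpower x b * A <= Rpower x b * (k * t)) by (apply Rmult_le_compat_l; lra). nra.
  - assert (E : Rpower x b = Rpower t (b / (b' - b))).
    { unfold t. rewrite Rpower_mult. f_equal. field. lra. }
    assert (Rpower x b <= Rpower (A / k) (b / (b' - b))).
    { rewrite E. apply Rpower_base_le; [|exact Ht0|lra]. left. apply Rdiv_lt_0_compat; lra. }
    assert (0 < k * (Rpower x b * t)) by (repeat apply Rmult_lt_0_compat; auto). nra.
Qed.

Lemma ln_le_power x b : 0 < x -> 0 < b -> ln x <= / b * Rpower x b.
Proof.
  intros Hx Hb. apply Rmult_le_reg_l with b; [exact Hb|]. rewrite <- Rmult_assoc, Rinv_r, Rmult_1_l by lra.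
  unfold Rpower. pose proof (exp_ineq1_le (b * ln x)). lra.
Qed.

(** The moment weight at size [4^(j+1)], the largest on the layer from [4^j] to [4^(j+1)]. *)
Definition layer (b : R) (j : nat) : R := exp (Rpower (INR (S j) * ln 4) b).

Lemma ln4_gt1 : 1 < ln 4.
Proof.
  rewrite <- (ln_exp 1). apply ln_increasing; [apply exp_pos|]. pose proof exp_le_3. lra.
Qed.

Lemma layer_sum b b' k : 0 < b -> b < b' -> 0 < k ->
  exists C, 0 < C /\ forall J, sum (seq 0 J) (fun j => layer b j * exp (- (k * Rpower (INR (S j)) b'))) <= C.
Proof.
  (* The summand [2 * / b] pays for [2 ln x], which leaves a factor [1 / (x (x + 1))] in each term;
     that factor telescopes. *)
  intros Hb Hbb Hk. set (A := Rpower (ln 4) b + 2 * / b).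
  assert (Hib : 0 < / b) by (apply Rinv_0_lt_compat; exact Hb).
  assert (HA : 0 < A) by (unfold A; pose proof (Rpower_pos (ln 4) b); lra).
  destruct (power_gap A k b b' HA Hk Hb Hbb) as [K HK].
  exists (exp (K + 1)). split; [apply exp_pos|]. intros J.
  assert (Hterm : forall j, layer b j * exp (- (k * Rpower (INR (S j)) b')) <= exp (K + 1) * (/ INR (S j) - / INR (S (S j)))).
  { intros j. set (x := INR (S j)).
    assert (Hx : 1 <= x) by (unfold x; rewrite S_INR; pose proof (pos_INR j); lra).
    replace (INR (S (S j))) with (x + 1) by (unfold x; rewrite (S_INR (S j)); reflexivity).
    replace (/ x - / (x + 1)) with (/ (x * (x + 1))) by (field; lra).
    assert (Hxx : 0 < x * (x + 1)) by nra.
    rewrite <- (exp_ln (x * (x + 1))), <- exp_Ropp by exact Hxx.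
    unfold layer. fold x. rewrite <- !exp_plus. apply exp_le.
    assert (Hl : ln (x * (x + 1)) <= 2 * ln x + 1).
    { apply Rle_trans with (ln (x * (x * 2))); [apply ln_le; nra|].
      rewrite !ln_mult by lra. pose proof ln_lt_2. assert (ln 2 <= 1); [|lra].
      rewrite <- (ln_exp 1). apply ln_le; [lra|]. pose proof (exp_ineq1_le 1). lra. }
    pose proof (ln_le_power x b ltac:(lra) Hb) as Hlx.
    specialize (HK x ltac:(lra)). unfold A in HK.
    assert (Hm : Rpower (x * ln 4) b = Rpower (ln 4) b * Rpower x b).
    { rewrite <- Rpower_mult_distr; [ring|lra|pose proof ln4_gt1; lra]. }
    rewrite Hm. lra. }
  apply Rle_trans with (sum (seq 0 J) (fun j => exp (K + 1) * (/ INR (S j) - / INR (S (S j))))).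
  - apply sum_le; auto.
  - rewrite sum_scal.
    assert (Htel : sum (seq 0 J) (fun j => / INR (S j) - / INR (S (S j))) = 1 - / INR (S J)).
    { induction J as [|J IH]; [unfold sum; simpl; lra|].
      rewrite seq_S, sum_app, IH, sum_cons. unfold sum; simpl (fold_right _ _ _). simpl (0 + J)%nat. lra. }
    rewrite Htel. assert (0 < / INR (S J)) by (apply Rinv_0_lt_compat, lt_0_INR; lia).
    pose proof (exp_pos (K + 1)). nra.
Qed.

Definition moment (psi : nat -> R) (b : R) (N : nat) : R :=
  sum (seq 1 N) (fun n => (psi n - psi (S n)) * f_beta b n).

Lemma sum_telescope (psi : nat -> R) n m : sum (seq n m) (fun s => psi s - psi (S s)) = psi n - psi (n + m)%nat.
Proof.
  revert n; induction m as [|m IH]; intros n.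
  - unfold sum; simpl. rewrite Nat.add_0_r. lra.
  - simpl seq. rewrite sum_cons, IH. replace (S n + m)%nat with (n + S m)%nat by lia. lra.
Qed.

Lemma f_beta_val b n : (2 <= n)%nat -> f_beta b n = exp (Rpower (ln (INR n)) b).
Proof.
  intros Hn. unfold f_beta, rpow. destruct (Req_EM_T (ln (INR n)) 0) as [E|E]; [|reflexivity].
  exfalso. assert (0 < ln (INR n)); [|lra]. rewrite <- ln_1. apply ln_increasing; [lra|].
  apply lt_1_INR; lia.
Qed.

Lemma f_beta_layer b n j : 0 < b -> (1 <= n)%nat -> (n <= 4 ^ S j)%nat -> f_beta b n <= layer b j.
Proof.
  intros Hb Hn Hj. destruct (Nat.eq_dec n 1) as [->|Hn1].
  - unfold f_beta, layer, rpow. rewrite INR_1, ln_1. destruct (Req_EM_T 0 0); [|lra].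
    destruct (Req_EM_T b 0); [lra|]. apply exp_le. left; apply Rpower_pos.
  - rewrite f_beta_val by lia. apply exp_le, Rpower_base_le; [lra| |].
    + rewrite <- ln_1. apply ln_increasing; [lra|]. apply lt_1_INR; lia.
    + apply Rle_trans with (ln (4 ^ S j)).
      * apply ln_le; [apply lt_0_INR; lia|]. rewrite <- INR_pow4. apply le_INR; exact Hj.
      * rewrite ln_pow by lra. lra.
Qed.

Section Tail.
Context (psi : nat -> R).
Context (Hpsi : forall n, 0 <= psi n <= 1) (Hanti : forall n, psi (S n) <= psi n).

Lemma moment_layers b J : 0 < b ->
  moment psi b (4 ^ J - 1) <= sum (seq 0 J) (fun j => layer b j * psi (4 ^ j)%nat).
Proof.
  intros Hb. unfold moment. induction J as [|J IH]; [unfold sum; simpl; lra|].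
  assert (H4 : (1 <= 4 ^ J)%nat) by (pose proof (Nat.pow_nonzero 4 J); lia).
  replace (4 ^ S J - 1)%nat with ((4 ^ J - 1) + 3 * 4 ^ J)%nat by (simpl; lia).
  rewrite seq_app, sum_app, seq_S, sum_app. apply Rplus_le_compat; [exact IH|].
  rewrite sum_cons. simpl (0 + J)%nat. replace (1 + (4 ^ J - 1))%nat with (4 ^ J)%nat by lia.
  apply Rle_trans with (sum (seq (4 ^ J) (3 * 4 ^ J)) (fun n => layer b J * (psi n - psi (S n)))).
  - apply sum_le. intros n Hn. apply in_seq in Hn. rewrite Rmult_comm. apply Rmult_le_compat_r.
    + pose proof (Hanti n); lra.
    + apply f_beta_layer; auto; simpl; lia.
  - rewrite sum_scal, sum_telescope. unfold sum; simpl (fold_right _ _ _). rewrite Rplus_0_r.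
    apply Rmult_le_compat_l; [left; apply exp_pos|]. pose proof (Hpsi (4 ^ J + 3 * 4 ^ J)%nat). lra.
Qed.

Lemma moment_term b n : 0 <= (psi n - psi (S n)) * f_beta b n.
Proof. apply Rmult_le_pos; [pose proof (Hanti n); lra|left; apply exp_pos]. Qed.

Lemma moment_le b N N' : (N <= N')%nat -> moment psi b N <= moment psi b N'.
Proof.
  intros H. unfold moment. replace N' with (N + (N' - N))%nat by lia. rewrite seq_app, sum_app.
  assert (0 <= sum (seq (1 + N) (N' - N)) (fun n => (psi n - psi (S n)) * f_beta b n)); [|lra].
  apply sum_nonneg; intros; apply moment_term.
Qed.

Lemma moment_bound b C : 0 < b -> (forall J, sum (seq 0 J) (fun j => layer b j * psi (4 ^ j)%nat) <= C) ->
  forall N, moment psi b N <= C.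
Proof.
  intros Hb H N. eapply Rle_trans; [|apply (H N)]. eapply Rle_trans; [|apply moment_layers; exact Hb].
  apply moment_le. pose proof (Nat.pow_gt_lin_r 4 N ltac:(lia)). lia.
Qed.

End Tail.

(** A tail [X / n] is exponential in the layer index, with exponent [1 > b]. For [b < 1] this gives
    the a priori finiteness of the moment. *)
Lemma linear_tail_moment b : 0 < b < 1 -> exists C, 0 < C /\
  forall (psi : nat -> R) X, (forall n, 0 <= psi n <= 1) -> (forall n, psi (S n) <= psi n) ->
    (forall n, INR n * psi n <= X) -> forall N, moment psi b N <= X * C.
Proof.
  intros Hb. destruct (layer_sum b 1 (ln 4)) as [C [HC0 HC]]; [lra|lra|pose proof ln4_gt1; lra|].
  exists (4 * C). split; [lra|]. intros psi X H1 H2 H3 N.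
  assert (HX : 0 <= X) by (pose proof (H3 0%nat); simpl in H; lra).
  apply (moment_bound psi H1 H2 b); [lra|]. intros J.
  apply Rle_trans with (sum (seq 0 J) (fun j => (X * 4) * (layer b j * exp (- (ln 4 * Rpower (INR (S j)) 1))))).
  - apply sum_le. intros j _.
    assert (Hlay : 0 < layer b j) by apply exp_pos.
    replace (X * 4 * (layer b j * exp (- (ln 4 * Rpower (INR (S j)) 1)))) with
      (layer b j * (X * 4 * exp (- (ln 4 * Rpower (INR (S j)) 1)))) by ring.
    apply Rmult_le_compat_l; [lra|]. rewrite Rpower_1 by (apply lt_0_INR; lia).
    replace (ln 4 * INR (S j)) with (ln (4 ^ S j)) by (rewrite ln_pow by lra; ring).
    rewrite exp_Ropp, exp_ln by (apply pow_lt; lra).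
    specialize (H3 (4 ^ j)%nat). rewrite INR_pow4 in H3.
    assert (0 < 4 ^ j) by (apply pow_lt; lra).
    apply Rmult_le_reg_l with (4 ^ j); [assumption|]. simpl.
    replace (4 ^ j * (X * 4 * / (4 * 4 ^ j))) with X by (field; lra). exact H3.
  - rewrite sum_scal. replace (X * (4 * C)) with (X * 4 * C) by ring.
    apply Rmult_le_compat_l; [lra|apply HC].
Qed.

(** As [L] varies the two terms balance at [L^(a+b) = k]. Below this value the first alone is large
    enough, above it the second. *)
Lemma weight_tradeoff a b k1 k L : 0 <= a -> 0 < b -> 0 < k1 <= 1 -> 1 <= k -> 0 < L ->
  k1 * Rpower k (b / (a + b)) <= k1 * k * Rpower L (- a) + Rpower L b.
Proof.
  intros Ha Hb Hk1 Hk HL. assert (Hab : 0 < a + b) by lra.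
  set (t := Rpower L (a + b)). assert (Ht : 0 < t) by apply Rpower_pos.
  assert (HLb : Rpower L b = Rpower t (b / (a + b))).
  { unfold t. rewrite Rpower_mult. f_equal. field. lra. }
  assert (HLa : Rpower L (- a) = Rpower t (- (a / (a + b)))).
  { unfold t. rewrite Rpower_mult. f_equal. field. lra. }
  assert (Hb' : 0 <= b / (a + b)) by (left; apply Rdiv_lt_0_compat; lra).
  assert (Ha' : 0 <= a / (a + b)) by (apply Rmult_le_pos; [lra|left; apply Rinv_0_lt_compat; lra]).
  pose proof (Rpower_pos L b). pose proof (Rpower_pos L (- a)). pose proof (Rpower_pos k (b / (a + b))).
  destruct (Rle_lt_dec t k) as [H2|H2].
  - assert (Hk' : k * Rpower k (- (a / (a + b))) = Rpower k (b / (a + b))).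
    { rewrite <- (Rpower_1 k) at 1 by lra. rewrite <- Rpower_plus. f_equal. field. lra. }
    assert (Rpower k (- (a / (a + b))) <= Rpower L (- a)).
    { rewrite HLa, !Rpower_Ropp. apply Rinv_le_contravar; [apply Rpower_pos|].
      apply Rpower_base_le; auto. }
    rewrite <- Hk'. rewrite Rmult_assoc.
    assert (k1 * (k * Rpower k (- (a / (a + b)))) <= k1 * (k * Rpower L (- a))).
    { apply Rmult_le_compat_l; [lra|]. apply Rmult_le_compat_l; lra. }
    lra.
  - assert (Rpower k (b / (a + b)) <= Rpower L b).
    { rewrite HLb. apply Rpower_base_le; lra. }
    assert (0 < k1 * k * Rpower L (- a)) by (repeat apply Rmult_lt_0_compat; lra).
    nra.
Qed.

(** [C] and [dl] are fixed before [psi]: the numbers [X] and [E] may be arbitrarily large, since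
    they serve only to make the moment finite and the cutoff term vanish. The tail bound [dl] is
    kept because it excludes infinite clusters in the limit at [p_c]. *)
Lemma bootstrap a b k1 C1 Q : 0 <= a -> 0 < b -> a + b < 1 -> 0 < k1 <= 1 -> 0 <= C1 -> (1 <= Q)%nat ->
  exists C (dl : nat -> R), (forall eps, 0 < eps -> exists j, dl j < eps) /\
  forall psi : nat -> R, (forall n, 0 <= psi n <= 1) -> (forall n, psi (S n) <= psi n) ->
    (exists X, forall n, INR n * psi n <= X) ->
    (forall j, (1 <= j)%nat -> exists E, forall J, (j < J)%nat ->
      psi (4 ^ j)%nat * psi (4 ^ j)%nat <=
      sum (seq (4 ^ j) (4 ^ J + 1 - 4 ^ j)) (fun s => (psi s - psi (S s)) *
        exp (- (k1 * INR (j / (8 * Q)) * Rpower (ln (INR s)) (- a))))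
      + C1 * exp (- INR (j / (8 * Q))) + psi (S (4 ^ J)) * E) ->
    (forall N, moment psi b N <= C) /\ (forall j, psi (4 ^ j)%nat <= dl j).
Proof.
  intros Ha Hb Hab Hk1 HC1 HQ.
  (* [16 * Q] converts between [j] and [k = j / (8 * Q)]: when [k >= 1], the integer part costs at
     most a factor [2], so [j + 1 <= 16 * Q * k]. *)
  set (b' := b / (a + b)). set (x0 := INR (16 * Q)).
  assert (Hb'1 : b' <= 1).
  { unfold b'. apply Rmult_le_reg_r with (a + b); [lra|]. unfold Rdiv. rewrite Rmult_assoc, Rinv_l; lra. }
  assert (Hbb' : b < b').
  { unfold b'. apply Rmult_lt_reg_r with (a + b); [lra|]. unfold Rdiv. rewrite Rmult_assoc, Rinv_l; nra. }
  assert (Hx0 : 1 <= x0) by (unfold x0; apply (le_INR 1); lia).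
  (* The factor [1/2] comes from taking the square root of the bound on [psi^2]. *)
  set (k3 := k1 / 2 * / Rpower x0 b').
  assert (Hk3 : 0 < k3).
  { unfold k3. apply Rmult_lt_0_compat; [lra|]. apply Rinv_0_lt_compat, Rpower_pos. }
  destruct (layer_sum b b' k3 Hb Hbb' Hk3) as [Cs [HCs0 HCs]].
  (* With [g = sqrt(F + C1 + 1)], the final inequality [g^2 <= B g + C1 + 1] and
     [2 B g <= B^2 + g^2] give [g^2 <= G]. The factor [exp 1] covers the small [j], where only
     [psi <= 1] is known. *)
  set (B := exp 1 * Cs). set (G := B * B + 2 * (C1 + 1)).
  exists (B * sqrt G), (fun j => exp 1 * sqrt G * exp (- (k3 * Rpower (INR (S j)) b'))). split.
  { intros eps Heps.
    set (A := exp 1 * sqrt G + 1).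
    assert (HA0 : 0 < A) by (unfold A; pose proof (exp_pos 1); pose proof (sqrt_pos G); nra).
    set (y := Rmax 1 ((ln A - ln eps + 1) / k3)).
    assert (Hy1 : 1 <= y) by apply Rmax_l.
    assert (Hy2 : ln A - ln eps + 1 <= k3 * y).
    { apply Rmult_le_reg_r with (/ k3); [apply Rinv_0_lt_compat; exact Hk3|].
      replace (k3 * y * / k3) with y by (field; lra). apply Rmax_r. }
    destruct (INR_unbounded (Rpower y (/ b'))) as [j Hj]. exists j.
    assert (Hyj : y <= Rpower (INR (S j)) b').
    { replace y with (Rpower (Rpower y (/ b')) b') by (rewrite Rpower_mult, Rinv_l, Rpower_1; lra).
      apply Rpower_base_le; [lra|apply Rpower_pos|]. rewrite S_INR. lra. }
    apply Rle_lt_trans with (A * exp (- (ln A - ln eps + 1))).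
    - apply Rmult_le_compat.
      + pose proof (exp_pos 1); pose proof (sqrt_pos G); nra.
      + left; apply exp_pos.
      + unfold A; lra.
      + apply exp_le. nra.
    - replace (- (ln A - ln eps + 1)) with (- ln A + (ln eps + - (1))) by ring.
      rewrite !exp_plus, exp_Ropp, !exp_ln by assumption.
      replace (A * (/ A * (eps * exp (- (1))))) with (eps * exp (- (1))) by (field; lra).
      assert (exp (- (1)) < 1) by (rewrite <- exp_0 at 2; apply exp_increasing; lra). nra. }
  intros psi Hpsi Hanti [X HX] Hself.
  destruct (linear_tail_moment b ltac:(lra)) as [Cl [HCl0 HCl]].
  assert (Hap : forall N, moment psi b N <= X * Cl) by (apply HCl; assumption).
  destruct (completeness (fun t => exists N, t = moment psi b N)) as [F [HF1 HF2]].
  { exists (X * Cl). intros t [N ->]. apply Hap. }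
  { exists (moment psi b 0), 0%nat. reflexivity. }
  assert (HF : forall N, moment psi b N <= F) by (intros N; apply HF1; exists N; reflexivity).
  assert (HF0 : 0 <= F).
  { apply Rle_trans with (moment psi b 0); [unfold moment, sum; simpl; lra|apply HF]. }
  (* The trade-off bounds [exp(- k1 k L^(-a))] by [exp(- k1 k^b') exp(L^b)] with [L = ln s], so the
     sum over sizes becomes a piece of the moment. *)
  assert (Hsq : forall j, (1 <= j / (8 * Q))%nat ->
    psi (4 ^ j)%nat * psi (4 ^ j)%nat <= (F + C1) * exp (- (k1 * Rpower (INR (j / (8 * Q))) b'))).
  { intros j Hkj. set (k := INR (j / (8 * Q))) in *.
    assert (Hk : 1 <= k) by (unfold k; apply (le_INR 1); exact Hkj).
    assert (Hj1 : (1 <= j)%nat).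
    { destruct j; [|lia]. rewrite Nat.Div0.div_0_l in Hkj. lia. }
    destruct (Hself j Hj1) as [E HE].
    set (w := exp (- (k1 * Rpower k b'))).
    assert (Hw0 : 0 < w) by apply exp_pos.
    assert (Hsum : forall J, (j < J)%nat -> sum (seq (4 ^ j) (4 ^ J + 1 - 4 ^ j)) (fun s => (psi s - psi (S s)) *
        exp (- (k1 * k * Rpower (ln (INR s)) (- a)))) <= F * w).
    { intros J HJ. apply Rle_trans with (sum (seq (4 ^ j) (4 ^ J + 1 - 4 ^ j)) (fun s => w * ((psi s - psi (S s)) * f_beta b s))).
      - apply sum_le. intros s Hs. apply in_seq in Hs.
        assert (H4j : (4 <= 4 ^ j)%nat) by (apply (Nat.pow_le_mono_r 4 1 j); lia).
        rewrite f_beta_val by lia.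
        replace (w * ((psi s - psi (S s)) * exp (Rpower (ln (INR s)) b)))
          with ((psi s - psi (S s)) * (w * exp (Rpower (ln (INR s)) b))) by ring.
        apply Rmult_le_compat_l; [pose proof (Hanti s); lra|]. unfold w. rewrite <- exp_plus. apply exp_le.
        assert (HL : 0 < ln (INR s)).
        { rewrite <- ln_1. apply ln_increasing; [lra|]. apply lt_1_INR; lia. }
        pose proof (weight_tradeoff a b k1 k (ln (INR s)) Ha Hb Hk1 Hk HL). fold b' in H. lra.
      - rewrite sum_scal, Rmult_comm. apply Rmult_le_compat_r; [lra|].
        apply Rle_trans with (moment psi b (4 ^ J)); [|apply HF]. unfold moment.
        apply sum_incl; [apply seq_NoDup| |intros; apply moment_term; assumption].
        intros s Hs. apply in_seq in Hs. apply in_seq. pose proof (Nat.pow_nonzero 4 j). lia. }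
    (* Here [J] tends to infinity: [E] is fixed and the tail at [4^J] is at most [X / 4^J]. *)
    assert (Hlim : forall eps, 0 < eps -> psi (4 ^ j)%nat * psi (4 ^ j)%nat <= F * w + C1 * exp (- k) + eps).
    { intros eps Heps.
      assert (HX0 : 0 <= X) by (pose proof (HX 0%nat); simpl in H; lra).
      destruct (INR_unbounded (X * Rabs E / eps)) as [J1 HJ1].
      set (J := (J1 + j + 1)%nat). specialize (HE J ltac:(unfold J; lia)). specialize (Hsum J ltac:(unfold J; lia)).
      assert (Herr : psi (S (4 ^ J)) * E <= eps).
      { apply Rle_trans with (psi (S (4 ^ J)) * Rabs E).
        { apply Rmult_le_compat_l; [apply Hpsi|apply Rle_abs]. }
        pose proof (HX (S (4 ^ J))) as HXJ.
        assert (HJN : INR J1 <= INR (S (4 ^ J))).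
        { apply le_INR. pose proof (Nat.pow_gt_lin_r 4 J ltac:(lia)). unfold J in *. lia. }
        assert (HN0 : 0 < INR (S (4 ^ J))) by (apply lt_0_INR; lia).
        apply Rmult_le_reg_l with (INR (S (4 ^ J))); [exact HN0|].
        apply Rle_trans with (X * Rabs E).
        - rewrite <- Rmult_assoc. apply Rmult_le_compat_r; [apply Rabs_pos|exact HXJ].
        - apply Rmult_le_reg_r with (/ eps); [apply Rinv_0_lt_compat; exact Heps|].
          replace (INR (S (4 ^ J)) * eps * / eps) with (INR (S (4 ^ J))) by (field; lra).
          unfold Rdiv in HJ1. lra. }
      fold k in HE. lra. }
    assert (Hmain : psi (4 ^ j)%nat * psi (4 ^ j)%nat <= F * w + C1 * exp (- k)).
    { apply Rnot_lt_le; intros Hlt.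
      pose proof (Hlim ((psi (4 ^ j)%nat * psi (4 ^ j)%nat - (F * w + C1 * exp (- k))) / 2) ltac:(lra)). lra. }
    assert (Hek : exp (- k) <= w).
    { unfold w. apply exp_le. assert (Rpower k b' <= k).
      { rewrite <- (Rpower_1 k) at 2 by lra. apply Rle_Rpower; lra. }
      pose proof (Rpower_pos k b'). nra. }
    nra. }
  assert (Htail : forall j, psi (4 ^ j)%nat <= exp 1 * sqrt (F + C1 + 1) * exp (- (k3 * Rpower (INR (S j)) b'))).
  { intros j. set (g := sqrt (F + C1 + 1)).
    assert (Hg1 : 1 <= g) by (apply Rle_trans with (sqrt 1); [rewrite sqrt_1; lra|apply sqrt_le_1; lra]).
    assert (Hx0b := Rpower_pos x0 b').
    assert (He1 : 1 <= exp 1) by (pose proof (exp_ineq1_le 1); lra).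
    assert (HSj : INR (S j) <= x0 \/ (1 <= j / (8 * Q))%nat /\ INR (S j) <= x0 * INR (j / (8 * Q))).
    { destruct (Nat.eq_dec (j / (8 * Q)) 0) as [E|E].
      - left. apply le_INR. apply Nat.div_small_iff in E; lia.
      - right. split; [lia|]. unfold x0. rewrite <- mult_INR. apply le_INR.
        pose proof (Nat.div_mod_eq j (8 * Q)). pose proof (Nat.mod_upper_bound j (8 * Q)). nia. }
    destruct HSj as [HSj|[Hkj HSj]].
    - apply Rle_trans with (exp 1 * exp (- (k3 * Rpower (INR (S j)) b'))).
      + rewrite <- exp_plus. apply Rle_trans with 1; [apply Hpsi|]. rewrite <- exp_0 at 1. apply exp_le.
        assert (Rpower (INR (S j)) b' <= Rpower x0 b') by (apply Rpower_base_le; [lra|apply lt_0_INR; lia|exact HSj]).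
        assert (k3 * Rpower x0 b' = k1 / 2) by (unfold k3; field; lra). nra.
      + apply Rmult_le_compat_r; [left; apply exp_pos|]. nra.
    - specialize (Hsq j Hkj). set (k := INR (j / (8 * Q))) in *.
      assert (Hk0 : 1 <= k) by (unfold k; apply (le_INR 1); exact Hkj).
      set (h := exp (- (k1 / 2 * Rpower k b'))).
      assert (Hh : h * h = exp (- (k1 * Rpower k b'))) by (unfold h; rewrite <- exp_plus; f_equal; field).
      assert (Hh0 : 0 < h) by apply exp_pos.
      assert (Hgg : g * g = F + C1 + 1) by (apply sqrt_sqrt; lra).
      assert (Hp1 : psi (4 ^ j)%nat <= g * h).
      { apply Rsqr_incr_0_var; [|nra]. unfold Rsqr. rewrite <- Hh in Hsq. nra. }
      assert (Hh2 : h <= exp (- (k3 * Rpower (INR (S j)) b'))).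
      { apply exp_le. assert (Rpower (INR (S j)) b' <= Rpower x0 b' * Rpower k b').
        { rewrite Rpower_mult_distr by lra. apply Rpower_base_le; [lra|apply lt_0_INR; lia|exact HSj]. }
        assert (k3 * (Rpower x0 b' * Rpower k b') = k1 / 2 * Rpower k b') by (unfold k3; field; lra). nra. }
      pose proof (exp_pos (- (k3 * Rpower (INR (S j)) b'))).
      apply Rle_trans with (g * exp (- (k3 * Rpower (INR (S j)) b'))); [nra|].
      apply Rmult_le_compat_r; [lra|nra]. }
  assert (Hmom : forall N, moment psi b N <= B * sqrt (F + C1 + 1)).
  { apply moment_bound; auto. intros J.
    apply Rle_trans with (sum (seq 0 J) (fun j => (exp 1 * sqrt (F + C1 + 1)) * (layer b j * exp (- (k3 * Rpower (INR (S j)) b'))))).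
    - apply sum_le. intros j _. specialize (Htail j). assert (0 < layer b j) by apply exp_pos. nra.
    - rewrite sum_scal. unfold B. specialize (HCs J).
      assert (0 <= exp 1 * sqrt (F + C1 + 1)) by (apply Rmult_le_pos; [left; apply exp_pos|apply sqrt_pos]). nra. }
  assert (HFB : F <= B * sqrt (F + C1 + 1)).
  { apply HF2. intros t [N ->]. apply Hmom. }
  assert (HG : F + C1 + 1 <= G).
  { set (g := sqrt (F + C1 + 1)) in *. assert (Hgg : g * g = F + C1 + 1) by (apply sqrt_sqrt; lra).
    unfold G. pose proof (Rle_0_sqr (B - g)) as Hs. unfold Rsqr in Hs. lra. }
  assert (Hs : sqrt (F + C1 + 1) <= sqrt G) by (apply sqrt_le_1; lra).
  split.
  - intros N. eapply Rle_trans; [apply Hmom|]. apply Rmult_le_compat_l; [|exact Hs].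
    unfold B. pose proof (exp_pos 1). nra.
  - intros j. eapply Rle_trans; [apply Htail|]. apply Rmult_le_compat_r; [left; apply exp_pos|].
    apply Rmult_le_compat_l; [left; apply exp_pos|exact Hs].
Qed.

(** * Conclusion *)

Lemma continuity_le_left h p p0 C : continuity_pt h p -> p0 < p ->
  (forall q, p0 < q < p -> h q <= C) -> h p <= C.
Proof.
  intros Hc Hp0 H. apply Rnot_lt_le; intros Hlt.
  destruct (Hc (h p - C)) as [al [Hal Ha]]; [lra|].
  set (q := Rmax ((p0 + p) / 2) (p - al / 2)).
  assert (Hq1 : (p0 + p) / 2 <= q) by apply Rmax_l.
  assert (Hq2 : p - al / 2 <= q) by apply Rmax_r.
  assert (Hq3 : q < p) by (unfold q; apply Rmax_lub_lt; lra).
  specialize (Ha q). simpl in Ha. unfold Rdist in Ha.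
  assert (Hd : Rabs (h q - h p) < h p - C).
  { apply Ha. split; [split; [exact I|lra]|]. rewrite Rabs_left by lra. lra. }
  specialize (H q ltac:(lra)). rewrite Rabs_left in Hd by lra. lra.
Qed.

Lemma continuity_sum {A} (l : list A) (f : A -> R -> R) p :
  (forall x, In x l -> continuity_pt (f x) p) -> continuity_pt (fun q => sum l (fun x => f x q)) p.
Proof.
  induction l as [|x l IH]; intros H.
  - apply continuity_pt_const. intros y z; reflexivity.
  - apply (continuity_pt_plus (f x) (fun q => sum l (fun x => f x q))).
    + apply H; left; reflexivity.
    + apply IH; intros; apply H; right; assumption.
Qed.

Lemma moment_continuous {V} (nb : V -> list V) (nb_sym : forall v w, In w (nb v) -> In v (nb w)) v b N p :
  continuity_pt (fun q => moment (psi nb q v) b N) p.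
Proof.
  apply (continuity_sum (seq 1 N) (fun n q => (psi nb q v n - psi nb q v (S n)) * f_beta b n)).
  intros n _. apply (continuity_pt_mult (fun q => psi nb q v n - psi nb q v (S n)) (fun _ => f_beta b n)).
  - apply (continuity_pt_minus (fun q => psi nb q v n) (fun q => psi nb q v (S n))); apply psi_continuous; exact nb_sym.
  - apply continuity_pt_const. intros y z; reflexivity.
Qed.

(** Powers of [ln n] increase with the exponent only when [ln n >= 1]. For smaller [n] the lower
    power is at most [1], including the value [rpow 0 0 = 1] at [n = 1], and the factor [exp 1]
    absorbs it. *)
Lemma f_beta_compare b0 b n : 0 <= b0 <= b -> (1 <= n)%nat -> f_beta b0 n <= exp 1 * f_beta b n.
Proof.
  intros Hb Hn. destruct (Nat.eq_dec n 1) as [->|Hn1].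
  - unfold f_beta, rpow. rewrite INR_1, ln_1. destruct (Req_EM_T 0 0); [|lra].
    rewrite <- exp_plus. apply exp_le. destruct (Req_EM_T b0 0), (Req_EM_T b 0); lra.
  - rewrite !f_beta_val by lia. rewrite <- exp_plus. apply exp_le.
    assert (HL : 0 < ln (INR n)) by (rewrite <- ln_1; apply ln_increasing; [lra|apply lt_1_INR; lia]).
    pose proof (Rpower_pos (ln (INR n)) b).
    destruct (Rle_lt_dec 1 (ln (INR n))) as [H1|H1].
    + assert (Rpower (ln (INR n)) b0 <= Rpower (ln (INR n)) b) by (apply Rle_Rpower; lra). lra.
    + assert (Rpower (ln (INR n)) b0 <= 1); [|lra]. unfold Rpower. rewrite <- exp_0. apply exp_le.
      assert (ln (ln (INR n)) <= 0) by (rewrite <- ln_1; apply ln_le; lra). nra.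
Qed.

Lemma moment_compare psi b0 b N : (forall n, psi (S n) <= psi n) -> 0 <= b0 <= b ->
  moment psi b0 N <= exp 1 * moment psi b N.
Proof.
  intros Ha Hb. unfold moment. rewrite <- sum_scal. apply sum_le. intros n Hn. apply in_seq in Hn.
  replace (exp 1 * ((psi n - psi (S n)) * f_beta b n)) with ((psi n - psi (S n)) * (exp 1 * f_beta b n)) by ring.
  apply Rmult_le_compat_l; [specialize (Ha n); lra|]. apply f_beta_compare; auto; lia.
Qed.

Lemma nat_ceil x : 0 <= x -> exists m : nat, x < INR m <= x + 1.
Proof.
  intros Hx. destruct (archimed x) as [H1 H2]. exists (Z.to_nat (up x)).
  assert (0 <= up x)%Z by (apply le_IZR; lra).
  rewrite INR_IZR_INZ, Z2Nat.id by assumption. lra.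
Qed.

(** * Degenerate cases and the choice of parameters *)

Section Assembly.
Context {V : Type} (nb : V -> list V).
Context (nb_nodup : forall v, NoDup (nb v)).
Context (nb_sym : forall v w, In w (nb v) -> In v (nb w)).
Context (nb_irrefl : forall v, ~ In v (nb v)).
Context (Hconn : connected_graph nb) (Htrans : transitive_graph nb) (Hunim : unimodular nb).

Notation psi := (psi nb).
Notation wp := (walk_prob nb).

Lemma regular u v : length (nb u) = length (nb v).
Proof.
  destruct (Htrans v u) as [f [Hf <-]]. apply INR_eq.
  pose proof (sum_nb_aut nb nb_nodup f v (fun _ => 1) Hf) as H. rewrite !sum_const in H. lra.
Qed.

(** The walk may step to one fixed neighbour and back, [n] times. *)
Lemma return_lower d : (forall x, length (nb x) = d) -> (1 <= d)%nat ->
  forall v n, / INR d ^ (2 * n) <= wp (2 * n) v v.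
Proof.
  intros Hd Hd0 v n. assert (HdR : 1 <= INR d) by (apply (le_INR 1); exact Hd0).
  assert (Hid : 0 < / INR d) by (apply Rinv_0_lt_compat; lra).
  induction n as [|n IH].
  - simpl. rewrite ind_true by reflexivity. lra.
  - replace (2 * S n)%nat with (S (S (2 * n))) by lia.
    assert (Hz : exists z, In z (nb v)).
    { specialize (Hd v). destruct (nb v) as [|z l]; [simpl in Hd; lia|]. exists z; left; reflexivity. }
    destruct Hz as [z Hz].
    rewrite (wp_S nb d Hd). simpl pow. rewrite Rinv_mult. apply Rmult_le_compat_l; [lra|].
    apply Rle_trans with (wp (S (2 * n)) z v).
    + rewrite (wp_S nb d Hd), Rinv_mult. apply Rmult_le_compat_l; [lra|].
      eapply Rle_trans; [exact IH|].
      apply (sum_ge_term (nb z) (fun u => wp (2 * n) u v)); [intros; apply (wp_nonneg nb d Hd Hd0)|].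
      apply nb_sym; exact Hz.
    + apply (sum_ge_term (nb v) (fun u => wp (S (2 * n)) u v)); [intros; apply (wp_nonneg nb d Hd Hd0)|exact Hz].
Qed.

(** With a positive degree the return probability decays at most exponentially in time, against the
    faster decay imposed by [gamma > 1]. *)
Lemma superexponential_trivial gamma c v : 0 < c -> 1 < gamma -> HK nb gamma c -> length (nb v) = 0%nat.
Proof.
  intros Hc Hg Hhk. destruct (Nat.eq_dec (length (nb v)) 0) as [H|H]; [exact H|exfalso].
  set (d := length (nb v)) in *. assert (Hd : forall x, length (nb x) = d) by (intros; apply regular).
  assert (HdR : 1 <= INR d) by (apply (le_INR 1); lia).
  assert (Hld : 0 <= ln (INR d)) by (rewrite <- ln_1; apply ln_le; lra).
  (* Chosen so that [c * y = ln d + c] exceeds the exponential rate [ln d]. *)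
  set (y := ln (INR d) / c + 1).
  assert (Hy : 1 <= y).
  { unfold y. assert (0 <= ln (INR d) / c); [|lra]. apply Rmult_le_pos; [lra|left; apply Rinv_0_lt_compat; lra]. }
  destruct (INR_unbounded (Rpower y (/ (gamma - 1)))) as [n Hn].
  assert (Hn0 : (1 <= n)%nat).
  { apply INR_le. pose proof (Rpower_pos y (/ (gamma - 1))). assert (0 < INR n) by lra.
    destruct n; [simpl in *; lra|]. apply le_INR; lia. }
  set (x := INR (2 * n)).
  assert (Hxn : INR n <= x) by (unfold x; apply le_INR; lia).
  assert (Hx0 : 0 < x) by (unfold x; apply lt_0_INR; lia).
  assert (Hyx : y <= Rpower x (gamma - 1)).
  { replace y with (Rpower (Rpower y (/ (gamma - 1))) (gamma - 1)) by (rewrite Rpower_mult, Rinv_l, Rpower_1; lra).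
    apply Rpower_base_le; [lra|apply Rpower_pos|lra]. }
  pose proof (Hhk v (2 * n)%nat ltac:(lia)) as H1. fold x in H1.
  pose proof (return_lower d Hd ltac:(lia) v n) as H2.
  assert (H3 : / INR d ^ (2 * n) = exp (- (x * ln (INR d)))).
  { unfold x. rewrite <- ln_pow by lra. rewrite exp_Ropp, exp_ln; [reflexivity|]. apply pow_lt; lra. }
  rewrite H3 in H2. assert (H4 := Rle_trans _ _ _ H2 H1).
  assert (H5 : - (x * ln (INR d)) <= - c * Rpower x gamma).
  { apply Rnot_lt_le; intros Hlt. apply exp_increasing in Hlt. lra. }
  replace (Rpower x gamma) with (x * Rpower x (gamma - 1)) in H5.
  2:{ rewrite <- (Rpower_1 x) at 1 by exact Hx0. rewrite <- Rpower_plus. f_equal; lra. }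
  assert (H6 : x * (c * y) <= x * (c * Rpower x (gamma - 1))).
  { apply Rmult_le_compat_l; [lra|]. apply Rmult_le_compat_l; lra. }
  assert (c * y = ln (INR d) + c) by (unfold y; field; lra). nra.
Qed.

Lemma isolated_tail p v : 0 <= p <= 1 -> (forall x, length (nb x) = 0%nat) ->
  forall n, (2 <= n)%nat -> psi p v n = 0.
Proof.
  intros Hp Hd n Hn. rewrite (psi_Ex nb nb_sym p v n _ Hp (incl_refl _)).
  rewrite <- (Ex_cst nb p (ball nb v n) 0). apply Ex_ext; auto. intros w [_ Hw] _. apply ind_false.
  intros [L [H1 [H2 H3]]].
  assert (H : incl L [v]).
  { intros x Hx. apply H3 in Hx. apply clos_rt_rt1n in Hx. destruct Hx as [|y z Hvy _]; [left; reflexivity|].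
    exfalso. apply Hw in Hvy. unfold adj in Hvy. specialize (Hd v). destruct (nb v); [destruct Hvy|discriminate]. }
  apply NoDup_incl_length in H; auto. simpl in H; lia.
Qed.

(** For the one-point set [phi] is at most [p] times the degree, hence at most [1/2], and
    [1 / (1 - 1/2) = 2]. *)
Lemma small_p_tail p v : 0 <= p <= 1 -> p * INR (length (nb v)) <= / 2 -> forall n, INR n * psi p v n <= 2.
Proof.
  intros Hp Hpd n.
  assert (Hphi : phi nb p [v] v <= / 2).
  { eapply Rle_trans; [|exact Hpd]. unfold phi. apply Rmult_le_compat_l; [lra|].
    rewrite sum_cons. replace (sum [] _) with 0 by reflexivity. rewrite Rplus_0_r.
    rewrite <- (Rmult_1_r (INR (length (nb v)))), <- sum_const. apply sum_le. intros y _.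
    eapply Rle_trans; [apply ind_mul_le, Ex_ind_bound; auto|]. apply Ex_ind_bound; auto. }
  eapply Rle_trans; [apply (tail_from_phi nb nb_nodup nb_sym p [v] v Hp Htrans)|].
  - constructor; [simpl; tauto|constructor].
  - left; reflexivity.
  - lra.
  - simpl length. rewrite INR_1. unfold Rdiv. rewrite Rmult_1_l.
    apply Rle_trans with (/ / 2); [apply Rinv_le_contravar; lra|]. rewrite Rinv_inv; lra.
Qed.

(** Origin of [8 * Q]: with [T = 2^(2kQ)], both [2k] and [p^(-2k)] are at most [T], because
    [1/p <= 2M <= 2^Q], while [2^(-j) <= T^(-4)]. What is left is [T^(-2) <= exp(-k)]. *)
Lemma error_bound d M p k j Q : (1 <= d <= M)%nat -> 0 < p <= 1 -> / 2 < p * INR d -> (2 * M <= 2 ^ Q)%nat ->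
  (1 <= Q)%nat -> (8 * Q * k <= j)%nat ->
  INR (k + k) * / p ^ (k + k) * (2 * (INR d + 1) / (2 ^ j * p)) <= 4 * INR M * (INR M + 1) * exp (- INR k).
Proof.
  intros Hd Hp Hpd HMQ HQ Hj.
  assert (HdM : INR d <= INR M) by (apply le_INR; lia).
  assert (Hd1 : 1 <= INR d) by (apply (le_INR 1); lia).
  assert (Hip : / p <= 2 * INR M).
  { apply Rmult_le_reg_l with p; [lra|]. rewrite Rinv_r by lra. nra. }
  assert (Hip0 : 0 < / p) by (apply Rinv_0_lt_compat; lra).
  set (T := 2 ^ (2 * k * Q)). assert (HT : 0 < T) by (apply pow_lt; lra).
  assert (H1 : / p ^ (k + k) <= T).
  { rewrite <- pow_inv. apply Rle_trans with ((2 ^ Q) ^ (k + k)).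
    - apply pow_incr. split; [lra|]. eapply Rle_trans; [exact Hip|].
      apply le_INR in HMQ. rewrite mult_INR, pow_INR in HMQ. replace (INR 2) with 2 in HMQ by (simpl; lra). lra.
    - rewrite <- pow_mult. unfold T. right. f_equal. lia. }
  assert (H2 : INR (k + k) <= T).
  { apply Rle_trans with (INR (2 ^ (2 * k * Q))).
    - apply le_INR. pose proof (Nat.pow_gt_lin_r 2 (2 * k * Q) ltac:(lia)). nia.
    - rewrite pow_INR. simpl. unfold T. right; f_equal; lra. }
  assert (H3 : / 2 ^ j <= / (T * T * T * T)).
  { apply Rinv_le_contravar; [repeat apply Rmult_lt_0_compat; exact HT|]. unfold T. rewrite <- !pow_add.
    apply Rle_pow; [lra|]. lia. }
  assert (H4 : exp (INR k) <= T * T).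
  { unfold T. rewrite <- pow_add. apply Rle_trans with (2 ^ (2 * k)); [|apply Rle_pow; [lra|nia]].
    rewrite pow_mult. clear. induction k as [|k IH]; [simpl; rewrite exp_0; lra|].
    rewrite S_INR, exp_plus, <- tech_pow_Rmult, Rmult_comm. apply Rmult_le_compat; auto; try (left; apply exp_pos).
    pose proof exp_le_3. lra. }
  assert (H5 : / (T * T) <= exp (- INR k)).
  { rewrite exp_Ropp. apply Rinv_le_contravar; [apply exp_pos|exact H4]. }
  apply Rle_trans with (T * T * (2 * (INR M + 1) * (/ (T * T * T * T) * (2 * INR M)))).
  - apply Rmult_le_compat.
    + apply Rmult_le_pos; [apply pos_INR|]. left; apply Rinv_0_lt_compat, pow_lt; lra.
    + apply Rmult_le_pos; [lra|]. left; apply Rinv_0_lt_compat, Rmult_lt_0_compat; [apply pow_lt; lra|lra].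
    + apply Rmult_le_compat; auto; [apply pos_INR|]. left; apply Rinv_0_lt_compat, pow_lt; lra.
    + unfold Rdiv. apply Rmult_le_compat; [lra| |lra|].
      * left; apply Rinv_0_lt_compat, Rmult_lt_0_compat; [apply pow_lt; lra|lra].
      * rewrite Rinv_mult. apply Rmult_le_compat; [|lra|exact H3|exact Hip].
        left; apply Rinv_0_lt_compat, pow_lt; lra.
  - replace (T * T * (2 * (INR M + 1) * (/ (T * T * T * T) * (2 * INR M))))
      with (4 * INR M * (INR M + 1) * / (T * T)) by (field; lra).
    apply Rmult_le_compat_l; [|exact H5]. nra.
Qed.

(** [m] is the first integer above [C2 * L^(1/gamma)] with [L = ln s]: large enough for
    [c (2m)^gamma >= 2L], and at most [2 * C2 * L^(1/gamma)], so that [L / m] keeps the order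
    [L^(1 - 1/gamma)]. Also [k <= j <= L <= m], since [ln 4 > 1]. *)
Lemma scale_choice gamma c C2 k s j : 0 < c -> / 2 < gamma <= 1 -> 1 <= C2 -> Rpower (2 / c) (/ gamma) <= C2 ->
  (k <= j)%nat -> (1 <= j)%nat -> (4 ^ j <= s)%nat ->
  exists m, (k <= m)%nat /\ (1 <= m)%nat /\ 2 * ln (INR s) <= c * Rpower (INR (m + m)) gamma /\
    / (2 * C2) * INR k * Rpower (ln (INR s)) (- (/ gamma - 1)) <= INR k / INR m * ln (INR s).
Proof.
  intros Hc Hg HC2 HC2c Hkj Hj Hs. set (L := ln (INR s)).
  assert (HjL : INR j <= L).
  { apply Rle_trans with (ln (4 ^ j)).
    - rewrite ln_pow by lra. pose proof ln4_gt1. pose proof (pos_INR j). nra.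
    - apply ln_le; [apply pow_lt; lra|]. rewrite <- INR_pow4. apply le_INR; exact Hs. }
  assert (HL1 : 1 <= L) by (eapply Rle_trans; [|exact HjL]; apply (le_INR 1); exact Hj).
  assert (Hig : 1 <= / gamma) by (rewrite <- Rinv_1; apply Rinv_le_contravar; lra).
  set (P := Rpower L (/ gamma)).
  assert (HP : L <= P) by (unfold P; rewrite <- (Rpower_1 L) at 1 by lra; apply Rle_Rpower; lra).
  destruct (nat_ceil (C2 * P)) as [m [Hm1 Hm2]]; [nra|].
  assert (HmP : L <= INR m) by nra. assert (Hm0 : 0 < INR m) by lra.
  assert (Hm2' : INR m <= 2 * C2 * P) by nra.
  exists m. split; [|split; [|split]].
  - apply INR_le. apply le_INR in Hkj. lra.
  - apply INR_le. simpl. lra.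
  - assert (E : Rpower (C2 * P) gamma = Rpower C2 gamma * L).
    { rewrite <- Rpower_mult_distr by lra. f_equal. unfold P. rewrite Rpower_mult, Rinv_l, Rpower_1; lra. }
    assert (E2 : 2 / c <= Rpower C2 gamma).
    { replace (2 / c) with (Rpower (Rpower (2 / c) (/ gamma)) gamma).
      - apply Rpower_base_le; [lra|apply Rpower_pos|exact HC2c].
      - rewrite Rpower_mult, Rinv_l, Rpower_1; [reflexivity| |lra]. apply Rdiv_lt_0_compat; lra. }
    assert (E3 : Rpower (C2 * P) gamma <= Rpower (INR (m + m)) gamma).
    { apply Rpower_base_le; [lra|nra|]. rewrite plus_INR. lra. }
    rewrite E in E3. apply Rle_trans with (c * (2 / c * L)); [right; field; lra|].
    apply Rmult_le_compat_l; [lra|]. nra.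
  - assert (E : Rpower L (- (/ gamma - 1)) = L * / P).
    { unfold P. rewrite <- Rpower_Ropp. rewrite <- (Rpower_1 L) at 2 by lra. rewrite <- Rpower_plus. f_equal; lra. }
    rewrite E. assert (Hinv : / (2 * C2 * P) <= / INR m) by (apply Rinv_le_contravar; lra).
    replace (/ (2 * C2) * INR k * (L * / P)) with (INR k * L * / (2 * C2 * P)) by (field; lra).
    unfold Rdiv. replace (INR k * / INR m * L) with (INR k * L * / INR m) by ring.
    apply Rmult_le_compat_l; [|exact Hinv]. pose proof (pos_INR k). nra.
Qed.

Lemma self_consistent gamma c C2 M Q p v d : 0 < c -> / 2 < gamma <= 1 -> 1 <= C2 -> Rpower (2 / c) (/ gamma) <= C2 ->
  HK nb gamma c -> (forall x, length (nb x) = d) -> (1 <= d <= M)%nat -> 0 < p <= 1 -> / 2 < p * INR d ->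
  (2 * M <= 2 ^ Q)%nat -> (1 <= Q)%nat ->
  forall j, (1 <= j)%nat -> exists E, forall J, (j < J)%nat ->
    psi p v (4 ^ j) * psi p v (4 ^ j) <=
    sum (seq (4 ^ j) (4 ^ J + 1 - 4 ^ j)) (fun s => (psi p v s - psi p v (S s)) *
      exp (- (/ (2 * C2) * INR (j / (8 * Q)) * Rpower (ln (INR s)) (- (/ gamma - 1)))))
    + 4 * INR M * (INR M + 1) * exp (- INR (j / (8 * Q))) + psi p v (S (4 ^ J)) * E.
Proof.
  intros Hc Hg HC2 HC2c Hhk Hd HdM Hp Hpd HMQ HQ j Hj. set (k := (j / (8 * Q))%nat).
  assert (Hkj : (8 * Q * k <= j)%nat) by (unfold k; apply Nat.Div0.mul_div_le).
  (* Collects every term carrying the tail beyond [4^J]. It depends on [j] and [p], but not on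
     [J]. *)
  exists (1 + INR (k + k) * / p ^ (k + k) * 2). intros J HJ.
  assert (Hm : forall s, exists m, (4 ^ j <= s)%nat -> (k <= m)%nat /\ (1 <= m)%nat /\
    2 * ln (INR s) <= c * Rpower (INR (m + m)) gamma /\
    / (2 * C2) * INR k * Rpower (ln (INR s)) (- (/ gamma - 1)) <= INR k / INR m * ln (INR s)).
  { intros s. destruct (classic (4 ^ j <= s)%nat) as [Hs|Hs]; [|exists 0%nat; tauto].
    destruct (scale_choice gamma c C2 k s j) as [m Hm]; auto; [nia|]. exists m; auto. }
  set (m := fun s => proj1_sig (constructive_indefinite_description _ (Hm s))).
  assert (Hms : forall s, (4 ^ j <= s)%nat -> (k <= m s)%nat /\ (1 <= m s)%nat /\
    2 * ln (INR s) <= c * Rpower (INR (m s + m s)) gamma /\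
    / (2 * C2) * INR k * Rpower (ln (INR s)) (- (/ gamma - 1)) <= INR k / INR (m s) * ln (INR s)).
  { intros s. exact (proj2_sig (constructive_indefinite_description _ (Hm s))). }
  assert (Hp' : 0 <= p <= 1) by lra.
  pose proof (self_bound nb nb_nodup nb_sym nb_irrefl Htrans Hunim d Hd ltac:(lia) p Hp' gamma c v j J k m Hhk ltac:(lra) HJ) as H.
  specialize (H ltac:(intros s Hs; destruct (Hms s Hs) as [? [? [? _]]]; auto)).
  pose proof (error_bound d M p k j Q HdM Hp Hpd HMQ HQ Hkj) as Herr.
  assert (Hsum : sum (seq (4 ^ j) (4 ^ J + 1 - 4 ^ j)) (fun s =>
      (psi p v s - psi p v (S s)) * exp (- (INR k / INR (m s) * ln (INR s)))) <=
    sum (seq (4 ^ j) (4 ^ J + 1 - 4 ^ j)) (fun s => (psi p v s - psi p v (S s)) *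
      exp (- (/ (2 * C2) * INR k * Rpower (ln (INR s)) (- (/ gamma - 1)))))).
  { apply sum_le. intros s Hs. apply in_seq in Hs. apply Rmult_le_compat_l.
    - pose proof (psi_anti nb nb_sym p v s (S s) Hp' ltac:(lia)). lra.
    - apply exp_le. destruct (Hms s ltac:(lia)) as [_ [_ [_ H4]]]. lra. }
  rewrite Rmult_plus_distr_l in H. lra.
Qed.

End Assembly.

Theorem theorem1p2 :
  forall (gamma c : R) (M : nat),
    0 < c -> 1 / 2 < gamma ->
    forall beta : R, 0 <= beta -> beta < (2 * gamma - 1) / gamma ->
    exists C : R,
      forall (V : Type) (nb : V -> list V),
        (forall v, NoDup (nb v)) ->
        (forall v w, In w (nb v) -> In v (nb w)) ->
        (forall v, ~ In v (nb v)) ->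
        connected_graph nb ->
        transitive_graph nb ->
        unimodular nb ->
        (forall v, (deg nb v <= M)%nat) ->
        HK nb gamma c ->
        forall (v : V) (p : R), 0 <= p <= 1 -> le_pc nb p ->
          exp_moment_le nb p v beta C.
Proof.
  intros gamma c M Hc Hg beta Hb0 Hb1.
  destruct (Rle_lt_dec gamma 1) as [Hg1|Hg1].
  2:{ exists (exp 1). intros V nb nb_nodup nb_sym nb_irrefl Hconn Htrans Hunim HM Hhk v p Hp _.
      assert (Hd : forall x, length (nb x) = 0%nat).
      { intros x. apply (superexponential_trivial nb nb_nodup nb_sym Htrans gamma c); auto. }
      pose proof (isolated_tail nb nb_sym p v Hp Hd) as Hz.
      split.
      - intros eps Heps. exists 2%nat. change (psi nb p v 2 < eps). rewrite Hz by lia. exact Heps.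
      - intros N. change (moment (psi nb p v) beta N <= exp 1).
        apply Rle_trans with (sum (seq 1 N) (fun n => ind (1%nat = n) * exp 1)).
        + apply sum_le. intros n Hn. apply in_seq in Hn. destruct (Nat.eq_dec n 1) as [->|Hn1].
          * rewrite ind_true, Rmult_1_l by reflexivity. rewrite (Hz 2%nat) by lia. rewrite Rminus_0_r.
            apply Rle_trans with (1 * exp 1); [|lra]. apply Rmult_le_compat; try apply (psi_bound nb nb_sym p v 1 Hp).
            -- left; apply exp_pos.
            -- unfold f_beta, rpow. rewrite INR_1, ln_1. apply exp_le.
               destruct (Req_EM_T 0 0); [|lra]. destruct (Req_EM_T beta 0); lra.
          * rewrite !Hz by lia. rewrite ind_false by auto. lra.
        + pose proof (exp_pos 1). destruct N as [|N]; [unfold sum; simpl; lra|].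
          rewrite (sum_pick (seq 1 (S N)) 1%nat (fun _ => exp 1)); [lra|apply seq_NoDup|].
          apply in_seq; lia. }
  assert (Hg' : / 2 < gamma <= 1) by lra.
  assert (Hig : 1 <= / gamma) by (rewrite <- Rinv_1; apply Rinv_le_contravar; lra).
  assert (Hgap : (2 * gamma - 1) / gamma = 1 - (/ gamma - 1)) by (field; lra).
  assert (Hgap0 : 0 < (2 * gamma - 1) / gamma) by (apply Rdiv_lt_0_compat; lra).
  (* The midpoint stays below the critical exponent and is positive even when [beta] is [0], as the
     bootstrap requires. *)
  set (b := (beta + (2 * gamma - 1) / gamma) / 2).
  assert (Hb : 0 < b) by (unfold b; lra). assert (Hbb : beta <= b) by (unfold b; lra).
  assert (Hab : (/ gamma - 1) + b < 1) by (unfold b; lra).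
  set (C2 := Rmax 1 (Rpower (2 / c) (/ gamma))).
  assert (HC2 : 1 <= C2) by apply Rmax_l.
  assert (HC2c : Rpower (2 / c) (/ gamma) <= C2) by apply Rmax_r.
  set (Q := (2 * M + 1)%nat).
  assert (HQ : (2 * M <= 2 ^ Q)%nat) by (pose proof (Nat.pow_gt_lin_r 2 Q ltac:(lia)); unfold Q in *; lia).
  assert (Hk1 : 0 < / (2 * C2) <= 1).
  { split; [apply Rinv_0_lt_compat; lra|]. rewrite <- Rinv_1. apply Rinv_le_contravar; lra. }
  destruct (bootstrap (/ gamma - 1) b (/ (2 * C2)) (4 * INR M * (INR M + 1)) Q) as [C [dl [Hdl Hboot]]]; auto; try lra.
  { pose proof (pos_INR M). nra. }
  { unfold Q; lia. }
  (* For small [p] the linear tail holds with the uniform constant [X = 2], and this gives the bound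
     directly. *)
  destruct (linear_tail_moment b ltac:(lra)) as [Cl [HCl0 HCl]].
  exists (exp 1 * Rmax C (2 * Cl)).
  intros V nb nb_nodup nb_sym nb_irrefl Hconn Htrans Hunim HM Hhk v p Hp Hpc.
  set (d := length (nb v)).
  assert (Hd : forall x, length (nb x) = d) by (intros; apply regular; assumption).
  assert (Hanti : forall q, 0 <= q <= 1 -> forall n, psi nb q v (S n) <= psi nb q v n)
    by (intros; apply psi_anti; auto).
  assert (Hfinish : (forall eps, 0 < eps -> exists n, psi nb p v n < eps) ->
    (forall N, moment (psi nb p v) b N <= Rmax C (2 * Cl)) ->
    exp_moment_le nb p v beta (exp 1 * Rmax C (2 * Cl))).
  { intros H1 H2. split; [exact H1|]. intros N. change (moment (psi nb p v) beta N <= exp 1 * Rmax C (2 * Cl)).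
    eapply Rle_trans; [apply (moment_compare _ beta b); auto; lra|].
    apply Rmult_le_compat_l; [left; apply exp_pos|apply H2]. }
  destruct (Rle_lt_dec (p * INR d) (/ 2)) as [Hpd|Hpd].
  - pose proof (small_p_tail nb nb_nodup nb_sym Htrans p v Hp Hpd) as Htail. apply Hfinish.
    + intros eps Heps. destruct (INR_unbounded (2 / eps)) as [n Hn]. exists n.
      assert (H2e : 0 < 2 / eps) by (apply Rdiv_lt_0_compat; lra).
      apply Rmult_lt_reg_l with (INR n); [lra|]. eapply Rle_lt_trans; [apply Htail|].
      apply Rmult_lt_reg_r with (/ eps); [apply Rinv_0_lt_compat; exact Heps|].
      replace (INR n * eps * / eps) with (INR n) by (field; lra). exact Hn.
    + intros N. eapply Rle_trans; [apply (HCl (psi nb p v) 2)|apply Rmax_r]; auto.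
      intros n; apply psi_bound; auto.
  - assert (Hd0 : (1 <= d)%nat) by (destruct d; [simpl in Hpd; lra|lia]).
    assert (HdM : (1 <= d <= M)%nat) by (split; [exact Hd0|apply HM]).
    assert (HdR : 1 <= INR d) by (apply (le_INR 1); exact Hd0).
    (* Strictly below [p] the a priori tail is available; the lower limit on [q] keeps
       [q * d > 1/2], hence [1/q] bounded in terms of [M]. *)
    assert (Hbelow : forall q, / (2 * INR d) < q < p ->
      (forall N, moment (psi nb q v) b N <= C) /\ (forall j, psi nb q v (4 ^ j) <= dl j)).
    { intros q [Hq1 Hq2]. assert (Hi0 : 0 < / (2 * INR d)) by (apply Rinv_0_lt_compat; lra).
      apply Hboot.
      - intros n; apply psi_bound; auto; lra.
      - apply Hanti; lra.
      (* The midpoint is above [q] and below [p], so [le_pc] excludes an infinite cluster there. *)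
      - apply (subcritical_tail nb nb_nodup nb_sym q ((q + p) / 2)); auto; try lra.
        intros Hinf. specialize (Hpc ((q + p) / 2) ltac:(lra) Hinf). lra.
      - apply (self_consistent nb nb_nodup nb_sym nb_irrefl Htrans Hunim gamma c C2 M Q q v d); auto; try lra.
        + apply Rmult_lt_reg_r with (/ INR d); [apply Rinv_0_lt_compat; lra|].
          replace (q * INR d * / INR d) with q by (field; lra). rewrite <- Rinv_mult. exact Hq1.
        + unfold Q; lia. }
    assert (Hpd' : / (2 * INR d) < p).
    { rewrite Rinv_mult. apply Rmult_lt_reg_r with (INR d); [lra|].
      rewrite Rmult_assoc, Rinv_l by lra. lra. }
    apply Hfinish.
    + intros eps Heps. destruct (Hdl (eps / 2) ltac:(lra)) as [j Hj]. exists (4 ^ j)%nat.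
      apply Rle_lt_trans with (dl j); [|lra].
      apply (continuity_le_left (fun q => psi nb q v (4 ^ j)) p (/ (2 * INR d))); auto.
      * apply psi_continuous; exact nb_sym.
      * intros q Hq. apply (Hbelow q Hq).
    + intros N. eapply Rle_trans; [|apply Rmax_l].
      apply (continuity_le_left (fun q => moment (psi nb q v) b N) p (/ (2 * INR d))); auto.
      * apply moment_continuous; exact nb_sym.
      * intros q Hq. apply (Hbelow q Hq).
Qed.
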